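(* There exists a constant $c>0$ such that for every planar graph $G$, the graph $\mathcal{K}_5(G)$ has diameter $O(|V(G)|^c)$; that is, there exist constants $c, C>0$ such that for every planar graph $G$ and any two proper $5$-colorings $\alpha,\beta$ of $G$, the coloring $\beta$ can be obtained from $\alpha$ by a sequence of at most $C\,|V(G)|^c$ K-changes.
   Context: All graphs are finite and simple. For an integer $k\ge 1$, a proper $k$-coloring of $G$ is a map $V(G)\to\{1,\dots,k\}$ giving adjacent vertices distinct colors. Given a proper coloring and two colors $a,b$, a Kempe chain in colors $\{a,b\}$ is a maximal connected subgraph $B$ of $G$ all of whose vertices have color $a$ or $b$; swapping colors $a$ and $b$ on all vertices of $B$ yields a new proper coloring, and this operation is called a K-change. $\mathcal{K}_k(G)$ is the graph whose vertex set is the set of proper $k$-colorings of $G$, with an edge between $\alpha$ and $\beta$ whenever $\beta$ can be obtained from $\alpha$ by a single K-change. *)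

(* Defs.v *)
From HB Require Import structures.
From mathcomp Require Import all_boot all_order all_algebra all_fingroup.

Set Implicit Arguments.
Unset Strict Implicit.
Unset Printing Implicit Defensive.

Import Order.TTheory GRing.Theory Num.Theory.

Record sgraph := SGraph {
  svertex :> finType;
  sedge : rel svertex;
  sg_sym : symmetric sedge;
  sg_irrefl : irreflexive sedge }.

Section Kempe.
Variables (G : sgraph) (k : nat).
Implicit Types (f g : {ffun G -> 'I_k}) (a b : 'I_k) (B : {set G}).

Definition proper_coloring f :=
  [forall x : G, forall y : G, sedge x y ==> (f x != f y)].

(* The subgraph of G induced by B is nonempty and connected. *)
Definition connected_in B :=
  (B != set0) &&
  [forall x in B, forall y in B,
     connect [rel u v : G | [&& u \in B, v \in B & sedge u v]] x y].

Definition bicolored f a b B :=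
  [forall x in B, (f x == a) || (f x == b)].

(* A maximal connected subgraph is induced, so a Kempe chain is represented
   by its vertex set. *)
Definition kempe_chain f a b B :=
  maxset (fun B' => connected_in B' && bicolored f a b B') B.

Definition kempe_swap f a b B : {ffun G -> 'I_k} :=
  [ffun x => if x \in B then tperm a b (f x) else f x].

Definition kchange f g :=
  [exists a : 'I_k, exists b : 'I_k, exists B : {set G},
    [&& a != b, kempe_chain f a b B & g == kempe_swap f a b B]].

Lemma bicolored_swap f a b B B' :
  bicolored (kempe_swap f a b B) a b B' = bicolored f a b B'.
Proof.
apply: eq_forallb_in => x _; rewrite ffunE; case: ifP => // _.
by case: tpermP => [->|->|/eqP/negPf-> /eqP/negPf->]; rewrite ?eqxx ?orbT.
Qed.

Lemma kempe_swapK f a b B : kempe_swap (kempe_swap f a b B) a b B = f.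
Proof.
by apply/ffunP => x; rewrite !ffunE; case: (x \in B); rewrite ?tpermK.
Qed.

Lemma kchange_sym : symmetric kchange.
Proof.
suff imp : forall f g, kchange f g -> kchange g f by move=> f g; apply/idP/idP; apply: imp.
move=> f g /existsP[a /existsP[b /existsP[B /and3P[ab fB /eqP->]]]].
apply/existsP; exists a; apply/existsP; exists b; apply/existsP; exists B.
rewrite ab kempe_swapK eqxx andbT /=.
congr is_true: fB; apply: maxset_eq => B'; by rewrite bicolored_swap.
Qed.

Lemma kchange_irrefl : irreflexive kchange.
Proof.
move=> f; case ffB: (kchange f f) => //; move: ffB => /existsP[a] /existsP[b] /existsP[B].
case/and3P=> ab fB /eqP ff; exfalso.
have /andP[/andP[/set0Pn[x xB] _] /forall_inP/(_ x xB) fx] := maxsetp fB.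
move/ffunP/(_ x): ff; rewrite ffunE xB => ffx; move/negP: ab; apply.
by case/orP: fx => /eqP fx; move: ffx; rewrite fx ?tpermL ?tpermR => ->.
Qed.

Lemma kempe_chain_closed f a b B x y :
  kempe_chain f a b B -> x \in B -> sedge x y -> (f y == a) || (f y == b) ->
  y \in B.
Proof.
move=> /maxsetP[/andP[/andP[_ Bc] Bab] Bmax] xB xy fy.
rewrite -(Bmax (y |: B)) ?setU11 ?subsetUr //.
pose r := [rel u v : G | [&& u \in y |: B, v \in y |: B & sedge u v]].
have rsym : connect_sym r.
  by apply: sym_connect_sym => u v; rewrite /r /= andbCA sg_sym.
have toB u : u \in y |: B -> connect r x u.
  rewrite in_setU1 => /orP[/eqP->|uB].
    by apply: connect1; rewrite /r /= setU11 setU1r.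
  have := forall_inP (forall_inP Bc x xB) u uB; apply: connect_sub => v w /=.
  by case/and3P=> vB wB vw; apply: connect1; rewrite /r /= !setU1r.
apply/andP; split; first apply/andP; first split.
- by apply/set0Pn; exists y; rewrite setU11.
- apply/forall_inP => u uB; apply/forall_inP => v vB.
  by apply: (connect_trans _ (toB v vB)); rewrite rsym; apply: toB.
- apply/forall_inP => u; rewrite in_setU1 => /orP[/eqP->//|uB].
  exact: (forall_inP Bab).
Qed.

Lemma kempe_swap_proper f a b B :
  proper_coloring f -> kempe_chain f a b B ->
  proper_coloring (kempe_swap f a b B).
Proof.
move=> /forallP fP fB; have /andP[_ /forall_inP Bab] := maxsetp fB.
have mixed x y : x \in B -> y \notin B -> sedge x y -> tperm a b (f x) != f y.
  move=> xB yB xy; apply: contraNneq yB => fxy.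
  apply: (kempe_chain_closed fB xB xy); rewrite -fxy.
  by case/orP: (Bab x xB) => /eqP->; rewrite ?tpermL ?tpermR eqxx ?orbT.
apply/forallP => x; apply/forallP => y; apply/implyP => xy; rewrite !ffunE.
have fxy : f x != f y by apply: (implyP (forallP (fP x) y)).
case: (boolP (x \in B)) => xB; case: (boolP (y \in B)) => yB //.
- by rewrite (inj_eq perm_inj).
- exact: mixed.
- by rewrite eq_sym; apply: mixed; rewrite // sg_sym.
Qed.

Definition coloring := {f : {ffun G -> 'I_k} | proper_coloring f}.

Definition kempe_adj : rel coloring := fun x y => kchange (val x) (val y).

Lemma kempe_adj_sym : symmetric kempe_adj.
Proof. by move=> x y; apply: kchange_sym. Qed.

Lemma kempe_adj_irrefl : irreflexive kempe_adj.
Proof. by move=> x; apply: kchange_irrefl. Qed.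

Definition kempe_graph : sgraph := SGraph kempe_adj_sym kempe_adj_irrefl.

End Kempe.

From mathcomp Require Import all_classical all_reals all_analysis.
Import numFieldNormedType.Exports.

Section Planarity.
Local Open Scope classical_set_scope.
Local Open Scope ring_scope.
Variable R : realType.

Definition is_arc (p q : R * R) (A : set (R * R)) :=
  exists gamma : R -> R * R,
    [/\ {within `[0, 1], continuous gamma},
        {in `[0, 1] &, injective gamma},
        gamma 0 = p, gamma 1 = q & A = gamma @` `[0, 1]].

(* A drawing of G in the plane without crossings: pos x is the point
   representing the vertex x and arc x y the arc representing the edge xy
   (unconstrained when x and y are not adjacent).  The last two conditions say
   that the interior of an edge contains no vertex and no point of any other
   edge. *)
Definition plane_drawing (G : sgraph) (pos : G -> R * R)
    (arc : G -> G -> set (R * R)) :=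
  [/\ injective pos,
      forall x y, sedge x y ->
        is_arc (pos x) (pos y) (arc x y) /\ arc y x = arc x y,
      forall x y z, sedge x y -> arc x y (pos z) -> z = x \/ z = y
    & forall x y z w, sedge x y -> sedge z w ->
        (z, w) <> (x, y) -> (z, w) <> (y, x) ->
        (arc x y `\` [set pos x; pos y]) `&` arc z w = set0].

Definition planar (G : sgraph) := exists pos arc, @plane_drawing G pos arc.

End Planarity.

(* Main.v *)
(** Proof idea.  Approximating a drawing by a fine grid, a planar graph is a minor
    of a grid, hence is carried by a planar combinatorial map.  In such a map a
    vertex [v] can be deleted and its neighbors merged along any noncrossing
    partition of its rotation.  If there are at most four blocks, recolorings of
    the smaller map lift: [v] follows, changing at most once per change of a block.
    At a vertex of degree at most 6, boundedly many Kempe changes make a coloring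
    constant on the blocks of such a partition.  In a large map, linearly many
    vertices of degree at most 6 are far apart and have few neighbors of large
    degree; split them into two halves, reduce [alpha] along the first half and
    [beta] along the second one.  A coloring [gamma] compatible with all the merges
    exists by the five color theorem, and the comparisons of [alpha] and [beta]
    with [gamma] take place in maps smaller by a constant factor: this gives a
    recursion [t(w) <= 10 t((1 - 1/N) w) + 62 w] with a polynomial solution.  The
    remaining bounded maps are handled by Meyniel's theorem that all 5-colorings of
    a planar graph are Kempe equivalent. *)

Require Import Defs.
From mathcomp Require Import all_boot all_order all_algebra all_fingroup.
From mathcomp Require Import zify ring lra.

Set Implicit Arguments.
Unset Strict Implicit.
Unset Printing Implicit Defensive.

(** * Planar combinatorial maps *)

(** Distances are measured by how often each single vertex changes color, not by the number of
    K-changes: undoing a merge at [v] costs only [v], which follows at most four blocks. If the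
    merged vertices are pairwise nonadjacent, none of them follows another, so a whole linear-size
    family costs one factor 5 for each of the two colorings, whence the 10 of the recursion. The
    obstacle is [gamma]: the blocks come from two unrelated colorings, yet all merges together must
    create no loop. When the family is spread out, a neighbor of bounded degree belongs to one
    vertex of the family only, but a neighbor of large degree may be shared by many. This is why the
    degree plus the number of large neighbors is asked to be at most 6: a vertex with more than four
    neighbors then has at most one large neighbor, and a vertex with at most four merges nothing.
    The recoloring at degree 5 or 6 is a finite game against all noncrossing patterns of Kempe
    chains, decided by computation. A merge changes the map from darts to vertices but never the
    vertex type, so colorings of all reduced maps are functions on the same set. *)

Section CombinatorialMaps.
Local Open Scope group_scope.

(** * Counting equivalence classes *)

Section ClassCount.
Variable T : finType.

Definition eclass (r : rel T) x := [set y | r x y].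
Definition classes (r : rel T) := [set eclass r x | x : T].

Lemma eclass_eq (r : rel T) x y : equivalence_rel r ->
  (eclass r x == eclass r y) = r x y.
Proof.
move=> er; apply/eqP/idP => [xy|xy].
  have : y \in eclass r y by rewrite inE; have [-> _] := er y y y.
  by rewrite -xy inE.
by apply/setP=> z; rewrite !inE; have [_ ->] := er x y z.
Qed.

Lemma card_classes_link (r r' : rel T) x y :
  equivalence_rel r -> equivalence_rel r' ->
  (forall u w, r' u w = [|| r u w, r u x && r y w | r u y && r x w]) ->
  #|classes r'| + ~~ r x y = #|classes r|.
Proof.
move=> er er' r'E.
have rr u : r u u by have [] := er u u u.
have rC u w : r u w = r w u.
  apply/idP/idP=> h; [have [_ <-//] := er u w u | have [_ <-//] := er w u w];
  by rewrite ?rr.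
case: (boolP (r x y)) => xy /=.
  rewrite addn0; congr #|pred_of_set _|; apply: eq_imset => u; apply/setP=> w; rewrite !inE r'E.
  case: (boolP (r u w)) => //= nuw; apply/negbTE; rewrite negb_or.
  apply/andP; split; apply: contra nuw => /andP[].
    by move=> ux yw; have [_ ->] := er u x w => //; have [_ ->] := er x y w.
  move=> uy xw; have [_ ->] := er u y w => //.
  by rewrite rC in xy; have [_ ->] := er y x w.
rewrite addn1.
have -> : classes r' = (eclass r x :|: eclass r y) |: (classes r :\ eclass r x :\ eclass r y).
  apply/setP=> A; apply/imsetP/setU1P=> [[u _ ->]|].
    have [ux|nux] := boolP (r u x).
      left; apply/setP=> w; rewrite !inE r'E ux /=.
      have [_ ->//] := er u x w.
      by rewrite (negbTE (_ : ~~ r u y)) ?orbF //; apply: contra xy=> uy; have [_ <-] := er u x y.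
    have [uy|nuy] := boolP (r u y).
      left; apply/setP=> w; rewrite !inE r'E uy (negbTE nux) /=.
      by have [_ ->//] := er u y w; rewrite orbC.
    right; have <- : eclass r u = eclass r' u.
      by apply/setP=> w; rewrite !inE r'E (negbTE nux) (negbTE nuy) !orbF.
    by rewrite !in_setD1 !eclass_eq // nux nuy imset_f.
  case=> [->|].
    exists x => //; apply/setP=> w; rewrite !inE r'E rr (negbTE xy) /=.
    by rewrite orbF.
  rewrite !in_setD1 => /and3P[Ay Ax /imsetP[u _ AE]]; subst A.
  rewrite !eclass_eq // in Ax Ay.
  exists u => //; apply/setP=> w.
  by rewrite !inE r'E (negbTE Ax) (negbTE Ay) !orbF.
have xNy : eclass r x != eclass r y by rewrite eclass_eq.
have xin : eclass r x \in classes r by rewrite imset_f.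
have yin : eclass r y \in classes r by rewrite imset_f.
set C := classes r in xin yin *.
rewrite (cardsD1 (eclass r x) C) xin (cardsD1 (eclass r y) (C :\ _)).
rewrite in_setD1 eq_sym xNy yin cardsU1.
suff -> : (eclass r x :|: eclass r y) \notin C :\ eclass r x :\ eclass r y by rewrite !add1n.
rewrite !in_setD1; apply/negP=> /and3P[Ay _ /imsetP[u _ AE]].
case/eqP: Ay; rewrite AE; apply/eqP; rewrite eclass_eq //.
have : y \in eclass r x :|: eclass r y by rewrite !inE rr orbT.
by rewrite AE inE.
Qed.

(** Every class has total weight one. In this form Euler's formula becomes a sum of local weights
    over the darts. *)
Lemma card_classes_sum (r : rel T) : equivalence_rel r ->
  (#|classes r|%:R = \sum_x (#|eclass r x|%:R)^-1 :> rat)%R.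
Proof.
move=> er.
have rr u : r u u by have [] := er u u u.
have -> : (\sum_x (#|eclass r x|%:R)^-1 = \sum_(A in classes r) \sum_(x | eclass r x == A) (#|eclass r x|%:R)^-1 :> rat)%R.
  by apply: partition_big => x _; rewrite imset_f.
rewrite (eq_bigr (fun _ => 1%R)) => [|A /imsetP[u _ ->]].
  by rewrite GRing.sumr_const.
rewrite (eq_bigr (fun _ => (#|eclass r u|%:R)^-1%R)) => [|x /eqP -> //].
rewrite GRing.sumr_const.
have -> : #|[pred x | eclass r x == eclass r u]| = #|eclass r u|.
  apply: eq_card => x; rewrite !inE eclass_eq //.
  by apply/idP/idP=> h; [have [_ <-//] := er x u x | have [_ <-//] := er u x u].
rewrite -[LHS]GRing.mulr_natl GRing.divff // Num.Theory.pnatr_eq0 -lt0n.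
by apply/card_gt0P; exists u; rewrite inE.
Qed.

End ClassCount.

(** * Euler's formula for pairs of permutations *)

Section PlanarPermutations.
Variable D : finType.
Implicit Types (e n s : {perm D}) (x y u w : D).

Lemma porbit_equiv s : equivalence_rel (fun x y => y \in porbit s x).
Proof.
move=> x y z; split; first exact: porbit_id.
by rewrite porbit_sym -eq_porbit_mem => /eqP ->.
Qed.

Lemma porbits_classes s : porbits s = classes (fun x y => y \in porbit s x).
Proof. by apply: eq_imset => x; apply/setP=> y; rewrite inE. Qed.

Lemma mem_porbit1 s x : s x \in porbit s x.
Proof. by have := mem_porbit s 1 x; rewrite expg1. Qed.

Lemma porbit_step s x y : (s y \in porbit s x) = (y \in porbit s x).
Proof.
have E : porbit s (s y) = porbit s y by have := porbit_perm s 1 y; rewrite expg1.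
by rewrite porbit_sym E porbit_sym.
Qed.

Lemma porbit_ind s x (P : pred D) :
  P x -> (forall u, P u -> P (s u)) -> forall y, y \in porbit s x -> P y.
Proof.
move=> Px Ps y /porbitP[i ->]; elim: i => [|i IH]; first by rewrite expg0 perm1.
by rewrite expgSr permM; apply: Ps.
Qed.

Definition comp_step e n : rel D := fun x y => (y == e x) || (y == n x).
Definition comp e n : rel D := connect (comp_step e n).

Lemma comp_e e n x : comp e n x (e x).
Proof. by apply: connect1; rewrite /comp_step eqxx. Qed.

Lemma comp_n e n x : comp e n x (n x).
Proof. by apply: connect1; rewrite /comp_step eqxx orbT. Qed.

Lemma comp_ind e n x (P : pred D) :
  P x -> (forall u, P u -> P (e u)) -> (forall u, P u -> P (n u)) ->
  forall y, comp e n x y -> P y.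
Proof.
move=> Px Pe Pn y /connectP[q]; elim: q x Px => [x Px _ -> //|z q IH x Px] /=.
by case/andP=> /orP[] /eqP -> pq lq; apply: (IH _ _ pq lq); auto.
Qed.

Lemma comp_porbit (e n s : {perm D}) x y :
  (forall u, comp e n u (s u)) -> y \in porbit s x -> comp e n x y.
Proof.
move=> H; apply: (@porbit_ind s x (comp e n x)); first exact: connect0.
by move=> u xu; apply: connect_trans xu (H u).
Qed.

Lemma comp_sym e n x y : comp e n x y = comp e n y x.
Proof.
suff H u w : comp e n u w -> comp e n w u by apply/idP/idP; apply: H.
apply: (@comp_ind e n u (fun w => comp e n w u)); first exact: connect0.
  move=> z zu; apply: connect_trans zu.
  by apply: (@comp_porbit e n e); [move=> ?; apply: comp_e | rewrite porbit_sym mem_porbit1].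
move=> z zu; apply: connect_trans zu.
by apply: (@comp_porbit e n n); [move=> ?; apply: comp_n | rewrite porbit_sym mem_porbit1].
Qed.

Lemma comp_equiv e n : equivalence_rel (comp e n).
Proof.
move=> x y z; split; first exact: connect0.
move=> xy; apply/idP/idP; last exact: connect_trans.
by apply: connect_trans; rewrite -/(comp _ _ _ _) comp_sym.
Qed.

Definition ncomp e n := #|classes (comp e n)|.

(* The orbits of [e], [n] and [n * e] are the edges, vertices and faces of the map:
   this is Euler's formula, the reverse inequality being [euler_inequality]. *)
Definition planar_perm e n :=
  #|D| + (ncomp e n).*2 <= #|porbits e| + #|porbits n| + #|porbits (n * e)|.

Lemma mem_porbit_tperm n x y : x \notin porbit n y ->
  x \in porbit (tperm x y * n) y.
Proof.
move=> xy; have xNy : x != y by apply: contraNneq xy => ->; apply: porbit_id.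
have := porbits_mul_tperm n x y; have := porbits_mul_tperm (tperm x y * n) x y.
rewrite /= mulgA tperm2 mul1g xy xNy /=.
by case: (x \in _) => //=; lia.
Qed.

Lemma comp_tperm e n x y u w : x \notin porbit n y ->
  comp e (tperm x y * n) u w =
  [|| comp e n u w, comp e n u x && comp e n y w | comp e n u y && comp e n x w].
Proof.
move=> xy; set n' := tperm x y * n.
have t1 : comp e n' x y.
  rewrite comp_sym; apply: (@comp_porbit e n' n'); first by move=> ?; apply: comp_n.
  exact: mem_porbit_tperm.
have tr a b c : comp e n' a b -> comp e n' b c -> comp e n' a c by apply: connect_trans.
have sub a b : comp e n a b -> comp e n' a b.
  apply: (@comp_ind e n a (comp e n' a)); first exact: connect0.
    by move=> z az; apply: (tr _ _ _ az); apply: comp_e.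
  move=> z az; apply: (tr _ _ _ az).
  have := comp_n e n' (tperm x y z); rewrite /n' permM tpermK.
  case: tpermP => [->|->|_ _] //; first exact: (tr _ _ _ t1).
  by apply: tr; rewrite comp_sym.
apply/idP/idP; last first.
  case/or3P=> [/sub //|/andP[/sub ux /sub yw]|/andP[/sub uy /sub xw]].
    exact: (tr _ _ _ ux (tr _ _ _ t1 yw)).
  by apply: (tr _ _ _ uy); apply: (tr _ _ _ _ xw); rewrite comp_sym.
have tr1 a b c : comp e n a b -> comp e n b c -> comp e n a c by apply: connect_trans.
pose P w := [|| comp e n u w, comp e n u x && comp e n y w | comp e n u y && comp e n x w].
have ext a b : P a -> comp e n a b -> P b.
  rewrite /P => /or3P[ua|/andP[-> ya]|/andP[-> xa]] ab.
  - by rewrite (tr1 _ _ _ ua ab).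
  - by rewrite (tr1 _ _ _ ya ab) orbT.
  - by rewrite (tr1 _ _ _ xa ab) !orbT.
apply: (@comp_ind e n' u P); rewrite /P; first by rewrite /comp connect0.
  by move=> z /ext; apply; apply: comp_e.
move=> z Pz; rewrite /n' permM.
suff /ext : P (tperm x y z) by apply; apply: comp_n.
case: tpermP => [zx|zy|_ _] //; rewrite ?zx ?zy in Pz *; rewrite /P.
  have yy : comp e n y y by apply: connect0.
  case/or3P: Pz => [->|/andP[-> _]|/andP[-> _]]; by rewrite ?yy ?orbT.
have xx : comp e n x x by apply: connect0.
case/or3P: Pz => [->|/andP[-> _]|/andP[-> _]]; by rewrite ?xx ?orbT.
Qed.

Lemma ncomp_tperm e n x y : x \notin porbit n y ->
  ncomp e (tperm x y * n) + ~~ comp e n x y = ncomp e n.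
Proof.
move=> xy; apply: card_classes_link; try exact: comp_equiv.
by move=> u w; apply: comp_tperm.
Qed.

Lemma face_tperm e n x y : tperm x y * n * e = tperm x y * (n * e).
Proof. by rewrite mulgA. Qed.

Lemma comp_face e n x y : y \in porbit (n * e) x -> comp e n x y.
Proof.
apply: comp_porbit => u; rewrite permM.
exact: connect_trans (comp_n _ _ _) (comp_e _ _ _).
Qed.

Lemma comp_rot e n x y : y \in porbit n x -> comp e n x y.
Proof. by apply: comp_porbit => u; apply: comp_n. Qed.

Lemma porbits_one : #|porbits (1 : {perm D})| = #|D|.
Proof.
rewrite card_imset // => x y /setP/(_ x); rewrite porbit_id => /esym.
by move=> /porbitP[i ->]; rewrite expg1n perm1.
Qed.

Lemma ncomp_one e : ncomp e 1 = #|porbits e|.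
Proof.
rewrite porbits_classes /ncomp; congr #|pred_of_set _|.
apply: eq_imset => x; apply/setP=> y; rewrite !inE; apply/idP/idP.
  apply: (@comp_ind e 1 x (fun y => y \in porbit e x)); first exact: porbit_id.
    by move=> u; rewrite porbit_step.
  by move=> u; rewrite perm1.
by apply: comp_porbit => u; apply: comp_e.
Qed.

(** Induction on the number of steps from [n] to the identity: [y = n x] is detached as a fixed
    point, giving [n1]. Going back, if [x] and [y] are already connected, the vertex count drops by
    one and the face count rises by at most one; otherwise vertices, faces and components all drop
    by one. For [n = 1] equality holds. *)
Lemma euler_inequality e n :
  #|porbits e| + #|porbits n| + #|porbits (n * e)| <= #|D| + (ncomp e n).*2.
Proof.
have [k] := ubnP (#|D| - #|porbits n|); elim: k n => // k IH n lek.
have [n1|] := boolP [forall x, n x == x].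
  have -> : n = 1 by apply/permP=> x; rewrite perm1; apply/eqP/(forallP n1).
  by rewrite porbits_one mul1g ncomp_one; lia.
case/forallPn=> x nx; pose y := n x; pose n1 := tperm x y * n.
have nE : n = tperm x y * n1 by rewrite mulgA tperm2 mul1g.
have yfix : n1 y = y by rewrite permM tpermR.
have xy : x \notin porbit n1 y.
  apply/negP=> /porbitP[i]; rewrite permX.
  have -> : iter i n1 y = y by elim: i => //= i ->.
  by apply/eqP; rewrite eq_sym.
have xNy : x != y by rewrite eq_sym.
have cn := ncomp_tperm e xy; rewrite -nE in cn.
have pn := porbits_mul_tperm n1 x y; rewrite /= -nE xNy xy in pn.
have pf := porbits_mul_tperm (n1 * e) x y.
rewrite /= -face_tperm -nE xNy in pf.
have le1 : #|D| - #|porbits n1| < k.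
  have : #|porbits n1| <= #|D| by apply: leq_imset_card.
  by move: pn lek => /=; lia.
have := IH _ le1; move: pn pf cn => /=.
case: (boolP (comp e n1 x y)) => cxy /=; first by case: (x \in _) => /=; lia.
have -> : x \notin porbit (n1 * e) y.
  by apply: contra cxy => h; rewrite comp_sym; apply: comp_face.
by move=> /=; lia.
Qed.

(** The vertex count rises by one. The face count drops by one only if the two new vertices lie on a
    common face, and then the number of components is unchanged; otherwise the face count rises by
    one, which pays for a possible new component. *)
Lemma planar_split e n x y : planar_perm e n -> x \in porbit n y ->
  planar_perm e (tperm x y * n).
Proof.
rewrite /planar_perm => pl xy; have [<-|xNy] := eqVneq x y.
  by rewrite tperm1 mul1g.
set n1 := tperm x y * n.
have nE : n = tperm x y * n1 by rewrite mulgA tperm2 mul1g.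
have pn := porbits_mul_tperm n x y; rewrite /= xy xNy -/n1 in pn.
have xy1 : x \notin porbit n1 y.
  by have := porbits_mul_tperm n1 x y; rewrite /= -nE xNy; case: (x \in _) => //=; lia.
have cn := ncomp_tperm e xy1; rewrite -nE in cn.
have pf := porbits_mul_tperm (n1 * e) x y; rewrite /= -face_tperm -nE xNy in pf.
move: pl pn cn pf; case: (boolP (x \in porbit (n1 * e) y)) => h /=; last first.
  by case: (comp e n1 x y) => /=; lia.
by rewrite comp_sym comp_face //=; lia.
Qed.

Lemma planar_merge_face e n x y : planar_perm e n -> x \notin porbit n y ->
  x \in porbit (n * e) y -> planar_perm e (tperm x y * n).
Proof.
rewrite /planar_perm => pl xy xf.
have xNy : x != y by apply: contraNneq xy => ->; apply: porbit_id.
have := porbits_mul_tperm n x y; have := ncomp_tperm e xy.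
have := porbits_mul_tperm (n * e) x y; rewrite /= xy xNy xf -face_tperm /=.
by move: pl; case: (comp _ _ _ _) => /=; lia.
Qed.

Lemma planar_merge_comp e n x y : planar_perm e n -> ~~ comp e n x y ->
  planar_perm e (tperm x y * n).
Proof.
rewrite /planar_perm => pl cxy.
have xy : x \notin porbit n y.
  by apply: contra cxy => h; rewrite comp_sym; apply: comp_rot.
have xNy : x != y by apply: contraNneq xy => ->; apply: porbit_id.
have := porbits_mul_tperm n x y; have := ncomp_tperm e xy.
have := porbits_mul_tperm (n * e) x y; rewrite /= xy xNy cxy -face_tperm /=.
by move: pl; case: (x \in _) => /=; lia.
Qed.

(* Planarity means equality in Euler's inequality; splitting a vertex between
   two corners of the same face would otherwise violate that inequality. *)
Lemma planar_split_disconnects e n x y : planar_perm e n -> x != y ->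
  x \in porbit n y -> x \in porbit (n * e) y -> ~~ comp e (tperm x y * n) x y.
Proof.
rewrite /planar_perm => pl xNy xy xf; set n1 := tperm x y * n.
have nE : n = tperm x y * n1 by rewrite mulgA tperm2 mul1g.
have pn := porbits_mul_tperm n x y; rewrite /= xy xNy -/n1 in pn.
have xy1 : x \notin porbit n1 y.
  by have := porbits_mul_tperm n1 x y; rewrite /= -nE xNy; case: (x \in _) => //=; lia.
have cn := ncomp_tperm e xy1; rewrite -nE in cn.
have pf := porbits_mul_tperm (n * e) x y; rewrite /= -face_tperm -/n1 xNy xf in pf.
have := euler_inequality e n1; apply: contraTN => cxy; rewrite cxy in cn.
by move: pl pn cn pf => /=; lia.
Qed.

Lemma fpath_ext (f g : D -> D) a (s : seq D) : {in belast a s, f =1 g} ->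
  fpath f a s = fpath g a s.
Proof.
elim: s a => //= b s IH a fg; rewrite fg ?mem_head // IH // => z zs.
by apply: fg; rewrite inE zs orbT.
Qed.

(** Exchanging the images of the last darts of the two arcs closes each arc into a cycle of its
    own. *)
Lemma cycle_split e n a1 (s1 : seq D) a2 (s2 : seq D) : planar_perm e n ->
  uniq ((a1 :: s1) ++ a2 :: s2) -> fcycle n ((a1 :: s1) ++ a2 :: s2) ->
  let n1 := tperm (last a1 s1) (last a2 s2) * n in
  [/\ planar_perm e n1, fcycle n1 (a1 :: s1), fcycle n1 (a2 :: s2)
    & forall x, x \notin (a1 :: s1) ++ a2 :: s2 -> n1 x = n x].
Proof.
move=> pl un cy n1; set l1 := last a1 s1; set l2 := last a2 s2.
have l1in : l1 \in a1 :: s1 by apply: mem_last.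
have l2in : l2 \in a2 :: s2 by apply: mem_last.
have orb : l1 \in porbit n l2.
  have E z : z \in (a1 :: s1) ++ a2 :: s2 -> z \in porbit n a1.
    move=> zin; have h : fconnect n a1 z by rewrite (fconnect_cycle cy) ?mem_head.
    by rewrite -(iter_findex h) -permX mem_porbit.
  have := E l1; have := E l2; rewrite !mem_cat l1in l2in orbT /= => /(_ isT) h2 /(_ isT).
  by rewrite -eq_porbit_mem in h2; rewrite (eqP h2).
move: cy; rewrite /= rcons_cat cat_path /= -/l1.
rewrite rcons_path -/l2 => /and4P[p1 /eqP nl1 p2 /eqP nl2].
move: un; rewrite cat_uniq => /and3P[u1 disj u2].
have dis z : z \in a1 :: s1 -> z \in a2 :: s2 -> False.
  by move=> z1 z2; case/hasP: disj; exists z.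
split.
- exact: planar_split.
- rewrite /= rcons_path -/l1 (@fpath_ext n1 n) ?p1 /= ?permM ?tpermL ?nl2 // => z zb.
  rewrite permM tpermD //.
    apply: contraTneq u1 => zl; rewrite lastI rcons_uniq zl zb //.
  by apply/eqP=> lz; move: zb; rewrite -lz => /mem_belast /dis; apply.
- rewrite /= rcons_path -/l2 (@fpath_ext n1 n) ?p2 /= ?permM ?tpermR ?nl1 // => z zb.
  rewrite permM tpermD //.
    by apply/eqP=> lz; move: zb; rewrite -lz => /mem_belast h; apply: dis h.
  by apply: contraTneq u2 => zl; rewrite lastI rcons_uniq zl zb //.
- move=> x; rewrite -cat_cons mem_cat negb_or => /andP[x1 x2]; rewrite permM tpermD //.
    by apply: contraNneq x1 => <-.
  by apply: contraNneq x2 => <-.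
Qed.

(* [noncrossing s bs]: the cyclic sequence [s] is cut into the cyclic
   sequences [bs] by successive noncrossing chords. *)
Inductive noncrossing (T : Type) : seq T -> seq (seq T) -> Prop :=
| NcOne (s : seq T) : 0 < size s -> noncrossing s [:: s]
| NcRot k (s : seq T) bs : noncrossing (rot k s) bs -> noncrossing s bs
| NcCat (s1 s2 : seq T) bs1 bs2 : 0 < size s1 -> 0 < size s2 -> noncrossing s1 bs1 ->
    noncrossing s2 bs2 -> noncrossing (s1 ++ s2) (bs1 ++ bs2).

Lemma noncrossing_perm (s : seq D) bs : noncrossing s bs -> perm_eq (flatten bs) s.
Proof.
elim=> {s bs} [s _|k s bs _ IH|s1 s2 bs1 bs2 _ _ _ IH1 _ IH2].
- by rewrite /= cats0.
- by apply: perm_trans IH _; rewrite perm_rot.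
- by rewrite flatten_cat perm_cat.
Qed.

Lemma noncrossing_split e (s : seq D) bs : noncrossing s bs -> forall n : {perm D},
  planar_perm e n -> uniq s -> fcycle n s ->
  exists n1 : {perm D}, [/\ planar_perm e n1, all (fcycle n1) bs
    & forall x, x \notin s -> n1 x = n x].
Proof.
elim=> {s bs} [s _ n pl _ cy|k s bs _ IH n pl un cy|s1 s2 bs1 bs2 p1 p2 nc1 IH1 nc2 IH2 n pl un cy].
- by exists n; rewrite /= cy.
- have [||n1 [pl1 cy1 E]] := IH n pl; rewrite ?rot_uniq ?rot_cycle //.
  by exists n1; split=> // x xs; apply: E; rewrite mem_rot.
case: s1 p1 nc1 IH1 un cy => // a1 s1 _ nc1 IH1; case: s2 p2 nc2 IH2 => // a2 s2 _ nc2 IH2 un cy.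
have [pl1 cy1 cy2 E1] := cycle_split pl un cy; set n1 := (_ * _) in pl1 cy1 cy2 E1.
move: un; rewrite cat_uniq => /and3P[u1 disj u2].
have dis z : z \in a1 :: s1 -> z \in a2 :: s2 -> False.
  by move=> z1 z2; case/hasP: disj; exists z.
have [n2 [pl2 cyc1 E2]] := IH1 n1 pl1 u1 cy1.
have cy2' : fcycle n2 (a2 :: s2).
  move: cy2 => /=; rewrite !rcons_path => /andP[p l]; rewrite (@fpath_ext n2 n1).
    rewrite p /= E2 //; apply/negP=> /dis; apply; exact: mem_last.
  by move=> z /mem_belast z2; apply: E2; apply/negP=> /dis; apply.
have [n3 [pl3 cyc2 E3]] := IH2 n2 pl2 u2 cy2'.
exists n3; split=> //; last first.
  by move=> x; rewrite mem_cat negb_or => /andP[x1 x2]; rewrite E3 ?E2 ?E1 // mem_cat negb_or x1.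
rewrite all_cat cyc2 andbT; apply/allP=> b b1.
have sub : {subset b <= a1 :: s1}.
  by move=> z zb; rewrite -(perm_mem (noncrossing_perm nc1)); apply/flattenP; exists b.
move/allP: cyc1 => /(_ b b1); case: b sub {b1} => // c b sub /=.
rewrite !rcons_path => /andP[p l]; rewrite (@fpath_ext n3 n2).
  by rewrite p /= E3 //; apply/negP=> h; apply: (dis (last c b)) => //; apply/sub/mem_last.
by move=> z /mem_belast /sub z1; apply: E3; apply/negP=> h; apply: (dis z).
Qed.

(** The edges of [X] are contracted one by one, each contraction merging the two ends inside a face;
    an edge whose ends already coincide is left as a loop. The clause on [phi] says that nothing is
    identified beyond what [X] forces, and the last one that vertices away from [X] keep their
    rotation. *)
Lemma contract_edges e n (X : seq D) : planar_perm e n ->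
  exists n' : {perm D}, [/\ planar_perm e n',
    forall x y, y \in porbit n x -> y \in porbit n' x,
    {in X, forall d, e d \in porbit n' d},
    forall (T : eqType) (phi : D -> T), (forall x, phi (n x) = phi x) ->
      {in X, forall d, phi (e d) = phi d} -> forall x, phi (n' x) = phi x
    & forall x, {in X, forall d, x \notin porbit n d /\ x \notin porbit n (e d)} -> n' x = n x].
Proof.
move=> pl; elim: X => [|d X [n1 [pl1 H1 H2 H3 H4]]]; first by exists n.
have [ed|ned] := boolP (e d \in porbit n1 d).
  exists n1; split=> //.
  - by move=> z; rewrite inE => /orP[/eqP ->//|/H2].
  - by move=> T phi h1 h2; apply: H3 => // z zX; apply: h2; rewrite inE zX orbT.
  - by move=> x h; apply: H4 => z zX; apply: h; rewrite inE zX orbT.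
(* [x0] lies at the vertex of [d] and is followed by [e d] on its face, so the merge with [e d]
   takes place inside one face. *)
pose x0 := n1^-1 d; pose t := tperm x0 (e d).
have nx0 : n1 x0 = d by rewrite /x0 permKV.
have x0d y : (y \in porbit n1 d) = (y \in porbit n1 x0).
  by rewrite -nx0 !(porbit_sym _ y) porbit_step.
have orb : x0 \notin porbit n1 (e d) by rewrite porbit_sym -x0d.
have sub x y : y \in porbit n1 x -> y \in porbit (t * n1) x.
  have m : x0 \in porbit (t * n1) (e d) by apply: mem_porbit_tperm.
  apply: (@porbit_ind n1 x [pred y | y \in porbit (t * n1) x]) => /=; first exact: porbit_id.
  move=> u; rewrite -eq_porbit_mem => /eqP <-; rewrite porbit_sym.
  have := mem_porbit1 (t * n1) (t u); rewrite permM tpermK porbit_sym.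
  rewrite -!eq_porbit_mem => /eqP <-; rewrite eq_porbit_mem.
  by rewrite /t; case: tpermP => [->|->|_ _] //; rewrite ?porbit_id // porbit_sym.
exists (t * n1); split.
- apply: planar_merge_face => //; rewrite porbit_sym.
  by have := mem_porbit1 (n1 * e) x0; rewrite permM nx0.
- by move=> x y /H1 /sub.
- move=> z; rewrite inE => /orP[/eqP ->|/H2 /sub //].
  have m : x0 \in porbit (t * n1) (e d) by apply: mem_porbit_tperm.
  have : d \in porbit (t * n1) x0 by apply: sub; rewrite -nx0 mem_porbit1.
  by rewrite -eq_porbit_mem => /eqP ->; rewrite porbit_sym.
- move=> T phi h1 h2 x.
  have h3 : forall y, phi (n1 y) = phi y.
    by apply: H3 => // z zX; apply: h2; rewrite inE zX orbT.
  rewrite permM h3 /t; case: tpermP => // ->.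
    by rewrite h2 ?mem_head // -nx0 h3.
  by rewrite h2 ?mem_head // -[in RHS]nx0 h3.
- move=> x h; rewrite permM.
  have [xd xed] := h d (mem_head _ _).
  have E : n1 x = n x by apply: H4 => z zX; apply: h; rewrite inE zX orbT.
  rewrite tpermD //; last by apply: contraNneq xed => <-; apply: porbit_id.
  apply: contraNneq xd => xx; rewrite -porbit_step -E -xx nx0; exact: porbit_id.
Qed.

(** Deletion of a dart without changing the type of darts: making it a fixed point of the rotation
    is a vertex split, hence preserves planarity. *)
Lemma isolate_dart e n z : planar_perm e n ->
  exists n' : {perm D}, [/\ planar_perm e n', n' z = z,
    forall x y, x != z -> y != z -> (y \in porbit n' x) = (y \in porbit n x)
    & forall x, x != z -> n x != z -> n' x = n x].
Proof.
move=> pl; have [nz|nz] := eqVneq (n z) z.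
  by exists n.
pose x0 := n^-1 z; pose t := tperm x0 z.
have nx0 : n x0 = z by rewrite /x0 permKV.
have orb : x0 \in porbit n z by rewrite porbit_sym -{1}nx0 mem_porbit1.
have fixz : (t * n) z = z by rewrite permM tpermR.
have x0z : x0 != z by apply: contraNneq nz => xz; rewrite -{1}xz nx0.
exists (t * n); split=> //; first exact: planar_split.
  move=> x y xz yz; apply/idP/idP.
    apply: (@porbit_ind (t * n) x [pred y | y \in porbit n x]) => /=; first exact: porbit_id.
    move=> u; rewrite permM porbit_step /t; case: tpermP => // ->; by rewrite -nx0 porbit_step.
  move=> /(@porbit_ind n x [pred y | if y == z then x0 \in porbit (t * n) x else y \in porbit (t * n) x]) /=.
  rewrite (negbTE yz); apply; first by rewrite (negbTE xz) porbit_id.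
  move=> u; case: (eqVneq u z) => [->|uz].
    rewrite (negbTE nz) => h; rewrite -porbit_step permM tpermL in h; exact: h.
  case: eqP => [nu|/eqP nuz] h.
    by have -> : x0 = u by apply: (@perm_inj _ n); rewrite nx0.
  rewrite -porbit_step permM tpermD in h => //; last by rewrite eq_sym.
  by apply: contraNneq nuz => <-; rewrite nx0.
move=> x xz nxz; rewrite permM tpermD //; last by rewrite eq_sym.
by apply: contraNneq nxz => <-; rewrite nx0.
Qed.

Lemma isolate_darts e n (Z : seq D) : planar_perm e n ->
  exists n' : {perm D}, [/\ planar_perm e n', {in Z, forall z, n' z = z},
    {in [predC Z] &, forall x y, (y \in porbit n' x) = (y \in porbit n x)}
    & forall x, x \notin Z -> n x \notin Z -> n' x = n x].
Proof.
move=> pl; elim: Z => [|z Z [n1 [pl1 H1 H2 H3]]]; first by exists n.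
have [n2 [pl2 K1 K2 K3]] := isolate_dart z pl1; exists n2; split=> //.
- move=> w; rewrite inE => /orP[/eqP ->//|wZ]; have [->//|wz] := eqVneq w z.
  by rewrite K3 ?H1.
- move=> x y; rewrite !inE !negb_or => /andP[xz xZ] /andP[yz yZ].
  by rewrite K2 // H2.
- move=> x; rewrite !inE !negb_or => /andP[xz xZ] /andP[yz yZ].
  by rewrite K3 ?H3.
Qed.

End PlanarPermutations.

Lemma porbit_ext (D : finType) (n n1 : {perm D}) (A : pred D) :
  (forall x, A x -> A (n x)) -> (forall x, A x -> n1 x = n x) ->
  forall x, A x -> porbit n1 x = porbit n x.
Proof.
move=> An E x Ax.
have it i : A (iter i n x) /\ iter i n1 x = iter i n x.
  elim: i => //= i [IHA IHE]; split; first exact: An.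
  by rewrite IHE E.
apply/setP=> y; apply/porbitP/porbitP=> -[i ->]; exists i;
  by rewrite !permX; have [_ ->] := it i.
Qed.

(** * Plane maps and the merging of neighbors *)

Section Maps.
Variables (V D : finType) (e : {perm D}).
Hypothesis eK : involutive e.
Implicit Types (n : {perm D}) (L : {set D}) (p : D -> V).

(* A planar combinatorial map with dart set [L]: [e] reverses darts, [n] is the
   rotation at the origins [p] of the darts; the darts outside [L] are unused. *)
Definition plane_map n L p :=
  [/\ planar_perm e n, {in L, forall x, e x \in L},
      {in L &, forall x y, (p x == p y) = (y \in porbit n x)}
    & forall x, x \notin L -> n x = x].

Definition adj L p : rel V :=
  fun u w => [exists x in L, (p x == u) && (p (e x) == w)].

Lemma adjP L p u w :
  reflect (exists2 x, x \in L & p x = u /\ p (e x) = w) (adj L p u w).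
Proof.
apply: (iffP existsP) => [[x /and3P[xL /eqP <- /eqP <-]]|[x xL [<- <-]]]; exists x => //.
by rewrite xL !eqxx.
Qed.

Lemma map_closed n L p x : plane_map n L p -> x \in L -> n x \in L.
Proof.
case=> _ _ _ dead xL; apply/negPn/negP=> h.
by have nx := perm_inj (dead _ h); rewrite nx xL in h.
Qed.

Lemma origin_rot n L p x : plane_map n L p -> p (n x) = p x.
Proof.
move=> M; case: (boolP (x \in L)) => [xL|]; last by case: M => _ _ _ dead /dead ->.
have [_ _ orb _] := M; apply/esym/eqP; rewrite orb ?mem_porbit1 //.
exact: map_closed M xL.
Qed.

Lemma adj_sym n L p : plane_map n L p -> symmetric (adj L p).
Proof.
case=> _ eL _ _; suff H u w : adj L p u w -> adj L p w u by move=> u w; apply/idP/idP; apply: H.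
by case/adjP=> x xL [<- <-]; apply/adjP; exists (e x); rewrite ?eL ?eK.
Qed.

Lemma map_prune n L L0 p : plane_map n L p -> L0 \subset L ->
  {in L0, forall x, e x \in L0} ->
  exists n', plane_map n' L0 p.
Proof.
move=> [pl eL orb dead] /subsetP sub eL0.
have [n' [pl' H1 H2 _]] := isolate_darts (enum (~: L0)) pl.
exists n'; split=> //.
  move=> x y x0 y0; rewrite orb ?sub // H2 //; rewrite !inE mem_enum inE; exact/negPn.
by move=> x xL0; apply: H1; rewrite mem_enum inE.
Qed.

Definition rotation n L p v (s : seq D) :=
  [/\ uniq s, fcycle n s & forall x, (x \in s) = (x \in L) && (p x == v)].

Lemma rotation_exists n L p v : plane_map n L p -> exists s, rotation n L p v s.
Proof.
move=> M; case: (pickP [pred x in L | p x == v]) => [x /= /andP[xL /eqP pxv]|H].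
  exists (fingraph.orbit n x); split; first exact: fingraph.orbit_uniq.
    by apply: cycle_orbit; apply: perm_inj.
  move=> y; rewrite -fconnect_orbit; apply/idP/idP.
    move/iter_findex <-; elim: (findex n x y) => /= [|i /andP[iL ip]].
      by rewrite xL pxv eqxx.
    by rewrite (map_closed M iL) (origin_rot _ M).
  case/andP=> yL /eqP pyv; have : y \in porbit n x.
    by case: (M) => _ _ <- //; rewrite pxv pyv.
  by case/porbitP=> i ->; rewrite permX fconnect_iter.
by exists [::]; split=> // x; have := H x => /= ->.
Qed.

Lemma rotation_nbr n L p v s : plane_map n L p -> rotation n L p v s ->
  forall w, adj L p v w = (w \in [seq p (e x) | x <- s]).
Proof.
move=> M [_ _ sE] w; apply/adjP/mapP=> -[x].
  by move=> xL [pv pw]; exists x; rewrite // sE xL pv eqxx.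
by rewrite sE => /andP[xL /eqP pv] ->; exists x.
Qed.

(** The rotation at [v] is cut into one vertex for each block, the edges at [v] are contracted,
    which fuses the far ends of each block, and the darts at [v] with their reverses are deleted.
    [r] sends a vertex to a representative of its fused class. The third clause says that [r]
    identifies only what the blocks force; it is the tool for showing that a coloring, or any other
    labelling, survives the merge. *)
Lemma map_merge n L p v s bs : plane_map n L p -> ~~ adj L p v v ->
  rotation n L p v s -> noncrossing s bs ->
  exists n' r, let L' := [set x in L | (p x != v) && (p (e x) != v)] in
  [/\ plane_map n' L' (r \o p),
      {in bs, forall b, {in b &, forall x y, r (p (e x)) = r (p (e y))}},
      forall (T : eqType) (phi : V -> T),
        {in bs, forall b, {in b &, forall x y, phi (p (e x)) = phi (p (e y))}} ->
        forall u, phi (r u) = phi u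
    & {in L, forall x, p x != v -> ~~ adj L p v (p x) -> n' x = n x}].
Proof.
move=> M irr [us cs sE] nc; have [pl eL orb dead] := M.
have flat := noncrossing_perm nc.
have bsub b : b \in bs -> {subset b <= s}.
  by move=> bb x xb; rewrite -(perm_mem flat); apply/flattenP; exists b.
have sb x : x \in s -> exists2 b, b \in bs & x \in b.
  by rewrite -(perm_mem flat) => /flattenP.
have [n1 [pl1 cyc1 E1]] := noncrossing_split nc pl us cs.
have [n2 [pl2 H1 H2 H3 H4]] := contract_edges s pl1.
pose Z := s ++ map e s; have [n3 [pl3 K1 K2 K3]] := isolate_darts Z pl2.
have sL x : x \in s -> x \in L by rewrite sE => /andP[].
have sv x : x \in s -> p x = v by rewrite sE => /andP[_ /eqP].
have sev x : x \in s -> p (e x) != v.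
  move=> xs; apply/eqP=> h; have : adj L p v v.
    by apply/adjP; exists x; [exact: sL | split; first exact: sv].
  by rewrite (negbTE irr).
have ns x : x \notin s -> n x \notin s.
  apply: contra; rewrite !sE (origin_rot _ M) => /andP[nxL ->]; rewrite andbT.
  by apply: contraLR nxL => xL; rewrite dead.
have n1s x : x \in s -> n1 x \in s.
  case/sb=> b bb xb; have /allP/(_ b bb) := cyc1 => cb.
  by apply: (bsub b bb); rewrite -(fconnect_cycle cb xb) fconnect1.
have orb1 x : x \notin s -> porbit n1 x = porbit n x.
  by move=> xs; apply: (@porbit_ext _ n n1 [predC s]).
pose L0 := [set x in L | p x != v].
have L0s x : x \in L0 -> x \notin s.
  by rewrite inE sE => /andP[-> /negbTE ->].
(* A canonical dart of each fused class, chosen among the darts not at [v]; [r] reads the vertex off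
   this dart and leaves vertices without such a dart in place. *)
pose can x := odflt x [pick y in porbit n2 x :&: L0].
have canP x : x \in L0 -> can x \in porbit n2 x /\ can x \in L0.
  rewrite /can => x0; case: pickP => /= [y|/(_ x)]; first by rewrite inE => /andP[].
  by rewrite inE porbit_id x0.
pose r u := if [pick x in L0 | p x == u] is Some x then p (can x) else u.
have rP x : x \in L0 -> exists2 y, y \in L0 & r (p x) = p y /\ porbit n2 y = porbit n2 x
     /\ forall z, z \in L0 -> porbit n2 z = porbit n2 x -> r (p z) = r (p x).
  move=> x0.
  have go z : z \in L0 -> exists z', [/\ z' \in L0, porbit n2 z' = porbit n2 z & r (p z) = p (can z')].
    move=> z0; rewrite /r; case: pickP => /= [z' /andP[z'0 /eqP pz]|/(_ z)]; last by rewrite z0 eqxx.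
    exists z'; split=> //; apply/eqP; rewrite eq_porbit_mem; apply: H1; rewrite orb1 ?L0s // -orb.
    - by rewrite pz.
    - by move: z0; rewrite inE => /andP[].
    - by move: z'0; rewrite inE => /andP[].
  have [x' [x'0 ox rx]] := go x x0; have [cx c0] := canP x' x'0.
  exists (can x') => //; split=> //; split.
    by rewrite -ox; apply/eqP; rewrite eq_porbit_mem.
  move=> z z0 oz; have [z' [z'0 oz' rz]] := go z z0; rewrite rz rx /can.
  rewrite oz' oz -ox; case: pickP => //= /(_ x').
  by rewrite inE porbit_id x'0.
have rE : {in L0 &, forall x y, (r (p x) == r (p y)) = (y \in porbit n2 x)}.
  move=> x y x0 y0; have [x' x'0 [rx [ox cx]]] := rP x x0.
  rewrite -eq_porbit_mem; apply/eqP/eqP=> h; last by apply/esym/cx.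
  have [y' y'0 [ry [oy _]]] := rP y y0.
  rewrite -oy -ox; apply/eqP; rewrite eq_porbit_mem porbit_sym; apply: H1.
  rewrite orb1 ?L0s // porbit_sym -orb; first by rewrite -rx -ry h.
    by move: x'0; rewrite inE => /andP[].
  by move: y'0; rewrite inE => /andP[].
have es0 x : x \in s -> e x \in L0 by move=> xs; rewrite inE eL ?sL ?sev.
have inZ x : (x \in Z) = (x \in s) || (e x \in s).
  rewrite mem_cat; congr (_ || _); apply/mapP/idP=> [[y ys ->]|es]; first by rewrite eK.
  by exists (e x); rewrite ?eK.
exists n3, r => /=; split.
- split=> //.
  + by move=> x; rewrite !inE eK => /and3P[xL -> ->]; rewrite eL.
  + move=> x y; rewrite !inE => /and3P[xL xv exv] /and3P[yL yv eyv].
    rewrite rE ?inE ?xL ?xv ?yL ?yv // K2 // !inE inZ !sE ?(negbTE xv) ?(negbTE exv) ?(negbTE yv) ?(negbTE eyv) ?andbF //.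
  + move=> x; rewrite inE; case: (boolP (x \in Z)) => [xZ _|xZ]; first exact: K1.
    move=> h; have xL : x \notin L.
      apply: contra h => xL; rewrite xL; move: xZ; rewrite inZ negb_or !sE xL eL //.
    have xs : x \notin s by apply: contra xL => /sL.
    have n1x : n1 x = x by rewrite E1 ?dead.
    have o1 : porbit n1 x = [set x].
      apply/setP=> y; rewrite inE; apply/idP/eqP=> [/porbitP[i ->]|->]; last exact: porbit_id.
      by rewrite permX; elim: i => //= i ->.
    have n2x : n2 x = x.
      rewrite H4 // => d ds; rewrite !(porbit_sym _ x) o1 !inE; split.
        by apply: contraNneq xL => <-; apply: sL.
      by apply: contraNneq xL => <-; apply/eL/sL.
    by rewrite K3 ?n2x.
- move=> b bb x y xb yb; apply/eqP; rewrite rE ?es0 //; try exact: bsub bb _ _.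
  have xs := bsub _ bb _ xb; have ys := bsub _ bb _ yb.
  have cb : fcycle n1 b by apply: (allP cyc1).
  have : y \in porbit n2 x.
    apply: H1; have h : fconnect n1 x y by rewrite (fconnect_cycle cb).
    by rewrite -(iter_findex h) -permX mem_porbit.
  have := H2 x xs; have := H2 y ys; rewrite -!eq_porbit_mem => /eqP -> /eqP -> /eqP ->.
  by [].
- move=> T phi hphi u; rewrite /r; case: pickP => //= x /andP[x0 /eqP pxu].
  have [cx c0] := canP x x0.
  (* Each piece of [v] receives the value of [phi] at its far ends, so [psi] is invariant under the
     split rotation and constant along the contracted edges. *)
  pose psi x := if x \in s then phi (p (e x)) else phi (p x).
  have inv : forall z, psi (n2 z) = psi z.
    apply: H3 => z; rewrite /psi; last first.
      move=> zs; rewrite zs; case: ifP => // es.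
      by move: (sev z zs); rewrite (sv _ es) eqxx.
    case: (boolP (z \in s)) => zs; last first.
      by rewrite E1 // (negbTE (ns _ zs)) (origin_rot _ M).
    rewrite n1s //; case/sb: zs => b bb zb; apply: (hphi b bb) => //.
    by have /allP/(_ b bb) cb := cyc1; rewrite -(fconnect_cycle cb zb) fconnect1.
  have : psi (can x) = psi x.
    apply/eqP; apply: (@porbit_ind _ n2 x (fun z => psi z == psi x)) cx => // z.
    by rewrite inv.
  by rewrite /psi !(negbTE (L0s _ _)) // pxu.
- move=> x xL xv nadj.
  have xs : x \notin s by rewrite sE (negbTE xv) andbF.
  have nb d : d \in s -> p x != p (e d).
    move=> ds; apply: contraNneq nadj => ->; apply/adjP; exists d; [exact: sL | split=> //; exact: sv].
  have outZ y : y \in L -> p y = p x -> y \notin Z.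
    move=> yL py; rewrite inZ negb_or !sE py (negbTE xv) andbF /=.
    apply/negP=> /andP[eyL /eqP eyv]; have := nb (e y); rewrite sE eyL eyv eqxx eK py eqxx.
    by move=> /(_ isT).
  have n2x : n2 x = n x.
    rewrite H4 ?E1 // => d ds; split.
      rewrite porbit_sym orb1 // porbit_sym; apply/negP=> h.
      have := orb d x (sL _ ds) xL; rewrite h => /eqP; rewrite sv // => E.
      by rewrite E eqxx in xv.
    have ed : e d \notin s by rewrite sE (negbTE (sev _ ds)) andbF.
    by rewrite orb1 // -(orb (e d) x (eL _ (sL _ ds)) xL) eq_sym; apply: nb.
  rewrite K3 ?n2x //; first exact: outZ.
  by apply: outZ; rewrite ?(origin_rot _ M) ?(map_closed M).
Qed.

End Maps.

(** An entry outside [t] is brought to the front by a rotation and cut off as a singleton; this is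
    repeated until only [t] is left. *)
Lemma noncrossing_subseq (T : eqType) (t s : seq T) : 0 < size t -> subseq t s ->
  exists bs, [/\ noncrossing s bs, t \in bs, {in bs, forall b, b = t \/ size b = 1%N}
    & (size bs + size t <= (size s).+1)%N].
Proof.
move=> t0; have [k] := ubnP (size s); elim: k s => // k IH s lek ts.
have [->|tNs] := eqVneq t s.
  exists [:: s]; split; rewrite ?mem_head ?add1n //.
    by apply: NcOne; apply: leq_trans t0 (size_subseq ts).
  by move=> b; rewrite inE => /eqP ->; left.
have [s1 [z [s2 [sE ts12]]]] : exists s1 z s2, s = s1 ++ z :: s2 /\ subseq t (s1 ++ s2).
  elim: s t ts tNs {IH lek t0} => [|a s IHs] [|b t] //= h.
  - by move=> _; exists [::], a, s; rewrite sub0seq.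
  - move: h; case: eqP => [-> h|ba h _]; last by exists [::], a, s.
    rewrite eqseq_cons eqxx /= => /(IHs _ h) [s1 [z [s2 [-> h12]]]].
    by exists (a :: s1), z, s2; rewrite /= eqxx.
have [|bs [nc tb bss szb]] := IH (s1 ++ s2) _ ts12.
  by move: lek; rewrite sE !size_cat /= addnS.
exists ([:: z] :: bs); split.
- apply: (NcRot (k := size s1)); rewrite sE rot_size_cat -cat1s -catA -[_ :: bs]cat1s.
  apply: NcCat; rewrite //; last 1 first.
  + by apply: (NcRot (k := size s2)); rewrite rot_size_cat.
  + by apply: leq_trans t0 (leq_trans (size_subseq ts12) _); rewrite !size_cat addnC.
  + exact: NcOne.
- by rewrite inE tb orbT.
- by move=> b; rewrite inE => /orP[/eqP ->|/bss //]; right.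
- by move: szb; rewrite sE !size_cat /= !addnS !addSn.
Qed.

(** * Disjoint connected sets do not cross at a vertex *)

Section Crossing.
Variables (V D : finType) (e : {perm D}).
Hypothesis eK : involutive e.

Let frel_in (E : rel V) (C : pred V) : rel V := [rel u w | [&& C u, C w & E u w]].

(* Contracting the disjoint connected sets [C1] and [C2] would give a one-vertex
   neighbourhood with two crossing double edges, whose single face splits the
   vertex without disconnecting it. *)
Lemma no_crossing n L p v s x1 x2 x3 x4 (C1 C2 : pred V) :
  plane_map e n L p -> rotation n L p v s -> subseq [:: x1; x2; x3; x4] s ->
  (forall u, C1 u -> ~~ C2 u) -> ~~ C1 v -> ~~ C2 v ->
  C1 (p (e x1)) -> C2 (p (e x2)) ->
  connect (frel_in (adj e L p) C1) (p (e x1)) (p (e x3)) ->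
  connect (frel_in (adj e L p) C2) (p (e x2)) (p (e x4)) -> False.
Proof.
move=> M [us cs sE] sub dis v1 v2 cx1 cx2 con1 con2.
have [pl eL orb dead] := M.
have sL x : x \in s -> x \in L by rewrite sE => /andP[].
have sv x : x \in s -> p x = v by rewrite sE => /andP[_ /eqP].
have ut := subseq_uniq sub us.
have ts := mem_subseq sub.
have [s1 s2 s3 s4] : [/\ x1 \in s, x2 \in s, x3 \in s & x4 \in s].
  by split; apply: ts; rewrite !inE eqxx ?orbT.
pose X (C : pred V) := [seq x <- enum D | [&& x \in L, C (p x) & C (p (e x))]].
have inX C x : (x \in X C) = [&& x \in L, C (p x) & C (p (e x))].
  by rewrite mem_filter mem_enum andbT.
have [n2 [pl2 H1 H2 H3 H4]] := contract_edges (X C1 ++ X C2) pl.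
have conO C u w : C = C1 \/ C = C2 -> connect (frel_in (adj e L p) C) u w ->
    forall a b, a \in L -> b \in L -> p a = u -> p b = w -> b \in porbit n2 a.
  move=> CC /connectP[q]; elim: q u => [u _ -> a b aL bL pa pb|z q IH u /= /andP[]].
    by apply: H1; rewrite -orb // pa pb.
  case/and3P=> Cu Cz /adjP[y yL [py pey]] pq lw a b aL bL pa pb.
  have h1 : y \in porbit n2 a by apply: H1; rewrite -orb // pa py.
  have h2 : e y \in porbit n2 y.
    apply: H2; rewrite mem_cat !inX yL py pey; case: CC => <-; rewrite Cu Cz ?orbT //.
  have h3 := IH z pq lw (e y) b (eL _ yL) bL pey pb.
  by move: h1 h2 h3; rewrite -!eq_porbit_mem => /eqP <- /eqP <- .
have C1e u : C1 (p (e u)) -> u \in L -> e u \in L by move=> _; apply: eL.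
(* The label records the set containing the origin of a dart; being invariant under the contraction,
   it shows that [C1], [C2] and [v] remain apart. *)
pose phi x := if x \in L then (if C1 (p x) then 1%N else if C2 (p x) then 2 else 0%N) else 0%N.
have phiN : forall x, phi (n2 x) = phi x.
  apply: H3 => [x|d].
    rewrite /phi (origin_rot _ M); case: (boolP (x \in L)) => [xL|xL].
      by rewrite (map_closed M xL).
    by rewrite dead // (negbTE xL).
  rewrite mem_cat !inX /phi => /orP[] /and3P[dL c1 c2]; rewrite dL eL // c1 c2 //.
  have h z : C2 z -> C1 z = false by move=> c; apply/negP=> /dis; rewrite c.
  by rewrite !h.
have phiO x y : y \in porbit n2 x -> phi y = phi x.
  move=> h; apply/eqP; apply: (@porbit_ind _ n2 x (fun z => phi z == phi x)) h => // z.
  by rewrite phiN.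
have n2s : {in s, forall x, n2 x = n x}.
  move=> x xs; apply: H4 => d; rewrite mem_cat !inX => dX.
  have dL : d \in L by case/orP: dX => /andP[].
  have vd : p d != v /\ p (e d) != v.
    by split; apply/eqP=> h; case/orP: dX => /and3P[_]; rewrite h ?(negbTE v1) ?(negbTE v2).
  split; apply/negP=> h.
    by have := orb d x dL (sL _ xs); rewrite h (sv _ xs) (negbTE (proj1 vd)).
  by have := orb (e d) x (eL _ dL) (sL _ xs); rewrite h (sv _ xs) (negbTE (proj2 vd)).
have cs2 : fcycle n2 s.
  case: (s) cs n2s => // a s' /=; rewrite !rcons_path => /andP[pa la] h.
  rewrite (@fpath_ext _ n2 n); last by move=> z /mem_belast; apply: h.
  by rewrite pa /= h ?mem_last.
have n2o x : x \notin s -> n2 x \notin s.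
  apply: contra => h; rewrite -(fconnect_cycle cs2 h) fconnect_sym ?fconnect1 //.
  exact: perm_inj.
have [bs [nc tb _ _]] := @noncrossing_subseq _ [:: x1; x2; x3; x4] s isT sub.
have [n3 [pl3 cyc3 E3]] := noncrossing_split nc pl2 us cs2.
have ct : fcycle n3 [:: x1; x2; x3; x4] by apply: (allP cyc3).
have orb3 x : x \notin s -> porbit n3 x = porbit n2 x.
  by move=> xs; apply: (@porbit_ext _ n2 n3 [predC s]).
pose b1 := e x1; pose b2 := e x2; pose b3 := e x3; pose b4 := e x4.
pose K := [:: x1; x2; x3; x4; b1; b2; b3; b4].
have [n4 [pl4 K1 K2 K3]] := isolate_darts [seq x <- enum D | x \notin K] pl3.
have inZ x : (x \in [seq x <- enum D | x \notin K]) = (x \notin K).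
  by rewrite mem_filter mem_enum andbT.
have pv1 : p b1 != v by apply: contraNneq v1 => <-.
have pv2 : p b2 != v by apply: contraNneq v2 => <-.
have Cend C u w : connect (frel_in (adj e L p) C) u w -> C u -> C w.
  case/connectP=> q; elim: q u => [u _ -> //|z q IH u /= /andP[/and3P[_ cz _] pq] lw _].
  exact: IH pq lw cz.
have cx3 : C1 (p b3) := Cend _ _ _ con1 cx1.
have cx4 : C2 (p b4) := Cend _ _ _ con2 cx2.
have pv3 : p b3 != v by apply: contraNneq v1 => <-.
have pv4 : p b4 != v by apply: contraNneq v2 => <-.
have bNs b : p b != v -> b \notin s by move=> h; rewrite sE (negbTE h) andbF.
have o13 : b3 \in porbit n2 b1 by apply: (conO C1 _ _ _ con1) => //; [left | apply/eL/sL | apply/eL/sL].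
have o24 : b4 \in porbit n2 b2 by apply: (conO C2 _ _ _ con2) => //; [right | apply/eL/sL | apply/eL/sL].
have ph1 : phi b1 = 1%N by rewrite /phi eL ?sL // cx1.
have nC1 z : C2 z -> C1 z = false by move=> c; apply/negP=> /dis; rewrite c.
have ph2 : phi b2 = 2 by rewrite /phi eL ?sL // cx2 nC1.
have ph3 : phi b3 = 1%N by rewrite /phi eL ?sL // cx3.
have ph4 : phi b4 = 2 by rewrite /phi eL ?sL // cx4 nC1.
have phs x : x \in s -> phi x = 0%N by move=> xs; rewrite /phi sL // sv // (negbTE v1) (negbTE v2).
have K2' x y : x \in K -> y \in K -> (y \in porbit n4 x) = (y \in porbit n3 x).
  by move=> xK yK; apply: K2; rewrite !inE ?inZ ?negbK.
have stepb b b' (w := n4 b) : b \in K -> b' \in K -> b \notin s -> b' != b ->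
   b' \in porbit n2 b -> {in K, forall z, z \in porbit n2 b -> (z == b) || (z == b')} ->
   n4 b = b'.
  move=> bK b'K bs' nb ob only.
  have ob' : b' \in porbit n4 b by rewrite K2' // orb3.
  have nbb : n4 b != b.
    apply/eqP=> h; case/eqP: nb; case/porbitP: ob' => i ->; rewrite permX.
    by elim: i => //= i ->.
  have wK : n4 b \in K.
    apply: contraT => wK; have := K1 (n4 b); rewrite inZ wK => /(_ isT) /perm_inj h.
    by rewrite h eqxx in nbb.
  have := only _ wK; rewrite -orb3 // -K2' // mem_porbit1 (negbTE nbb) => /(_ isT) /eqP.
  by [].
have inK : {in K, forall z, z \in s \/ [\/ z = b1, z = b2, z = b3 | z = b4]}.
  move=> z; rewrite !inE; do ?[case/orP]; move=> /eqP ->; try by left.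
  - by right; constructor 1.
  - by right; constructor 2.
  - by right; constructor 3.
  - by right; constructor 4.
have xneq : [/\ x1 != x2, x1 != x3, x1 != x4 & x3 != x2 /\ x4 != x2].
  move: ut; rewrite /= !inE !negb_or => /and4P[/and3P[-> -> ->] /andP[h1 h2] _ _].
  by rewrite eq_sym h1 eq_sym h2.
have [x12 x13 x14 [x32 x42]] := xneq.
have be i j : i != j -> e i != e j by rewrite (inj_eq perm_inj).
have only1 : {in K, forall z, z \in porbit n2 b1 -> (z == b1) || (z == b3)}.
  move=> y yK /phiO; rewrite ph1; case: (inK y yK) => [ys|[] ->]; rewrite ?eqxx ?orbT //.
    by rewrite (phs _ ys).
  - by rewrite ph2.
  - by rewrite ph4.
have only2 : {in K, forall z, z \in porbit n2 b2 -> (z == b2) || (z == b4)}.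
  move=> y yK /phiO; rewrite ph2; case: (inK y yK) => [ys|[] ->]; rewrite ?eqxx ?orbT //.
    by rewrite (phs _ ys).
  - by rewrite ph1.
  - by rewrite ph3.
have mK : [/\ b1 \in K, b2 \in K, b3 \in K & b4 \in K].
  by split; rewrite !inE eqxx ?orbT.
have [b1K b2K b3K b4K] := mK.
have n4b1 : n4 b1 = b3 by apply: stepb; rewrite ?bNs ?be // eq_sym.
have n4b2 : n4 b2 = b4 by apply: stepb; rewrite ?bNs ?be //.
have n4x x y : x \in K -> y \in K -> n3 x = y -> n4 x = y.
  by move=> xK yK h; rewrite K3 ?inZ ?h ?negbK.
move: ct; rewrite /= => /and5P[/eqP e1 /eqP e2 /eqP e3 /eqP e4 _].
have m1 : n4 x1 = x2 by apply: n4x; rewrite ?inE ?eqxx ?orbT.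
have m2 : n4 x2 = x3 by apply: n4x; rewrite ?inE ?eqxx ?orbT.
have m4 : n4 x4 = x1 by apply: n4x; rewrite ?inE ?eqxx ?orbT.
have in1 : x1 \in porbit n4 x3.
  rewrite porbit_sym -{1}m2 -{1}m1; have := mem_porbit n4 2 x1.
  by rewrite expgS expg1 permM.
(* On the eight darts of [K] the face walk runs through [x1], [b2], [x4], [b1], [x3]. Splitting [v]
   at its corners [x1] and [x3], which share this face, should therefore disconnect them, but the
   path through [b1] and [b3] survives. *)
have inF : x1 \in porbit (n4 * e) x3.
  rewrite porbit_sym; have := mem_porbit (n4 * e) 4 x1.
  by rewrite !expgS expg0 !permM perm1 m1 -/b2 n4b2 /b4 eK m4 -/b1 n4b1 /b3 eK.
have := planar_split_disconnects pl4 x13 in1 inF; set n5 := _ * n4 => /negP; apply.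
have c1 := comp_e e n5 x1; have c2 := comp_n e n5 b1; have c3 := comp_e e n5 b3.
rewrite /b3 eK in c3.
have n5b : n5 b1 = b3.
  rewrite permM tpermD ?n4b1 //.
    by apply: contraNneq pv1 => <-; rewrite sv.
  by apply: contraNneq pv1 => <-; rewrite sv.
rewrite n5b in c2; exact: connect_trans c1 (connect_trans c2 c3).
Qed.

End Crossing.

(** * The edge bound for simple planar maps *)

Section EdgeBound.
Variables (V D : finType) (e : {perm D}).
Hypothesis eK : involutive e.

Lemma porbit_pair (s : {perm D}) x y : s x = y -> s y = x -> porbit s x = [set x; y].
Proof.
move=> sx sy; apply/setP=> z; apply/idP/idP.
  apply: (@porbit_ind _ s x (mem [set x; y])); first by rewrite /= !inE eqxx.
  by move=> u /=; rewrite !inE => /orP[] /eqP ->; rewrite ?sx ?sy eqxx ?orbT.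
by rewrite !inE => /orP[] /eqP ->; rewrite ?porbit_id // -sx mem_porbit1.
Qed.

Lemma comp_pair (n : {perm D}) x : n x = x -> n (e x) = e x ->
  eclass (comp e n) x = [set x; e x].
Proof.
move=> nx nex; apply/setP=> z; rewrite !inE; apply/idP/idP.
  apply: (@comp_ind _ e n x (fun z => (z == x) || (z == e x))); first by rewrite eqxx.
    by move=> u /orP[] /eqP ->; rewrite ?eK eqxx ?orbT.
  by move=> u /orP[] /eqP ->; rewrite ?nx ?nex eqxx ?orbT.
by case/orP=> /eqP ->; [apply: connect0 | apply: comp_e].
Qed.

Definition simple_map (L : {set D}) (p : D -> V) :=
  {in L &, forall x y, p x = p y -> p (e x) = p (e y) -> x = y}.

Lemma sum_inv_degree n L (p : D -> V) : plane_map e n L p ->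
  (\sum_(x in L) (#|porbit n x|%:R)^-1 = #|p @: L|%:R :> rat)%R.
Proof.
move=> M; have [_ _ orb _] := M.
rewrite (partition_big p (mem (p @: L))) /=; last by move=> x xL; rewrite imset_f.
rewrite (eq_bigr (fun _ => 1%R)) => [|u /imsetP[x xL ->]]; first by rewrite GRing.sumr_const.
have E y : (y \in L) && (p y == p x) = (y \in porbit n x).
  apply/andP/idP=> [[yL]|yx]; first by rewrite eq_sym orb.
  have yL : y \in L.
    by apply: (@porbit_ind _ n x (mem L)) yx => //= z; apply: map_closed M.
  by rewrite eq_sym orb.
rewrite (eq_bigl _ _ E) (eq_bigr (fun _ => (#|porbit n x|%:R)^-1%R)); last first.
  by move=> y; rewrite -eq_porbit_mem => /eqP ->.
rewrite GRing.sumr_const -[LHS]GRing.mulr_natl GRing.divff //.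
by rewrite Num.Theory.pnatr_eq0 card_porbit_neq0.
Qed.

(** By planarity the weights [w], one share of Euler's formula for each dart, have a nonnegative
    sum. A dead dart has weight 0. A live dart has an edge of two darts and in general a face of at
    least three, so its weight is below [1/deg - 1/6] because [1/2 + 1/3 - 1 = -1/6]. Summing
    [1/deg] over the live darts counts the vertices. *)
Lemma edge_bound n L (p : D -> V) : plane_map e n L p ->
  irreflexive (adj e L p) -> simple_map L p -> L != set0 ->
  #|L| < 6 * #|p @: L|.
Proof.
move=> M irr sim /set0Pn[x0 x0L]; have [pl eL orb dead] := M.
have loopless x : x \in L -> p (e x) != p x.
  by move=> xL; apply: contraFneq (irr (p x)) => h; apply/adjP; exists x.
pose w x : rat := ((#|porbit e x|%:R)^-1 + (#|porbit n x|%:R)^-1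
   + (#|porbit (n * e) x|%:R)^-1 - 1 - 2%:R * (#|eclass (comp e n) x|%:R)^-1)%R.
have w0 : (0 <= \sum_x w x)%R.
  have ecl (s : {perm D}) x : porbit s x = eclass (fun x y => y \in porbit s x) x.
    by apply/setP=> y; rewrite inE.
  have sumw (s : {perm D}) : (\sum_x (#|porbit s x|%:R)^-1 = #|porbits s|%:R :> rat)%R.
    rewrite porbits_classes card_classes_sum; last exact: porbit_equiv.
    by apply: eq_bigr => x _; rewrite -ecl.
  rewrite /w !GRing.sumrB !big_split /= !sumw -GRing.mulr_sumr.
  rewrite -card_classes_sum; last exact: comp_equiv.
  rewrite GRing.sumr_const -/(ncomp e n).
  move: pl; rewrite /planar_perm -(Num.Theory.ler_nat rat) !GRing.natrD -muln2 GRing.natrM.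
  rewrite cardT -cardE -[#|_|]/(#|D|); lra.
have w_dead x : x \notin L -> w x = 0%R.
  move=> xL; have exL : e x \notin L by apply: contra xL => /eL; rewrite eK.
  have nx := dead _ xL; have nex := dead _ exL.
  rewrite /w comp_pair // (@porbit_pair e x (e x)) ?eK // (@porbit_pair n x x) // setUid cards1.
  rewrite (@porbit_pair (n * e) x (e x)) ?permM ?nx ?nex ?eK //.
  set c := (_ ^-1)%R; lra.
have w_live x : x \in L -> (w x < (#|porbit n x|%:R)^-1 - 6%:R^-1)%R.
  move=> xL; have exx : e x != x by apply: contraNneq (loopless x xL) => ->.
  rewrite /w (@porbit_pair e x (e x)) ?eK // cards2 eq_sym exx /=.
  have cpos : (0 < #|eclass (comp e n) x|%:R :> rat)%R.
    by rewrite Num.Theory.ltr0n; apply/card_gt0P; exists x; rewrite inE; apply: connect0.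
  (* Without loops and parallel edges a face of length at most two bounds an isolated edge, where
     both vertices have degree one and the weight is 0. *)
  have [F3|] := leqP 3 #|porbit (n * e) x|.
    have : ((#|porbit (n * e) x|%:R)^-1 <= 3%:R^-1 :> rat)%R.
      by rewrite Num.Theory.lef_pV2 ?Num.Theory.ler_nat // Num.Theory.posrE Num.Theory.ltr0n ?(leq_trans _ F3).
    have : (0 < (#|eclass (comp e n) x|%:R)^-1 :> rat)%R by rewrite Num.Theory.invr_gt0.
    set a := (_ ^-1)%R; set b := (#|porbit n x|%:R^-1)%R; set c := (_ ^-1)%R; lra.
  move=> F2; have F1 : e (n x) != x.
    apply/eqP=> h; case/eqP: (loopless x xL).
    have -> : e x = n x by apply: (can_inj eK); rewrite eK.
    exact: origin_rot M.
  have FF : e (n (e (n x))) = x.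
    have := iter_porbit (n * e) x; have := card_porbit_neq0 (n * e) x.
    case: #|_| F2 => [|[|[|]]] //= _ _; first by rewrite permM => h; rewrite h eqxx in F1.
    by rewrite !permM.
  have nxL := map_closed M xL.
  have yE : e (n x) = e x.
    apply: sim; rewrite ?eL // ?eK ?(origin_rot _ M) //.
    have nF : n (e (n x)) = e x by rewrite -FF eK FF.
    by rewrite -nF (origin_rot _ M).
  have nx : n x = x by apply: (perm_inj yE).
  have nex : n (e x) = e x by apply: (can_inj eK); rewrite eK -[RHS]FF nx.
  rewrite comp_pair // (@porbit_pair n x x) // setUid cards1 cards2 eq_sym exx.
  rewrite (@porbit_pair (n * e) x (e x)) ?permM ?nx ?nex ?eK // cards2 eq_sym exx /=.
  lra.
have : (0 < \sum_(x in L) ((#|porbit n x|%:R)^-1 - 6%:R^-1) :> rat)%R.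
  apply: Order.POrderTheory.le_lt_trans w0 _.
  rewrite (bigID (mem L)) /= [X in (_ + X)%R]big1 => [|x xL]; last exact: w_dead.
  rewrite GRing.addr0; apply: Num.Theory.ltr_sum => [|x xL]; last exact: w_live.
  by apply/hasP; exists x0; rewrite ?mem_index_enum.
rewrite GRing.sumrB (sum_inv_degree M) GRing.sumr_const -GRing.mulr_natl => h.
have : (#|L|%:R < (6 * #|p @: L|)%:R :> rat)%R by rewrite GRing.natrM; move: h; lra.
by rewrite Num.Theory.ltr_nat.
Qed.

End EdgeBound.

Lemma porbit_comp (D : finType) (n : {perm D}) x y : (y \in porbit n x) = comp 1 n x y.
Proof.
apply/idP/idP; first exact: comp_rot.
apply: (@comp_ind _ 1 n x (fun y => y \in porbit n x)); first exact: porbit_id.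
  by move=> u; rewrite perm1.
by move=> u; rewrite porbit_step.
Qed.

(** Keeps the vertex labels in step with a merge: the label of [x] is replaced by that of [y]. *)
Lemma porbit_relabel (D : finType) (T : eqType) (n : {perm D}) (A : pred D) (P : D -> T) x y :
  {in A &, forall u w, (P u == P w) = (w \in porbit n u)} ->
  A x -> A y -> P x != P y ->
  {in A &, forall u w, let P' z := if P z == P x then P y else P z in
     (P' u == P' w) = (w \in porbit (tperm x y * n) u)}.
Proof.
move=> orb Ax Ay xy u w Au Aw /=.
have xNy : x \notin porbit n y by rewrite -orb // eq_sym.
rewrite porbit_comp comp_tperm // -!porbit_comp -!orb //.
case: (eqVneq (P u) (P x)) => [->|ux]; case: (eqVneq (P w) (P x)) => [->|wx].
- by rewrite !eqxx.
- by rewrite ?eqxx (negbTE xy) /= ?orbF.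
- by rewrite ?eqxx (eq_sym (P y)) ?(negbTE xy) (negbTE ux) /= andbT.
- by rewrite /= ?andbF ?orbF.
Qed.

(** * Disjoint unions, and the addition of an edge *)

Section Sum.
Variables (D B : finType).

Definition sum_fun (s : {perm D}) (t : {perm B}) (z : D + B) : D + B :=
  match z with inl x => inl (s x) | inr y => inr (t y) end.

Lemma sum_fun_inj s t : injective (sum_fun s t).
Proof. by move=> [x|x] [y|y] //= [/perm_inj ->]. Qed.

Definition sum_perm s t : {perm D + B} := perm (@sum_fun_inj s t).

Lemma sum_perml s t x : sum_perm s t (inl x) = inl (s x).
Proof. by rewrite permE. Qed.

Lemma sum_permr s t x : sum_perm s t (inr x) = inr (t x).
Proof. by rewrite permE. Qed.

Lemma sum_permM s s' t t' : sum_perm s t * sum_perm s' t' = sum_perm (s * s') (t * t').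
Proof. by apply/permP=> -[x|x]; rewrite !permM ?sum_perml ?sum_permr !permM. Qed.

Lemma card_classes_sumtype (r : rel (D + B)) (r1 : rel D) (r2 : rel B) :
  equivalence_rel r -> equivalence_rel r1 -> equivalence_rel r2 ->
  (forall x y, r (inl x) (inl y) = r1 x y) ->
  (forall x y, r (inr x) (inr y) = r2 x y) ->
  (forall x y, r (inl x) (inr y) = false) ->
  (forall x y, r (inr x) (inl y) = false) ->
  #|classes r| = #|classes r1| + #|classes r2|.
Proof.
move=> er er1 er2 h1 h2 h12 h21; apply/eqP; rewrite -(Num.Theory.eqr_nat rat) GRing.natrD.
rewrite !card_classes_sum // big_sumType /=; apply/eqP; congr (_ + _)%R; apply: eq_bigr => x _.
  suff -> : eclass r (inl x) = inl @: eclass r1 x by rewrite card_imset // => ? ? [].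
  apply/setP=> -[y|y]; rewrite !inE ?h1 ?h12.
    by rewrite mem_imset ?inE // => ? ? [].
  by apply/esym/imsetP=> -[].
suff -> : eclass r (inr x) = inr @: eclass r2 x by rewrite card_imset // => ? ? [].
apply/setP=> -[y|y]; rewrite !inE ?h2 ?h21; first by apply/esym/imsetP=> -[].
by rewrite mem_imset ?inE // => ? ? [].
Qed.

Lemma comp_sum (e n : {perm D}) (e' n' : {perm B}) :
  [/\ forall x y, comp (sum_perm e e') (sum_perm n n') (inl x) (inl y) = comp e n x y,
      forall x y, comp (sum_perm e e') (sum_perm n n') (inr x) (inr y) = comp e' n' x y,
      forall x y, comp (sum_perm e e') (sum_perm n n') (inl x) (inr y) = false
    & forall x y, comp (sum_perm e e') (sum_perm n n') (inr x) (inl y) = false].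
Proof.
set E := sum_perm e e'; set N := sum_perm n n'.
pose Pl x (z : D + B) := if z is inl y then comp e n x y else false.
pose Pr x (z : D + B) := if z is inr y then comp e' n' x y else false.
have hl x z : comp E N (inl x) z -> Pl x z.
  apply: (@comp_ind _ E N (inl x) (Pl x)); first exact: connect0.
    by move=> [u|u] //= xu; rewrite /E permE /=; apply: connect_trans xu (comp_e _ _ _).
  by move=> [u|u] //= xu; rewrite /N permE /=; apply: connect_trans xu (comp_n _ _ _).
have hr x z : comp E N (inr x) z -> Pr x z.
  apply: (@comp_ind _ E N (inr x) (Pr x)); first exact: connect0.
    by move=> [u|u] //= xu; rewrite /E permE /=; apply: connect_trans xu (comp_e _ _ _).
  by move=> [u|u] //= xu; rewrite /N permE /=; apply: connect_trans xu (comp_n _ _ _).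
split=> x y.
- apply/idP/idP; first exact: hl.
  apply: (@comp_ind _ e n x (fun y => comp E N (inl x) (inl y))); first exact: connect0.
    by move=> u xu; apply: connect_trans xu _; rewrite -(sum_perml e e'); apply: comp_e.
  by move=> u xu; apply: connect_trans xu _; rewrite -(sum_perml n n'); apply: comp_n.
- apply/idP/idP; first exact: hr.
  apply: (@comp_ind _ e' n' x (fun y => comp E N (inr x) (inr y))); first exact: connect0.
    by move=> u xu; apply: connect_trans xu _; rewrite -(sum_permr e e'); apply: comp_e.
  by move=> u xu; apply: connect_trans xu _; rewrite -(sum_permr n n'); apply: comp_n.
- by apply/negP=> /hl.
- by apply/negP=> /hr.
Qed.

Lemma sum_perm1 : sum_perm 1 1 = 1.
Proof. by apply/permP=> -[x|x]; rewrite ?sum_perml ?sum_permr !perm1. Qed.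

Lemma card_porbits_sum s t : #|porbits (sum_perm s t)| = #|porbits s| + #|porbits t|.
Proof.
rewrite !porbits_classes; have [h1 h2 h3 h4] := comp_sum 1 s 1 t.
rewrite sum_perm1 in h1 h2 h3 h4.
apply: card_classes_sumtype; try exact: porbit_equiv; move=> x y; rewrite !porbit_comp //.
Qed.

Lemma planar_sum (e n : {perm D}) (e' n' : {perm B}) :
  planar_perm e n -> planar_perm e' n' -> planar_perm (sum_perm e e') (sum_perm n n').
Proof.
rewrite /planar_perm => p1 p2; rewrite sum_permM !card_porbits_sum card_sum.
have [h1 h2 h3 h4] := comp_sum e n e' n'.
rewrite /ncomp (card_classes_sumtype _ _ _ h1 h2 h3 h4); try exact: comp_equiv.
by move: p1 p2; rewrite /ncomp; lia.
Qed.

End Sum.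

Section AddEdge.
Variables (V D : finType) (e : {perm D}).
Hypothesis eK : involutive e.

(** Two consecutive neighbors of a vertex lie on a common face, where an edge between them can be
    drawn. The new edge enters as a separate component with darts [a] and [b]; [a] is attached to
    [c1] by a merge of components, then [b] to [c2] by a merge inside a face. [iota] carries over
    the rotations at all other vertices. *)
Lemma map_add_edge n L (p : D -> V) d : plane_map e n L p -> d \in L ->
  let c1 := p (e d) in let c2 := p (e (n d)) in
  c1 != p d -> c1 != c2 ->
  exists (D' : finType) (e' n' : {perm D'}) (L' : {set D'}) (p' : D' -> V),
  [/\ involutive e', plane_map e' n' L' p',
      forall u w, adj e' L' p' u w =
       [|| adj e L p u w, (u == c1) && (w == c2) | (u == c2) && (w == c1)]
    & exists iota : D -> D', (forall x, p' (e' (iota x)) = p (e x)) /\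
        forall v s, v != c1 -> v != c2 -> rotation n L p v s ->
          rotation n' L' p' v (map iota s)].
Proof.
move=> M dL c1 c2 c1v c12; have [pl eL orb dead] := M.
pose D' := (D + bool)%type.
have negbI : injective negb by apply: inv_inj negbK.
pose ne : {perm bool} := perm negbI.
pose e' := sum_perm e ne; pose n0 := sum_perm n (1 : {perm bool}).
have pl0 : planar_perm e' n0.
  apply: planar_sum => //; rewrite /planar_perm porbits_one ncomp_one mul1g; lia.
pose a : D' := inr true; pose b : D' := inr false.
have e'a : e' a = b by rewrite sum_permr permE.
have e'b : e' b = a by rewrite sum_permr permE.
have e'l x : e' (inl x) = inl (e x) by apply: sum_perml.
have n0l x : n0 (inl x) = inl (n x) by apply: sum_perml.
have n0r x : n0 (inr x) = inr x by rewrite /n0 sum_permr perm1.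
pose x0 := n^-1 (e d); have nx0 : n x0 = e d by rewrite /x0 permKV.
pose x : D' := inl x0; pose y : D' := inl (e (n d)).
have x0L : x0 \in L.
  by apply: contraT => /[dup] /dead; rewrite nx0 => <-; rewrite eL.
have px0 : p x0 = c1 by rewrite -(origin_rot _ M) nx0.
have yL : e (n d) \in L by rewrite eL // (map_closed M dL).
have cross := comp_sum e n ne 1.
pose n1 := tperm a x * n0.
have pl1 : planar_perm e' n1.
  by apply: planar_merge_comp => //; have [_ _ _ ->] := cross.
pose n2 := tperm b y * n1.
have n1b : n1 b = b by rewrite permM tpermD ?n0r.
have n1x : n1 x = a by rewrite permM tpermR n0r.
have n1a : n1 a = inl (e d) by rewrite permM tpermL n0l nx0.
have n1d : n1 (inl d) = inl (n d).
  rewrite permM tpermD ?n0l //.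
  by apply: contraNneq c1v => -[xd]; rewrite -px0 xd.
pose A : pred D' := fun z => if z is inl z then z \in L else true.
pose P0 (z : D') : V + bool := match z with inl z => inl (p z) | inr z => inr z end.
have orb0 : {in A &, forall u w, (P0 u == P0 w) = (w \in porbit n0 u)}.
  have [h1 h2 h3 h4] := comp_sum 1 n 1 (1 : {perm bool}).
  rewrite sum_perm1 in h1 h2 h3 h4.
  move=> [u|u] [w|w] uA wA; rewrite porbit_comp ?h1 ?h2 ?h3 ?h4 //= -porbit_comp.
    by rewrite -orb.
  rewrite -[LHS]/(u == w); apply/eqP/idP=> [->|/porbitP[i ->]]; first exact: porbit_id.
  by rewrite expg1n perm1.
have ax : P0 a != P0 x by [].
have orb1 := porbit_relabel orb0 (isT : A a) (x0L : A x) ax.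
pose P1 z := if P0 z == P0 a then P0 x else P0 z; rewrite -/P1 -/n1 /= in orb1.
have byP : P1 b != P1 y by [].
have orb2 := porbit_relabel orb1 (isT : A b) (yL : A y) byP.
rewrite -/n2 /= in orb2.
have pl2 : planar_perm e' n2.
  apply: planar_merge_face => //.
    rewrite porbit_sym -orb1 // eq_sym; exact: byP.
  (* With [a] attached, the face walk from [b] goes through [a] and [d] to [y]. *)
  rewrite porbit_sym; have := mem_porbit (n1 * e') 3 b.
  have F1 : (n1 * e') b = a by rewrite permM n1b.
  have F2 : (n1 * e') a = inl d by rewrite permM n1a e'l eK.
  have F3 : (n1 * e') (inl d) = y by rewrite permM n1d e'l.
  by rewrite permX /= F1 F2 F3.
pose p' (z : D') : V := match z with inl z => p z | inr true => c1 | inr false => c2 end.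
pose L' : {set D'} := [set z | A z].
have e'K : involutive e'.
  by move=> [z|[]]; rewrite ?e'l ?eK // -/a -/b ?e'a ?e'b ?e'a.
exists D', e', n2, L', p'; split=> //.
  split=> //.
  - by move=> [z|z]; rewrite !inE ?e'l /=; [apply: eL | rewrite sum_permr].
  - move=> u w; rewrite !inE => uA wA; rewrite -orb2 // /P1.
    have h z : (if (if P0 z == P0 a then P0 x else P0 z) == (if P0 b == P0 a then P0 x else P0 b)
       then (if P0 y == P0 a then P0 x else P0 y) else (if P0 z == P0 a then P0 x else P0 z))
      = inl (p' z) :> V + bool.
      by case: z => [z|[]] //=; rewrite px0.
    by rewrite !h.
  - move=> [z|z]; rewrite inE //= => zL.
    rewrite permM tpermD //; last by apply: contraNneq zL => -[<-].
    rewrite permM tpermD //; last by apply: contraNneq zL => -[<-].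
    by rewrite n0l dead.
- move=> u w; apply/adjP/or3P=> [[[z|z]]|[/adjP[z zL [pz pez]]|/andP[/eqP -> /eqP ->]|/andP[/eqP -> /eqP ->]]].
  + rewrite inE /= e'l /= => zL [pz pez]; constructor 1; apply/adjP; by exists z.
  + case: z => _ /= [<-]; rewrite ?(e'a : e' (inr true) = b) ?(e'b : e' (inr false) = a) => /= <-.
      by constructor 2; rewrite !eqxx.
    by constructor 3; rewrite !eqxx.
  + by exists (inl z); rewrite ?inE //= e'l.
  + by exists a; rewrite ?inE // e'a.
  + by exists b; rewrite ?inE // e'b.
- exists inl; split=> [z|v s vc1 vc2 [us cs sE]]; first by rewrite e'l.
  split; first by rewrite map_inj_uniq // => ? ? [].
    have n2l z : z \in s -> n2 (inl z) = inl (n z).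
      rewrite sE => /andP[zL /eqP pz]; rewrite permM tpermD //; last first.
        by apply: contraNneq vc2 => -[yz]; rewrite -pz -yz.
      rewrite permM tpermD ?n0l //.
      by apply: contraNneq vc1 => -[xz]; rewrite -pz -xz px0.
    rewrite (cycle_map (f := inl)); apply: (sub_in_cycle (P := mem s) _ _ cs); last exact/allP.
    by move=> z z' zs _ /= /eqP <-; rewrite n2l.
  move=> [z|z]; rewrite [_ \in L']inE /=.
    by rewrite mem_map ?sE // => ? ? [].
  apply/mapP/eqP=> [[? _ //]|pz].
  by case: z pz => pz; [move: vc1|move: vc2]; rewrite -pz eqxx.
Qed.

End AddEdge.

Lemma noncrossing_singletons (T : Type) (s : seq T) : 0 < size s ->
  noncrossing s [seq [:: x] | x <- s].
Proof.
elim: s => // x [|y s] IH _; first exact: NcOne.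
rewrite -[x :: y :: s]cat1s map_cat; apply: NcCat => //; last exact: IH.
exact: NcOne.
Qed.

(** * Simplification of maps and the five color theorem *)

Section Reduction.
Variables (V D : finType) (e : {perm D}).
Hypothesis eK : involutive e.
Implicit Types (n : {perm D}) (L : {set D}) (p : D -> V).

(** A labelling that is proper and survives the merge certifies that no loop arises. The type of
    labels is arbitrary, so the certificate need not be a 5-coloring. *)
Lemma merged_irreflexive (T : eqType) (phi : V -> T) L p (r : V -> V) (L' : {set D}) :
  L' \subset L -> (forall u, phi (r u) = phi u) ->
  (forall u w, adj e L p u w -> phi u != phi w) -> irreflexive (adj e L' (r \o p)).
Proof.
move=> /subsetP sL pr pp u; apply/negbTE/negP=> /adjP[x xL' [/= h1 h2]].
have : phi (p x) != phi (p (e x)) by apply: pp; apply/adjP; exists x; rewrite ?sL.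
by rewrite -pr -(pr (p (e x))) h1 h2 eqxx.
Qed.

(** One edge is kept in each parallel class. The dart is picked for pairs increasing in the
    enumeration of [V], and its reverse serves the opposite pair, so that the kept set is closed
    under [e]. *)
Lemma map_simplify n L p : plane_map e n L p -> irreflexive (adj e L p) ->
  exists n' L', [/\ plane_map e n' L' p, adj e L' p =2 adj e L p,
    simple_map e L' p & p @: L' = p @: L].
Proof.
move=> M irr; have [_ eL _ _] := M.
pose c u w := [pick x in L | (p x == u) && (p (e x) == w)].
pose lt (u w : V) := enum_rank u < enum_rank w.
have ltN (u w : V) : u != w -> lt w u = ~~ lt u w.
  move=> uw; rewrite /lt; case: ltngtP => // /val_inj/enum_rank_inj wu.
  by rewrite wu eqxx in uw.
have nl x : x \in L -> p x != p (e x).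
  by move=> xL; apply: contraFneq (irr (p x)) => h; apply/adjP; exists x.
pose L' := [set x in L | if lt (p x) (p (e x)) then c (p x) (p (e x)) == Some x
                        else c (p (e x)) (p x) == Some (e x)].
have sL : L' \subset L by apply/subsetP=> x; rewrite inE => /andP[].
have eL' : {in L', forall x, e x \in L'}.
  move=> x; rewrite !inE eK => /andP[xL]; rewrite eL //= (ltN _ _ (nl x xL)).
  by case: (lt _ _).
have [n' M'] := map_prune M sL eL'.
have adjE : adj e L' p =2 adj e L p.
  have half u w : lt u w -> adj e L p u w -> adj e L' p u w.
    move=> uw /adjP[x xL [pu pw]].
    have : c u w != None.
      by rewrite /c; case: pickP => // /(_ x); rewrite /= xL pu pw !eqxx.
    case cE: (c u w) => [y|] // _; apply/adjP; exists y.
      move: (cE); rewrite /c; case: pickP => //= z /and3P[zL /eqP zu /eqP zw] [zy].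
      by rewrite -zy inE zL zu zw uw cE zy eqxx.
    by move: cE; rewrite /c; case: pickP => //= z /and3P[zL /eqP zu /eqP zw] [<-].
  move=> u w; apply/idP/idP.
    by case/adjP=> x xL' [pu pw]; apply/adjP; exists x => //; apply: (subsetP sL).
  move=> a; have uw : u != w by apply: contraTneq a => ->; rewrite irr.
  case: (boolP (lt u w)) => [h|]; first exact: half.
  rewrite -ltN // => h; rewrite (adj_sym eK M'); apply: half => //.
  by rewrite (adj_sym eK M).
exists n', L'; split=> //.
  move=> x y; rewrite !inE => /andP[xL hx] /andP[yL hy] pxy pexy.
  move: hx hy; rewrite -pxy -pexy; case: (lt _ _) => /eqP -> /eqP [] //.
  exact: perm_inj.
apply/setP=> u; apply/imsetP/imsetP=> -[x xL ->].
  by exists x => //; apply: (subsetP sL).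
have : adj e L' p (p x) (p (e x)) by rewrite adjE; apply/adjP; exists x.
by case/adjP=> y yL' [<- _]; exists y.
Qed.

Lemma low_degree_vertex n L p : plane_map e n L p -> irreflexive (adj e L p) ->
  simple_map e L p -> L != set0 ->
  exists v s, [/\ rotation n L p v s, 0 < size s & size s <= 5].
Proof.
move=> M irr sim L0; have lt6 := edge_bound eK M irr sim L0.
pose deg u := #|[set x in L | p x == u]|.
have sumdeg : #|L| = \sum_(u in p @: L) deg u.
  rewrite -sum1_card (partition_big p (mem (p @: L))) /=; last by move=> x xL; rewrite imset_f.
  apply: eq_bigr => u _; rewrite /deg -sum1_card; apply: eq_bigl => x; by rewrite inE.
have [v vL dv] : exists2 v, v \in p @: L & deg v <= 5.
  apply/exists_inP; apply: contraLR lt6 => /exists_inPn h.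
  rewrite -leqNgt sumdeg mulnC -sum_nat_const; apply: leq_sum => u uL.
  by rewrite ltnNge; apply: h.
have [s rs] := rotation_exists v M; exists v, s; split=> //.
  case: rs => _ _ sE; case/imsetP: vL => x xL vx.
  by have : x \in s; [rewrite sE xL vx eqxx | case: (s)].
case: rs => us _ sE; rewrite -(card_uniqP us); apply: leq_trans dv.
by apply: subset_leq_card; apply/subsetP=> x; rewrite inE sE.
Qed.

Lemma fresh_color (T : finType) (s : seq T) : size s < #|T| -> exists c, c \notin s.
Proof.
move=> lt; apply/existsP; apply: contraLR lt => /existsPn h; rewrite -leqNgt.
rewrite cardE; apply: uniq_leq_size; first exact: enum_uniq.
by move=> x _; have := h x; rewrite negbK.
Qed.

(** The neighbors of [v] show at most one color for each block, hence at most four, and a fifth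
    color is free. *)
Lemma extend_coloring n L p v s bs r (f2 : V -> 'I_5) :
  plane_map e n L p -> ~~ adj e L p v v -> rotation n L p v s ->
  noncrossing s bs -> size bs <= 4 ->
  {in bs, forall b, {in b &, forall x y, r (p (e x)) = r (p (e y))}} ->
  (forall u w, adj e [set x in L | (p x != v) && (p (e x) != v)] (r \o p) u w -> f2 u != f2 w) ->
  exists2 f : {ffun V -> 'I_5}, forall u w, adj e L p u w -> f u != f w
    & forall u, u != v -> f u = f2 (r u).
Proof.
move=> M irr rs nc szb H1 hf.
pose cols := [seq (if b is x :: _ then f2 (r (p (e x))) else ord0) | b <- bs].
have [c cN] : exists c, c \notin cols.
  by apply: fresh_color; rewrite size_map card_ord.
have cnbr x : x \in s -> f2 (r (p (e x))) != c.
  rewrite -(perm_mem (noncrossing_perm nc)) => /flattenP[b bB xb].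
  apply: contraNneq cN => <-; apply/mapP; exists b => //.
  by case: b bB xb => // y b bB xb; rewrite (H1 _ bB x y) ?mem_head.
exists [ffun u => if u == v then c else f2 (r u)] => [u w auw|u uv]; rewrite !ffunE; last first.
  by rewrite (negbTE uv).
case: (eqVneq u v) => [uv|uv]; case: (eqVneq w v) => [wv|wv].
- by rewrite uv wv (negbTE irr) in auw.
- have : adj e L p v w by rewrite -uv.
  by rewrite (rotation_nbr M rs) => /mapP[x xs ->]; rewrite eq_sym cnbr.
- have : adj e L p v u by rewrite -wv (adj_sym eK M).
  by rewrite (rotation_nbr M rs) => /mapP[x xs ->]; rewrite cnbr.
- apply: hf; case/adjP: auw => x xL [pu pw]; apply/adjP; exists x; last by rewrite /= pu pw.
  by rewrite inE xL pu uv pw wv.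
Qed.

(** Being [v] and being the origin of a live dart are both constant on the blocks, so [r] preserves
    them; the support is mapped into itself and loses [v]. *)
Lemma merged_card n L p v s bs r : plane_map e n L p -> ~~ adj e L p v v ->
  rotation n L p v s -> noncrossing s bs -> 0 < size s ->
  (forall phi : V -> bool,
     {in bs, forall b, {in b &, forall x y, phi (p (e x)) = phi (p (e y))}} ->
     forall u, phi (r u) = phi u) ->
  #|(r \o p) @: [set x in L | (p x != v) && (p (e x) != v)]| < #|p @: L|.
Proof.
move=> M irr [us cs sE] nc s0 U1.
have sL x : x \in s -> x \in L by rewrite sE => /andP[].
have sv x : x \in s -> p x = v by rewrite sE => /andP[_ /eqP].
have nbr b x : b \in bs -> x \in b -> x \in s.
  by move=> bB xb; rewrite -(perm_mem (noncrossing_perm nc)); apply/flattenP; exists b.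
have nv x : x \in s -> p (e x) != v.
  by move=> xs; apply: contraNneq irr => h; apply/adjP; exists x; [exact: sL | split=> //; exact: sv].
have rv u : (r u == v) = (u == v).
  apply: (U1 (fun u => u == v)) => b bB x y xb yb.
  by rewrite !(negbTE (nv _ _)) //; apply: nbr bB _.
have rL u : (r u \in p @: L) = (u \in p @: L).
  apply: (U1 (fun u => u \in p @: L)) => b bB x y xb yb.
  have [_ eL _ _] := M.
  by rewrite !imset_f //; apply/eL/sL; apply: nbr bB _.
rewrite (cardsD1 v (p @: L)).
have -> : v \in p @: L.
  by case: (s) s0 sL sv => // x s' _ sL sv; rewrite -(sv x) ?mem_head // imset_f ?sL ?mem_head.
rewrite add1n ltnS; apply: subset_leq_card; apply/subsetP=> u /imsetP[x]; rewrite inE.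
by case/and3P=> xL xv _ -> /=; rewrite !inE rv xv rL imset_f.
Qed.

(** Induction on the number of vertices by merging, without Kempe chains. At a vertex of degree five
    the edges between the ends of [x1], [x3] and of [x2], [x4] cannot both exist, since they would
    cross; a nonadjacent pair is merged, leaving four blocks. *)
Lemma five_color n L p : plane_map e n L p -> irreflexive (adj e L p) ->
  exists f : {ffun V -> 'I_5}, forall u w, adj e L p u w -> f u != f w.
Proof.
have [k] := ubnP #|p @: L|; elim: k n L p => // k IH n L p lek M irr.
have [L0|L0] := eqVneq L set0.
  by exists [ffun _ => ord0] => u w /adjP[x]; rewrite L0 inE.
have [n1 [L1 [M1 adjE sim p1]]] := map_simplify M irr.
have irr1 : irreflexive (adj e L1 p) by move=> u; rewrite adjE.
have L10 : L1 != set0.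
  by case/set0Pn: L0 => x xL; apply: contraTneq (imset_f p xL) => L10; rewrite -p1 L10 imset0 inE.
have [v [s [rs s0 s5]]] := low_degree_vertex M1 irr1 sim L10.
have [us cs sE] := rs.
have sL x : x \in s -> x \in L1 by rewrite sE => /andP[].
have sv x : x \in s -> p x = v by rewrite sE => /andP[_ /eqP].
suff [bs [nc szb [phi [hphi pphi]]]] : exists bs, [/\ noncrossing s bs, size bs <= 4 &
   exists phi : V -> V, {in bs, forall b, {in b &, forall x y, phi (p (e x)) = phi (p (e y))}} /\
     forall u w, adj e L1 p u w -> phi u != phi w].
  have [n2 [r [M2 H1 U1 _]]] := map_merge eK M1 (negbT (irr1 v)) rs nc.
  set L2 := [set x in L1 | _] in M2.
  have L21 : L2 \subset L1 by apply/subsetP=> x; rewrite inE => /andP[].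
  have irr2 : irreflexive (adj e L2 (r \o p)).
    by apply: (merged_irreflexive L21 (U1 _ _ hphi) pphi).
  have lt2 : #|(r \o p) @: L2| < k.
    rewrite -p1 ltnS in lek; apply: leq_trans lek.
    by apply: (merged_card M1 (negbT (irr1 v)) rs nc s0) => phi0; apply: U1.
  have [f2 hf2] := IH _ _ _ lt2 M2 irr2.
  have [f hf _] := extend_coloring M1 (negbT (irr1 v)) rs nc szb H1 hf2.
  by exists f => u w; rewrite -adjE; apply: hf.
have [s4|s4] := leqP (size s) 4.
  exists [seq [:: x] | x <- s]; split; [exact: noncrossing_singletons|by rewrite size_map|].
  exists id; split=> [b /mapP[x _ ->] y z|u w a]; first by rewrite !inE => /eqP -> /eqP ->.
  by apply: contraTneq a => ->; rewrite irr1.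
have se5 : size s = 5 by apply/eqP; rewrite eqn_leq s5 s4.
have merge x y : x \in s -> y \in s -> subseq [:: x; y] s -> ~~ adj e L1 p (p (e x)) (p (e y)) ->
  exists bs, [/\ noncrossing s bs, size bs <= 4 &
   exists phi : V -> V, {in bs, forall b, {in b &, forall x y, phi (p (e x)) = phi (p (e y))}} /\
     forall u w, adj e L1 p u w -> phi u != phi w].
  move=> xs ys sub nadj; have [bs [nc tb one szb]] := noncrossing_subseq (isT : 0 < size [:: x; y]) sub.
  exists bs; split=> //; first by move: szb; rewrite se5 /= !addnS addn0.
  exists (fun u => if u == p (e y) then p (e x) else u); split.
    move=> b /one [-> a c|].
      have E z : z \in [:: x; y] -> (if p (e z) == p (e y) then p (e x) else p (e z)) = p (e x).
        by rewrite !inE => /orP[] /eqP ->; case: ifP => //; rewrite eqxx.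
      by move=> ha hc; rewrite !E.
    by case: b => [|a [|]] // _ c d; rewrite !inE => /eqP -> /eqP ->.
  move=> u w auw; have nyx : ~~ adj e L1 p (p (e y)) (p (e x)) by rewrite (adj_sym eK M1).
  case: (eqVneq u (p (e y))) => [uy|uy]; case: (eqVneq w (p (e y))) => [wy|wy].
  - by rewrite uy wy irr1 in auw.
  - by apply: contraNneq nyx => ->; rewrite -uy.
  - by apply: contraNneq nadj => <-; rewrite -wy.
  - by apply: contraTneq auw => ->; rewrite irr1.
case: s rs us cs sE sL sv s0 s5 s4 se5 merge => [|x1 [|x2 [|x3 [|x4 [|x5 [|]]]]]] // rs us cs sE sL sv _ _ _ _ merge.
set s := [:: x1; x2; x3; x4; x5] in rs us sE sL sv merge.
have subs t : t \in [:: [:: x1; x3]; [:: x2; x4]; [:: x1; x2; x3; x4]] -> subseq t s.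
  rewrite !inE => /or3P[] /eqP ->; rewrite /s.
  - by have := @mask_subseq _ [:: true; false; true] [:: x1; x2; x3; x4; x5].
  - by have := @mask_subseq _ [:: false; true; false; true] [:: x1; x2; x3; x4; x5].
  - by have := @mask_subseq _ [:: true; true; true; true] [:: x1; x2; x3; x4; x5].
have ins : [/\ x1 \in s, x2 \in s, x3 \in s & x4 \in s] by split; rewrite !inE eqxx ?orbT.
have [i1 i2 i3 i4] := ins.
have [a13|] := boolP (adj e L1 p (p (e x1)) (p (e x3))); last first.
  by apply: merge => //; apply: subs; rewrite !inE eqxx.
have [a24|] := boolP (adj e L1 p (p (e x2)) (p (e x4))); last first.
  by apply: merge => //; apply: subs; rewrite !inE eqxx orbT.
exfalso; have ne x y : x \in s -> y \in s -> x != y -> p (e x) != p (e y).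
  move=> xs ys; apply: contraNneq => h; apply/eqP; apply: sim => //; rewrite ?sL //.
  by rewrite !sv.
have nv x : x \in s -> v != p (e x).
  move=> xs; apply: contraFneq (irr1 v) => h; apply/adjP; exists x; [exact: sL | split=> //; exact: sv].
have e1 : p (e x1) != p (e x2) by apply: ne => //; move: us; rewrite /s /= !inE !negb_or => /and5P[/and4P[]].
have e2 : p (e x1) != p (e x4) by apply: ne => //; move: us; rewrite /s /= !inE !negb_or => /and5P[/and4P[]].
have e3 : p (e x3) != p (e x2).
  by rewrite eq_sym; apply: ne => //; move: us; rewrite /s /= !inE !negb_or => /and5P[_ /and3P[]].
have e4 : p (e x3) != p (e x4).
  by apply: ne => //; move: us; rewrite /s /= !inE !negb_or => /and5P[_ _ /andP[]].
have sub4 : subseq [:: x1; x2; x3; x4] s by apply: subs; rewrite !inE eqxx !orbT.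
apply: (@no_crossing V D e eK n1 L1 p v s x1 x2 x3 x4 (pred2 (p (e x1)) (p (e x3)))
  (pred2 (p (e x2)) (p (e x4))) M1 rs sub4) => //=.
- by move=> u /orP[] /eqP ->; rewrite negb_or ?e1 ?e2 ?e3 ?e4.
- by rewrite negb_or !nv.
- by rewrite negb_or !nv.
- by rewrite eqxx.
- by rewrite eqxx.
- by apply: connect1; rewrite /= !eqxx orbT.
- by apply: connect1; rewrite /= !eqxx orbT.
Qed.

End Reduction.

End CombinatorialMaps.

(** * Recoloring and merging *)

Section Recoloring.
Variable V : finType.
Implicit Types (E : rel V) (f g h : {ffun V -> 'I_5}) (S : {set V}) (t : V -> nat) (a b : 'I_5).

Definition proper_for E f := forall u w, E u w -> f u != f w.

Definition swap_colors a b S f : {ffun V -> 'I_5} :=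
  [ffun x => if x \in S then tperm a b (f x) else f x].

(* [S] is a union of Kempe chains of [f] in the colors [a] and [b]. *)
Definition swappable E f a b S :=
  {in S, forall x, f x \in [:: a; b] /\
     forall y, E x y -> f y \in [:: a; b] -> y \in S}.

(* [g] is obtained from [f] by swaps that change each vertex [x] at most [t x] times. *)
Inductive reach E : {ffun V -> 'I_5} -> {ffun V -> 'I_5} -> (V -> nat) -> Prop :=
| ReachRefl f t : reach E f f t
| ReachStep a b S f g t t' : a != b -> swappable E f a b S ->
    reach E (swap_colors a b S f) g t -> (forall x, (x \in S) + t x <= t' x) ->
    reach E f g t'.

Lemma reach_le E f g t t' : reach E f g t -> (forall x, t x <= t' x) -> reach E f g t'.
Proof.
case=> {f g t} [f t _|a b S f g t1 t ab sw R le1 le2]; first exact: ReachRefl.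
by apply: (ReachStep ab sw R) => x; apply: leq_trans (le1 x) (le2 x).
Qed.

Lemma reach_trans E f g h t1 t2 : reach E f g t1 -> reach E g h t2 ->
  reach E f h (fun x => t1 x + t2 x).
Proof.
move=> R1 R2; elim: R1 R2 => {f g t1} [f t R|a b S f g t t' ab sw _ IH le R2].
  by apply: reach_le R _ => x; apply: leq_addl.
apply: (ReachStep ab sw (IH R2)) => x; rewrite addnA leq_add2r; exact: le.
Qed.

Lemma swap_colorsK a b S f : swap_colors a b S (swap_colors a b S f) = f.
Proof. by apply/ffunP=> x; rewrite !ffunE; case: (x \in S); rewrite ?tpermK. Qed.

Lemma mem_swap a b c : (tperm a b c \in [:: a; b]) = (c \in [:: a; b]).
Proof.
rewrite !inE; case: tpermP => [->|->|/eqP/negbTE -> /eqP/negbTE ->] //;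
by rewrite ?eqxx ?orbT.
Qed.

Lemma swappable_sym E f a b S : swappable E f a b S ->
  swappable E (swap_colors a b S f) a b S.
Proof.
move=> sw x xS; have [fx cl] := sw x xS; rewrite ffunE xS mem_swap; split=> // y xy.
by rewrite ffunE; case: ifP => // yS; apply: contraTT => _; apply: contraFN yS; apply: cl.
Qed.

Lemma reach_sym E f g t : reach E f g t -> reach E g f t.
Proof.
elim=> {f g t} [f t|a b S f g t t' ab sw _ IH le]; first exact: ReachRefl.
have R1 : reach E (swap_colors a b S f) f (fun x => (x \in S) + 0).
  apply: (ReachStep ab (swappable_sym sw) (t := fun _ => 0)) => //.
  by rewrite swap_colorsK; apply: ReachRefl.
apply: reach_le (reach_trans IH R1) _ => x; rewrite addn0 addnC; exact: le.
Qed.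

Lemma reach_sub E E' f g t : subrel E E' -> reach E' f g t -> reach E f g t.
Proof.
move=> sub; elim=> {f g t} [f t|a b S f g t t' ab sw _ IH le]; first exact: ReachRefl.
by apply: (ReachStep ab _ IH le) => x xS; have [fx cl] := sw x xS; split=> // y /sub; apply: cl.
Qed.

Lemma swap_proper E f a b S : symmetric E -> proper_for E f -> swappable E f a b S ->
  proper_for E (swap_colors a b S f).
Proof.
move=> sE pf sw.
have mix u w : E u w -> u \in S -> w \notin S -> tperm a b (f u) != f w.
  move=> uw uS wS; have [fu cl] := sw u uS.
  by apply: contraNneq wS => h; apply: cl uw _; rewrite -h mem_swap.
move=> u w uw; rewrite !ffunE.
case: (boolP (u \in S)) => uS; case: (boolP (w \in S)) => wS.
- by rewrite (inj_eq perm_inj) pf.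
- exact: mix.
- by rewrite eq_sym mix // sE.
- exact: pf.
Qed.

Lemma swappable1 E f v d : proper_for E f -> d != f v ->
  (forall y, E v y -> f y != d) -> swappable E f (f v) d [set v].
Proof.
move=> pf dv nd x; rewrite inE => /eqP ->; rewrite mem_head; split=> // y vy.
by rewrite !inE eq_sym (negbTE (pf _ _ vy)) (negbTE (nd y vy)).
Qed.

Lemma swap_colors1 f v d : swap_colors (f v) d [set v] f = [ffun x => if x == v then d else f x].
Proof. by apply/ffunP=> x; rewrite !ffunE inE; case: eqP => // ->; rewrite tpermL. Qed.

(* A vertex [v] seeing at most four vertices of the reduced graph can follow any
   recoloring of that graph, changing at most once per change of a neighbor:
   when it obstructs a swap, two of its neighbors share a color and it is free
   to move away first. *)
Lemma reach_lift E E' (r : V -> V) v (Z : seq V) f' g' t' f g :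
  symmetric E -> ~~ E v v ->
  (forall x y, x != v -> y != v -> E x y -> E' (r x) (r y)) ->
  size Z <= 4 -> (forall x, E v x -> r x \in Z) ->
  reach E' f' g' t' -> proper_for E f -> proper_for E g ->
  (forall x, x != v -> f x = f' (r x)) -> (forall x, x != v -> g x = g' (r x)) ->
  reach E f g (fun x => if x == v then (\sum_(z <- Z) t' z).+1 else t' (r x)).
Proof.
move=> sE nvv hE Z4 hZ R pf pg; elim: R f pf => {f' g' t'} [f' t' f pf ff' gf'|].
  have [fg|fg] := eqVneq (f v) (g v).
    have -> : f = g.
      by apply/ffunP=> x; have [->//|xv] := eqVneq x v; rewrite ff' ?gf'.
    exact: ReachRefl.
  have sw : swappable E f (f v) (g v) [set v].
    apply: swappable1; rewrite // 1?eq_sym // => y vy.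
    have yv : y != v by apply: contraTneq vy => ->.
    by rewrite ff' // -gf' // eq_sym; apply: pg.
  apply: (ReachStep (t := fun _ => 0) fg sw); last first.
    by move=> x; rewrite inE; case: eqP.
  rewrite swap_colors1; have -> : [ffun x => if x == v then g v else f x] = g.
    apply/ffunP=> x; rewrite ffunE; have [->//|xv] := eqVneq x v; by rewrite ff' ?gf'.
  exact: ReachRefl.
move=> a b S' f' g' t t' ab sw' _ IH le f pf ff' gg'.
pose S := [set x | (x != v) && (r x \in S')].
have inS x : (x \in S) = (x != v) && (r x \in S') by rewrite inE.
have clS x y : x \in S -> y != v -> E x y -> f y \in [:: a; b] -> y \in S.
  rewrite !inS => /andP[xv xS'] yv xy; have [_ cl] := sw' _ xS'.
  by rewrite yv ff' //= => fy; apply: cl (hE _ _ xv yv xy) fy.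
have colS x : x \in S -> f x \in [:: a; b].
  by rewrite inS => /andP[xv xS']; rewrite ff' //; have [] := sw' _ xS'.
have vne x : E v x -> x != v by apply: contraTneq => ->.
(* [k] counts a move made by [v] before the swap. Such a move, or the participation of [v] in the
   swap, is paid by an entry of [Z] lying in [S']; the successor in the budget is kept for the final
   move of [v] to its color in [g]. *)
have finish f0 S0 (k : nat) : proper_for E f0 -> (forall x, x != v -> f0 x = f x) ->
   swappable E f0 a b S0 -> (forall x, x != v -> (x \in S0) = (x \in S)) ->
   (v \in S0) + k <= \sum_(z <- Z) (z \in S') ->
   reach E f0 g (fun x => if x == v then (\sum_(z <- Z) t' z).+1 - k else t' (r x)).
  move=> pf0 f0f sw0 S0S kS.
  have ff0 x : x != v -> swap_colors a b S0 f0 x = swap_colors a b S' f' (r x).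
    by move=> xv; rewrite !ffunE S0S // inS xv f0f // ff'.
  have R := IH _ (swap_proper sE pf0 sw0) ff0 gg'.
  have sumle : \sum_(z <- Z) (z \in S') + \sum_(z <- Z) t z <= \sum_(z <- Z) t' z.
    by rewrite -big_split /=; apply: leq_sum => z _; apply: le.
  apply: (ReachStep ab sw0 R) => x; case: eqP => [->|/eqP xv].
    by move: kS sumle; case: (v \in S0) => /=; lia.
  by rewrite S0S // inS xv; apply: le.
have S_ok f0 : (forall x, x != v -> f0 x = f x) ->
    (forall x, E v x -> x \in S -> f0 v \in [:: a; b] -> False) -> swappable E f0 a b S.
  move=> f0f nv x xS; have xv : x != v by move: xS; rewrite inS => /andP[].
  rewrite f0f // colS //; split=> // y xy; have [yv|yv] := eqVneq y v.
    by subst y => h; case: (nv x) => //; rewrite sE.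
  by rewrite f0f //; apply: clS xS yv xy.
have vS : v \in S = false by rewrite inS eqxx.
have drop0 : reach E f g (fun x => if x == v then (\sum_(z <- Z) t' z).+1 - 0 else t' (r x)) ->
   reach E f g (fun x => if x == v then (\sum_(z <- Z) t' z).+1 else t' (r x)).
  by move=> R; apply: reach_le R _ => x; rewrite subn0.
have [cab|cab] := boolP (f v \in [:: a; b]); last first.
  apply: drop0; apply: (finish f S) => //; last by rewrite vS.
  by apply: S_ok => // x _ _; rewrite (negbTE cab).
have [/existsP[y1 /andP[vy1 y1S]]|noS] := boolP [exists y, E v y && (y \in S)]; last first.
  apply: drop0; apply: (finish f S) => //; last by rewrite vS.
  by apply: S_ok => // x vx xS _; case/negP: noS; apply/existsP; exists x; rewrite vx.
have sum1 : 0 < \sum_(z <- Z) (z \in S').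
  rewrite (big_rem (r y1)) /=; last exact: hZ.
  by move: y1S; rewrite inS => /andP[_ ->].
have [/existsP[y2 /and3P[vy2 y2S fy2]]|allS] := boolP [exists y, [&& E v y, y \notin S & f y \in [:: a; b]]]; last first.
  apply: drop0; apply: (finish f (v |: S)) => //.
  - move=> x; rewrite in_setU1 => /orP[/eqP ->|xS].
      split=> // y vy fy; rewrite in_setU1; apply/orP; right.
      by apply: contraNT allS => yS; apply/existsP; exists y; rewrite vy yS.
    split; first exact: colS.
    move=> y xy fy; rewrite in_setU1; have [//|yv] := eqVneq y v.
    exact: clS xS yv xy fy.
  - by move=> x xv; rewrite in_setU1 (negbTE xv).
  - by rewrite setU11 addn0.
have twocol x : E v x -> f x \in [:: a; b] -> f x = f y1.
  have two c d k : c \in [:: a; b] -> d \in [:: a; b] -> k \in [:: a; b] -> c != k -> d != k -> c = d.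
    rewrite !inE => /orP[] /eqP -> /orP[] /eqP -> /orP[] /eqP ->; rewrite ?eqxx //.
  move=> vx fx; apply: (two _ _ (f v)) => //; first exact: colS.
    by rewrite eq_sym; apply: pf.
  by rewrite eq_sym; apply: pf.
have r12 : r y2 != r y1.
  have [v1 v2] := (vne _ vy1, vne _ vy2).
  by apply: contraNneq y2S => h; rewrite inS v2 h; move: y1S; rewrite inS => /andP[].
(* [y1] and [y2] have the same color but different images under [r], so the at most three entries of
   [Z] left after removing [r y1] still show every color around [v]. Together with [f v] this
   excludes at most four colors. *)
have [d dN] : exists d, d \notin f v :: [seq f' z | z <- rem (r y1) Z].
  apply: fresh_color; rewrite card_ord /= size_map size_rem ?hZ //.
  by case: (size Z) Z4.
move: dN; rewrite inE negb_or => /andP[dv dN].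
have inrem x : x \in Z -> x != r y1 -> x \in rem (r y1) Z.
  move=> xZ xy; move: (perm_to_rem (hZ _ vy1)) => /perm_mem /(_ x).
  by rewrite inE (negbTE xy) xZ.
have d2 : f y1 != d.
  apply: contraNneq dN => <-; rewrite -(twocol y2 vy2 fy2) (ff' _ (vne _ vy2)).
  by apply: map_f; apply: inrem; rewrite // hZ.
have dnbr y : E v y -> f y != d.
  move=> vy; rewrite ff' ?vne //; have [->|ry] := eqVneq (r y) (r y1).
    by rewrite -ff' ?vne.
  by apply: contraNneq dN => <-; apply: map_f; apply: inrem; rewrite ?hZ.
have sw1 := swappable1 pf dv dnbr.
have dab : d \notin [:: a; b].
  apply/negP=> dab; case/eqP: d2; have := colS _ y1S; move: cab dab (pf _ _ vy1) dv.
  by rewrite !inE => /orP[] /eqP -> /orP[] /eqP -> h1 h2 /orP[] /eqP h3;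
     rewrite ?h3 ?eqxx // in h1 h2 *.
have R1 := finish [ffun x => if x == v then d else f x] S 1%N.
rewrite eq_sym in dv.
apply: (ReachStep dv sw1 (t := fun x => if x == v then (\sum_(z <- Z) t' z).+1 - 1 else t' (r x))); last first.
  by move=> x; rewrite inE; case: eqP => //= _; rewrite subn1 add1n.
rewrite swap_colors1; apply: R1.
- by rewrite -swap_colors1; apply: swap_proper.
- by move=> x xv; rewrite ffunE (negbTE xv).
- apply: S_ok => [x xv|x _ _]; rewrite ffunE ?(negbTE xv) // eqxx (negbTE dab) //.
- by [].
- by rewrite vS.
Qed.

End Recoloring.

(* The three ways [q < 3] of pairing the colors 0, 1, 2, 3. *)
Definition partner (q c : nat) : nat :=
  match q, c with
  | 0, 0 => 1 | 0, 1 => 0 | 0, 2 => 3 | 0, _ => 2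
  | 1, 0 => 2 | 1, 1 => 3 | 1, 2 => 0 | 1, _ => 1
  | _, 0 => 3 | _, 1 => 2 | _, 2 => 1 | _, _ => 0
  end.

Definition paired (q c c' : nat) := (c == c') || (partner q c == c').

(* Short-circuiting versions, since the connectives are strict under [vm_compute]. *)
Fixpoint lhas (T : Type) (a : pred T) (s : seq T) : bool :=
  if s is x :: s' then (if a x then true else lhas a s') else false.

Fixpoint lall (T : Type) (a : pred T) (s : seq T) : bool :=
  if s is x :: s' then (if a x then lall a s' else false) else true.

Lemma lhasE T (a : pred T) s : lhas a s = has a s.
Proof. by elim: s => //= x s ->; case: (a x). Qed.

Lemma lallE T (a : pred T) s : lall a s = all a s.
Proof. by elim: s => //= x s ->; case: (a x). Qed.

Definition ats (s : seq nat) i := nth 0 s i.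

(* [rs] maps each position of the word [w] to the first position whose vertex
   lies in the same Kempe chain; [cyc] records that cyclically consecutive
   vertices are adjacent. *)
Definition chain_map (cyc : bool) (q d : nat) (w rs : seq nat) : bool :=
  if lall (fun i => [&& ats rs i <= i, ats rs (ats rs i) == ats rs i
                      & paired q (ats w (ats rs i)) (ats w i)]) (iota 0 d) then
  if lall (fun l => lall (fun k => if ats rs k == ats rs l then true else lall (fun j =>
      if ats rs j == ats rs l then ~~ lhas (fun i => ats rs i == ats rs k) (iota 0 j) else true)
           (iota 0 k)) (iota 0 l)) (iota 0 d) then
    if cyc then lall (fun i => paired q (ats w i) (ats w (i.+1 %% d)) ==>
         (ats rs i == ats rs (i.+1 %% d))) (iota 0 d) else true
  else false else false.

Fixpoint all_maps (d : nat) : seq (seq nat) :=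
  if d is d'.+1 then [seq rcons rs i | rs <- all_maps d', i <- iota 0 d] else [:: [::]].

Fixpoint all_bits (d : nat) : seq (seq bool) :=
  if d is d'.+1 then [seq b :: bs | b <- [:: false; true], bs <- all_bits d'] else [:: [::]].

Definition kswap (q d : nat) (w rs : seq nat) (T : seq bool) : seq nat :=
  mkseq (fun i => if nth false T (ats rs i) then partner q (ats w i) else ats w i) d.

(** A table of a predicate on the words over four letters, so that each level of the game below is
    tabulated once instead of being recomputed at every query. *)
Inductive tree := Leaf of bool | Node of tree & tree & tree & tree.

Fixpoint build (d : nat) (f : seq nat -> bool) : tree :=
  if d is d'.+1 then
    Node (build d' (fun w => f (0 :: w))) (build d' (fun w => f (1 :: w)))
         (build d' (fun w => f (2 :: w))) (build d' (fun w => f (3 :: w)))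
  else Leaf (f [::]).

Fixpoint lookup (t : tree) (w : seq nat) : bool :=
  match t, w with
  | Leaf b, _ => b
  | Node t0 t1 t2 t3, c :: w' =>
      match c with 0 => lookup t0 w' | 1 => lookup t1 w' | 2 => lookup t2 w' | _ => lookup t3 w' end
  | Node _ _ _ _, [::] => false
  end.

Definition win_step cyc d (maps : seq (seq nat)) (bits : seq (seq bool)) (W : tree) (w : seq nat) : bool :=
  if lookup W w then true else
  lhas (fun q => lall (fun rs => if chain_map cyc q d w rs then
     lhas (fun T => lookup W (kswap q d w rs T)) bits else true) maps) (iota 0 3).

(* The words over the four colors available around a vertex that can be brought into
   [target] by at most [k] rounds of swaps, whatever the Kempe chains are. *)
Fixpoint win_tree cyc d (target : seq nat -> bool) (k : nat) : tree :=
  if k is k'.+1 then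
    let W := win_tree cyc d target k' in
    let maps := all_maps d in let bits := all_bits d in
    build d (fun w => win_step cyc d maps bits W w)
  else build d target.

Definition word d (w : seq nat) := (size w == d) && all (fun c => c < 4) w.

Lemma lookup_build d f w : word d w -> lookup (build d f) w = f w.
Proof.
elim: d f w => [|d IH] f [|c w] //; rewrite /word /= eqSS => /andP[sw /andP[c4 aw]].
by case: c c4 => [|[|[|[|]]]] //= _; rewrite IH // /word sw aw.
Qed.

Lemma word_kswap q d w rs T : word d w -> word d (kswap q d w rs T).
Proof.
case/andP=> /eqP sw aw; rewrite /word size_mkseq eqxx; apply/allP=> c /mapP[i].
rewrite mem_iota add0n => /andP[_ id] ->; case: ifP => _.
  by case: q => [|[|q]]; case: (ats w i) => [|[|[|]]].
by apply: (allP aw); apply: mem_nth; rewrite sw.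
Qed.

Lemma mem_all_maps d rs : size rs = d -> (forall i, i < d -> ats rs i <= i) -> rs \in all_maps d.
Proof.
elim: d rs => [|d IH] rs; first by move/size0nil ->.
case/lastP: rs => // rs i; rewrite size_rcons => -[sd] h.
have im : i \in iota 0 d.+1.
  by rewrite mem_iota; have := h d (ltnSn d); rewrite /ats nth_rcons sd ltnn eqxx.
apply/allpairsP; exists (rs, i); split=> //.
  apply: IH => // j jd; have := h j (ltnW jd); by rewrite /ats nth_rcons sd jd.
Qed.

(** A round of the game: the player names a pairing [q] of the colors, the adversary a chain pattern
    [rs] allowed by planarity, and the player the set [T] of chains to swap. [P m w] says that [w]
    is reached after [m] rounds, and [step] that actual Kempe chains play the part of the
    adversary. *)
Lemma win_game cyc d target (P : nat -> seq nat -> Prop) k :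
  (forall m w q, word d w -> P m w -> q < 3 ->
     exists2 rs, size rs = d /\ chain_map cyc q d w rs &
       forall T, P m.+1 (kswap q d w rs T)) ->
  forall m w, word d w -> P m w -> lookup (win_tree cyc d target k) w ->
  exists m' w', [/\ m' <= m + k, word d w', P m' w' & target w'].
Proof.
move=> step; elim: k => [|k IH] m w ww Pw /=.
  by rewrite lookup_build // => tw; exists m, w; rewrite addn0.
rewrite lookup_build // /win_step; case: ifP => [Ww _|_].
  by have [m' [w' [le ? ? ?]]] := IH m w ww Pw Ww; exists m', w'; split=> //; lia.
rewrite lhasE => /hasP[q]; rewrite mem_iota lallE => /andP[_ q3] /allP all_rs.
have [rs [srs crs] Prs] := step m w q ww Pw q3.
have le i : i < d -> ats rs i <= i.
  move=> id; move: crs; rewrite /chain_map; case: ifP => // + _.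
  by rewrite lallE => /allP/(_ i); rewrite mem_iota => /(_ id) /and3P[].
have := all_rs rs (mem_all_maps srs le); rewrite crs lhasE => /hasP[T _] Wk.
have [m' [w' [lm ? ? ?]]] := IH m.+1 _ (word_kswap q rs T ww) (Prs T) Wk.
by exists m', w'; split=> //; lia.
Qed.

Definition letters := iota 0 4.

Fixpoint all_words d :=
  if d is d'.+1 then [seq c :: w | c <- letters, w <- all_words d'] else [:: [::]].

(* A triple of equal letters, or two noncrossing pairs. *)
Definition two_merges (w : seq nat) : bool :=
  has (fun l => has (fun k => (ats w k == ats w l) && has (fun j =>
     (ats w j == ats w k) ||
      has (fun i => (ats w i == ats w j)) (iota 0 j)) (iota 0 k)
    || has (fun j => (ats w j == ats w k) && has (fun i => ats w i == ats w l) (iota 0 j)) (iota 0 k))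
    (iota 0 l)) (iota 0 (size w)).

Lemma mem_all_words d w : word d w -> w \in all_words d.
Proof.
elim: d w => [|d IH] w /andP[/eqP sw aw]; first by rewrite (size0nil sw).
case: w sw aw => // c w [sw]; rewrite [all _ _]/= => /andP[c4 aw].
apply/(@allpairsP _ _ _ cons); exists (c, w); split=> //; first by rewrite mem_iota.
by apply: IH; rewrite /word sw eqxx.
Qed.

Definition win_everywhere cyc d target k :=
  let W := win_tree cyc d target k in lall (lookup W) (all_words d).

Lemma win_everywhereP cyc d target k w : win_everywhere cyc d target k = true ->
  word d w -> lookup (win_tree cyc d target k) w.
Proof. by rewrite /win_everywhere lallE => /allP h ww; apply: h; apply: mem_all_words. Qed.

(** Exhaustive search: around a vertex of degree 6, three rounds always produce merges that leave at
    most four blocks. *)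
Lemma two_merges_everywhere : win_everywhere false 6 two_merges 3 = true.
Proof. vm_cast_no_check (erefl true). Qed.

Definition pentagon_pairs := [:: (0, 2); (1, 3); (2, 4); (0, 3); (1, 4)].

Definition cyclically_proper (w : seq nat) :=
  lall (fun i => ats w i != ats w (i.+1 %% 5)) (iota 0 5).

(** [U] holds the pairs to be avoided. Words with equal cyclic neighbors count as won, because they
    never occur when consecutive neighbors are adjacent. *)
Definition pattern_outside (U : seq (nat * nat)) (w : seq nat) :=
  if cyclically_proper w then
    lhas (fun p => if p \in U then false else ats w p.1 == ats w p.2) pentagon_pairs
  else true.

(** Exhaustive search: in a wheel with five spokes, two rounds give equal colors to some opposite
    pair outside any two prescribed ones. Hence a coloring can realize at least three of the five
    pairs, and two colorings always have one in common. *)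
Lemma pattern_outside_everywhere :
  lall (fun p => lall (fun p' => win_everywhere true 5 (pattern_outside [:: p; p']) 2)
    pentagon_pairs) pentagon_pairs = true.
Proof. vm_cast_no_check (erefl true). Qed.

Lemma subseq_nths (T : Type) (E : eqType) (x0 : E) (s : seq E) js :
  sorted ltn js -> all (fun j => j < size s) js -> subseq [seq nth x0 s j | j <- js] s.
Proof.
move=> so al; have E1 : js = [seq i <- iota 0 (size s) | i \in js].
  apply: (irr_sorted_eq ltn_trans ltnn) => //.
    by apply: sorted_filter; [exact: ltn_trans | exact: iota_ltn_sorted].
  by move=> i; rewrite mem_filter mem_iota /=; case: (boolP (i \in js)) => // /(allP al) ->.
rewrite -[X in subseq _ X](mkseq_nth x0) /mkseq; apply: map_subseq.
by rewrite E1; apply: filter_subseq.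
Qed.

Section Blocks.
Variables (D : eqType) (g : D -> nat) (x0 : D).

Definition monochromatic (bs : seq (seq D)) :=
  {in bs, forall b, {in b &, forall x y, g x = g y}}.

Lemma one_merge_blocks (s t : seq D) : 0 < size t -> subseq t s ->
  {in t &, forall x y, g x = g y} ->
  exists bs, [/\ noncrossing s bs, size bs + size t <= (size s).+1 & monochromatic bs].
Proof.
move=> t0 ts gt; have [bs [nc tb one le]] := noncrossing_subseq t0 ts.
exists bs; split=> // b /one [-> //|]; case: b => [|a [|]] // _ x y.
by rewrite !inE => /eqP -> /eqP ->.
Qed.

Lemma pair_blocks (s : seq D) i j : i < j < size s -> g (nth x0 s i) = g (nth x0 s j) ->
  exists bs, [/\ noncrossing s bs, size bs < size s & monochromatic bs].
Proof.
case/andP=> ij js gij.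
have sub : subseq [seq nth x0 s k | k <- [:: i; j]] s.
  by apply: (@subseq_nths nat) => /=; rewrite ?ij ?js ?(ltn_trans ij).
have [|bs [nc le mono]] := @one_merge_blocks s [:: nth x0 s i; nth x0 s j] isT sub.
  by move=> x y; rewrite !inE => /orP[] /eqP -> /orP[] /eqP ->.
by exists bs; split=> //; move: le => /=; lia.
Qed.

Lemma side_blocks (s : seq D) i j k l : i < j -> j < k -> k < l -> l < size s ->
  g (nth x0 s i) = g (nth x0 s j) -> g (nth x0 s k) = g (nth x0 s l) ->
  exists bs, [/\ noncrossing s bs, size bs + 2 <= size s & monochromatic bs].
Proof.
move=> ij jk kl ls gij gkl.
have ks : k < size s by apply: ltn_trans ls.
have st : size (take k s) = k by rewrite size_take ks.
have sd : size (drop k s) = size s - k by rewrite size_drop.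
have [||bs1 [nc1 le1 m1]] := @pair_blocks (take k s) i j; first by rewrite st ij.
  by rewrite !nth_take // (ltn_trans ij).
have [||bs2 [nc2 le2 m2]] := @pair_blocks (drop k s) 0 (l - k).
    by rewrite sd; lia.
  by rewrite !nth_drop addn0 subnKC // ltnW.
exists (bs1 ++ bs2); split.
- by rewrite -[s](cat_take_drop k); apply: NcCat => //; rewrite ?st ?sd; lia.
- by rewrite size_cat; move: le1 le2; rewrite st sd; lia.
- by move=> b; rewrite mem_cat => /orP[/m1|/m2].
Qed.

Lemma two_merges_blocks (s : seq D) : size s = 6 -> two_merges (map g s) ->
  exists bs, [/\ noncrossing s bs, size bs <= 4 & monochromatic bs].
Proof.
move=> s6; have wE i : i < 6 -> ats (map g s) i = g (nth x0 s i).
  by move=> i6; rewrite /ats (nth_map x0) ?s6.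
rewrite /two_merges size_map s6.
case/hasP=> l; rewrite mem_iota => /andP[_ l6] /hasP[k]; rewrite mem_iota => /andP[_ kl].
have k6 : k < 6 by apply: ltn_trans l6.
case/orP=> [/andP[/eqP ekl /hasP[j]]|/hasP[j]]; rewrite mem_iota => /andP[_ jk].
  have j6 : j < 6 by apply: ltn_trans k6.
  rewrite !wE // in ekl *; case/orP=> [/eqP ejk|/hasP[i]].
    have sub : subseq [seq nth x0 s k | k <- [:: j; k; l]] s.
      by apply: (@subseq_nths nat) => /=; rewrite ?jk ?kl ?s6 ?l6 ?k6 ?j6.
    have [|bs [nc le mono]] := @one_merge_blocks s [:: nth x0 s j; nth x0 s k; nth x0 s l] isT sub.
      by move=> x y; rewrite !inE => /or3P[] /eqP -> /or3P[] /eqP ->; congruence.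
    by exists bs; split=> //; move: le; rewrite s6 /=; lia.
  rewrite mem_iota => /andP[_ ij]; have i6 : i < 6 by apply: ltn_trans j6.
  rewrite !wE // => /eqP eij.
  have [bs [nc le mono]] := side_blocks ij jk kl (eq_ind_r (fun m => l < m) l6 s6) eij ekl.
  by exists bs; split=> //; move: le; rewrite s6; lia.
have j6 : j < 6 by apply: ltn_trans k6.
rewrite !wE // => /andP[/eqP ejk /hasP[i]]; rewrite mem_iota => /andP[_ ij].
have i6 : i < 6 by apply: ltn_trans j6.
rewrite !wE // => /eqP eil.
(* Here the pair [i], [l] encloses the pair [j], [k]. Rotating by [j] puts the two pairs side by
   side, where one cut separates them. *)
have rE m : m < 6 -> nth x0 (rot j s) m = nth x0 s (if m < 6 - j then j + m else m - (6 - j)).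
  by move=> m6; rewrite /rot nth_cat size_drop s6 nth_drop; case: ifP => // h; rewrite nth_take //; lia.
have [bs [nc le mono]] := @side_blocks (rot j s) 0 (k - j) (l - j) (i + (6 - j))
   ltac:(lia) ltac:(lia) ltac:(lia) ltac:(rewrite size_rot; lia)
   ltac:(rewrite !rE; [|lia|lia]; rewrite !ifT; [|lia|lia]; rewrite addn0 subnKC //; lia)
   ltac:(rewrite !rE; [|lia|lia]; rewrite ifT; [|lia]; rewrite ifF; [|lia]; rewrite addnK subnKC; [congruence|lia]).
exists bs; split=> //; first by apply: NcRot nc.
by move: le; rewrite size_rot s6; lia.
Qed.

Lemma five_pigeonhole (s : seq D) : size s = 5 -> all (fun x => g x < 4) s ->
  exists bs, [/\ noncrossing s bs, size bs <= 4 & monochromatic bs].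
Proof.
move=> s5 g4; have : ~~ uniq (map g s).
  apply/negP=> u; have : {subset map g s <= iota 0 4}.
    by move=> c /mapP[x xs ->]; rewrite mem_iota /= (allP g4).
  by move/(uniq_leq_size u); rewrite size_map s5 size_iota.
case/(uniqPn 0) => i [j [ij]]; rewrite size_map => js.
rewrite !(nth_map x0) ?(ltn_trans ij) // => gij.
have [|bs [nc le mono]] := pair_blocks _ gij; first by rewrite ij.
by exists bs; split=> //; move: le; rewrite s5.
Qed.

End Blocks.

Lemma partnerK q c : q < 3 -> c < 4 -> partner q (partner q c) = c.
Proof. by case: q => [|[|[|]]] //; case: c => [|[|[|[|]]]]. Qed.

Lemma partner_lt q c : partner q c < 4.
Proof. by case: q => [|[|q]]; case: c => [|[|[|]]]. Qed.

Lemma partner_neq q c : q < 3 -> c < 4 -> partner q c != c.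
Proof. by case: q => [|[|[|]]] //; case: c => [|[|[|[|]]]]. Qed.

(** A representative of the pair not containing 0 in the pairing [q]. *)
Definition other_class (q : nat) := if q == 0 then 2 else 1.

Lemma paired_other q c : q < 3 -> c < 4 -> paired q (other_class q) c = ~~ paired q 0 c.
Proof. by case: q => [|[|[|]]] //; case: c => [|[|[|[|]]]]. Qed.

Lemma paired_equiv q c1 c2 c3 : q < 3 -> c1 < 4 -> c2 < 4 -> c3 < 4 ->
  paired q c1 c2 -> paired q c1 c3 = paired q c2 c3.
Proof.
by case: q => [|[|[|]]] //; case: c1 => [|[|[|[|]]]] //; case: c2 => [|[|[|[|]]]] //;
  case: c3 => [|[|[|[|]]]].
Qed.

Lemma connect_component (T : finType) (r : rel T) x y : connect r x y ->
  connect [rel u w | [&& connect r x u, connect r x w & r u w]] x y.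
Proof.
case/connectP=> q; elim/last_ind: q y => [y _ -> //|q z IH y].
rewrite rcons_path last_rcons => /andP[pq rz] ->.
have xl : connect r x (last x q) by apply/connectP; exists q.
apply: connect_trans (IH _ pq erefl) _; apply: connect1 => /=.
by rewrite xl rz (connect_trans xl (connect1 rz)).
Qed.

(** * The Kempe chains seen from a vertex *)

Section KempeRound.
Variables (V D : finType) (e : {perm D}).
Hypothesis eK : involutive e.
Variables (n : {perm D}) (L : {set D}) (p : D -> V).
Hypothesis M : plane_map e n L p.
Variables (v : V) (s : seq D).
Hypothesis rs : rotation n L p v s.
Let E := adj e L p.
Let d := size s.
Let nbrs := [seq p (e x) | x <- s].
Let nbr i := nth v nbrs i.

Definition col_from (c0 : 'I_5) (c : nat) : 'I_5 := lift c0 (inord c : 'I_4).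

Lemma col_from_inj c0 c c' : c < 4 -> c' < 4 -> col_from c0 c = col_from c0 c' -> c = c'.
Proof. by move=> c4 c4' /lift_inj h; rewrite -(inordK c4) h inordK. Qed.

Lemma col_from_neq c0 c : col_from c0 c != c0.
Proof. by rewrite eq_sym; apply: neq_lift. Qed.

Definition reads (f : {ffun V -> 'I_5}) (w : seq nat) :=
  word d w /\ forall i, i < d -> f (nbr i) = col_from (f v) (ats w i).

Lemma reads_exists f : proper_for E f -> exists w, reads f w.
Proof.
move=> pf; pose w := [seq (odflt ord0 (unlift (f v) (f u)) : nat) | u <- nbrs].
exists w; split.
  rewrite /word !size_map eqxx; apply/allP=> c /mapP[u _ ->].
  exact: ltn_ord.
move=> i id; have ni : i < size nbrs by rewrite size_map.
rewrite /ats (nth_map v) // -/(nbr i) /col_from.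
have : f v != f (nbr i).
  by apply: pf; rewrite /E (rotation_nbr M rs) mem_nth.
by case/unlift_some=> j -> ->; rewrite /= inord_val.
Qed.

(** The pattern [rm] is read off from the actual chains in the two color pairs of [q]. All these
    colors differ from that of [v], so the chains avoid [v] and [no_crossing] forbids two of them to
    alternate around it. The chains marked by [T] are swapped for one pair and then for the other,
    whence the bound 2. *)
Lemma kempe_round (cyc : bool) f w q : proper_for E f ->
  (cyc -> forall i, i < d -> E (nbr i) (nbr (i.+1 %% d))) ->
  reads f w -> q < 3 ->
  exists2 rm, size rm = d /\ chain_map cyc q d w rm &
    forall T, exists f', [/\ reach E f f' (fun _ => 2), proper_for E f' , f' v = f v
                          & reads f' (kswap q d w rm T)].
Proof.
move=> pf cycE [ww rw] q3; have [/eqP sw /allP w4] := andP ww.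
have symE : symmetric E by apply: adj_sym M.
have lt4 i : i < d -> ats w i < 4 by move=> id; apply: w4; apply: mem_nth; rewrite sw.
set c0 := f v in rw.
pose col := col_from c0; rewrite -/col in rw.
have colI c c' : c < 4 -> c' < 4 -> (col c == col c') = (c == c').
  by move=> h h'; apply/eqP/eqP=> [|-> //]; apply: col_from_inj.
pose A c : pred V := fun u => f u \in [:: col c; col (partner q c)].
have Av c : A c v = false.
  by rewrite /A !inE eq_sym (negbTE (col_from_neq _ _)) eq_sym (negbTE (col_from_neq _ _)).
have Anbr c i : c < 4 -> i < d -> A c (nbr i) = paired q c (ats w i).
  move=> c4 id; rewrite /A !inE rw // !colI ?lt4 ?partner_lt // /paired.
  by rewrite !(eq_sym (ats w i)).
have Apair c c' : c < 4 -> c' < 4 -> paired q c c' -> A c =1 A c'.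
  move=> h h'; rewrite /paired => /orP[/eqP -> //|/eqP <-] u.
  by rewrite /A partnerK // !inE orbC.
pose K c : rel V := [rel u u' | [&& A c u, A c u' & E u u']].
have KE c c' : c < 4 -> c' < 4 -> paired q c c' -> connect (K c) =2 connect (K c').
  move=> h h' cc; apply: eq_connect => u u'; by rewrite /K /= !(Apair _ _ h h' cc).
have Ksym c u u' : connect (K c) u u' = connect (K c) u' u.
  by apply: sym_connect_sym => x y; rewrite /K /= symE andbCA.
have KA c u u' : connect (K c) u u' -> A c u -> A c u'.
  case/connectP=> pt; elim: pt u => [u _ -> //|z pt IH u /= /andP[/and3P[_ Az _] pp] lz _].
  exact: IH pp lz Az.
pose R i j := paired q (ats w i) (ats w j) && connect (K (ats w i)) (nbr i) (nbr j).
have Rrefl i : R i i by rewrite /R /paired eqxx connect0.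
have Rtr i j k : i < d -> j < d -> k < d -> R i j -> R i k = R j k.
  move=> /lt4 i4 /lt4 j4 /lt4 k4 /andP[pij cij].
  rewrite /R (paired_equiv q3 i4 j4 k4 pij); congr (_ && _).
  rewrite (KE _ _ i4 j4 pij) in cij; rewrite (KE _ _ i4 j4 pij).
  by apply/idP/idP; apply: connect_trans; rewrite // Ksym.
have Rsym i j : i < d -> j < d -> R i j -> R j i.
  by move=> id jd h; rewrite -(Rtr i j i).
pose fst i := find (fun j => R j i) (iota 0 d).
have fstP i : i < d -> [/\ fst i <= i, fst i < d & R (fst i) i].
  move=> id; have hs : has (fun j => R j i) (iota 0 d).
    by apply/hasP; exists i; rewrite ?mem_iota.
  have fd : fst i < d by rewrite /fst -[X in _ < X](size_iota 0) -has_find.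
  have := nth_find 0 hs; rewrite -/(fst i) nth_iota // add0n => Ri; split=> //.
  rewrite leqNgt; apply/negP=> lt; have := before_find 0 lt.
  by rewrite nth_iota // add0n Rrefl.
have fstE i j : i < d -> j < d -> (fst i == fst j) = R i j.
  move=> id jd; apply/eqP/idP=> [h|Rij].
    have [_ fd Ri] := fstP i id; have [_ _ Rj] := fstP j jd.
    by rewrite -(Rtr (fst i) i j) // h.
  apply: eq_in_find => k; rewrite mem_iota => /andP[_ kd].
  apply/idP/idP=> h; first by rewrite (Rtr k i j).
  by rewrite (Rtr k j i) // Rsym.
pose rm := mkseq fst d.
have rmE i : i < d -> ats rm i = fst i by move=> id; rewrite /ats nth_mkseq.
exists rm; first split; first by rewrite size_mkseq.
  have cond1 : lall (fun i => [&& ats rm i <= i, ats rm (ats rm i) == ats rm i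
                      & paired q (ats w (ats rm i)) (ats w i)]) (iota 0 d).
    rewrite lallE; apply/allP=> i; rewrite mem_iota => /andP[_ id].
    have [le fd Rf] := fstP i id; rewrite !rmE // le fstE // Rf /=.
    by case/andP: Rf.
  have cond2 : lall (fun l => lall (fun k => if ats rm k == ats rm l then true else lall (fun j =>
      if ats rm j == ats rm l then ~~ lhas (fun i => ats rm i == ats rm k) (iota 0 j) else true)
           (iota 0 k)) (iota 0 l)) (iota 0 d).
    rewrite lallE; apply/allP=> l; rewrite mem_iota => /andP[_ ld].
    rewrite lallE; apply/allP=> k; rewrite mem_iota => /andP[_ kl].
    case: ifP => // Nkl.
    rewrite lallE; apply/allP=> j; rewrite mem_iota => /andP[_ jk].
    case: ifP => // Ejl; rewrite lhasE; apply/hasPn=> i; rewrite mem_iota => /andP[_ ij].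
    rewrite !add0n in ld kl jk ij.
    have kd := ltn_trans kl ld; have jd := ltn_trans jk kd; have id := ltn_trans ij jd.
    rewrite !rmE // !fstE // in Nkl Ejl *; apply/negP=> Rik.
    have nRij : ~~ R i j.
      by apply: contraFN Nkl => Rij; rewrite -(Rtr i k l) // (Rtr i j l).
    pose C i : pred V := fun u => A (ats w i) u && connect (K (ats w i)) (nbr i) u.
    have CC m m' : m < d -> R m m' ->
        connect [rel u w0 | [&& C m u, C m w0 & E u w0]] (nbr m) (nbr m').
      move=> md /andP[_ /connect_component]; apply: connect_sub => u u' /and3P[h1 h2 /and3P[h3 h4 h5]].
      by apply: connect1; rewrite /= /C h1 h2 h3 h4 h5.
    have [x0 nE] : exists x0 : D, forall m, m < d -> nbr m = p (e (nth x0 s m)).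
      have [x0 _] : exists x0 : D, x0 \in s.
        have : l < size s by []. 
        by case: (s) => // x0 s' _; exists x0; rewrite mem_head.
      by exists x0 => m md; rewrite /nbr (nth_map x0).
    have sub : subseq [:: nth x0 s i; nth x0 s j; nth x0 s k; nth x0 s l] s.
      apply: (@subseq_nths nat _ x0 s [:: i; j; k; l]) => /=; first by rewrite ij jk kl.
      by rewrite -/d id jd kd ld.
    apply: (@no_crossing V D e eK n L p v s _ _ _ _ (C i) (C j) M rs sub); rewrite -?nE //.
    - move=> u /andP[Ai ci]; apply: contra nRij => /andP[Aj cj].
      have [i4 j4] := (lt4 i id, lt4 j jd).
      have pij : paired q (ats w i) (ats w j).
        move: Ai Aj; rewrite /A !inE /paired.
        have E1 c c' : c < 4 -> c' < 4 -> f u = col c -> f u = col c' -> c = c'.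
          by move=> h h' -> /eqP; rewrite colI // => /eqP.
        have pl c : partner q c < 4 by apply: partner_lt.
        case/orP=> /eqP h1 /orP[] /eqP h2; have := E1 _ _ _ _ h1 h2 => h3.
        + by rewrite h3 // eqxx.
        + by rewrite h3 // partnerK // eqxx orbT.
        + by rewrite h3 // eqxx orbT.
        + by rewrite -(partnerK q3 i4) h3 // partnerK // eqxx.
      rewrite /R pij /=; apply: connect_trans ci _; rewrite Ksym.
      by rewrite (KE _ _ i4 j4 pij).
    - by rewrite /C Av.
    - by rewrite /C Av.
    - by rewrite /C connect0 andbT Anbr ?lt4 // /paired eqxx.
    - by rewrite /C connect0 andbT Anbr ?lt4 // /paired eqxx.
    - exact: CC.
    - exact: CC.
  have cond3 : cyc -> lall (fun i => paired q (ats w i) (ats w (i.+1 %% d)) ==>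
         (ats rm i == ats rm (i.+1 %% d))) (iota 0 d).
    move=> hc; rewrite lallE; apply/allP=> i; rewrite mem_iota => /andP[_ id].
    have md : i.+1 %% d < d by rewrite ltn_mod (leq_ltn_trans _ id).
    apply/implyP=> pi; rewrite !rmE // fstE // /R pi /=; apply: connect1.
    by rewrite /K /= !Anbr ?lt4 // pi {1}/paired eqxx cycE.
  by rewrite /chain_map cond1 cond2; case: (cyc) cond3 => // h; apply: h.
move=> T; pose S c := [set u | [exists i : 'I_d, [&& paired q c (ats w i), nth false T (ats rm i)
    & connect (K c) (nbr i) u]]].
have SA c u : c < 4 -> u \in S c -> A c u.
  move=> c4; rewrite inE => /existsP[i /and3P[pc _ cu]].
  by apply: KA cu _; rewrite Anbr.
have Snbr c i : c < 4 -> i < d -> (nbr i \in S c) = paired q c (ats w i) && nth false T (ats rm i).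
  move=> c4 id; apply/idP/andP=> [h|[pc Ti]].
    have pc : paired q c (ats w i) by rewrite -Anbr // SA.
    split=> //; move: h; rewrite inE => /existsP[j /and3P[pj Tj cj]].
    rewrite -(_ : ats rm j = ats rm i) //; rewrite !rmE //; apply/eqP; rewrite fstE // /R.
    have pji : paired q (ats w j) (ats w i) by rewrite -(paired_equiv q3 c4 _ _ pj) ?lt4.
    by rewrite pji /= -(KE c) ?lt4.
  rewrite inE; apply/existsP; exists (Ordinal id); by rewrite /= pc Ti connect0.
have Sv c : c < 4 -> v \in S c = false by move=> c4; apply/negP=> /SA; rewrite Av => /(_ c4).
have Scl c u u' : c < 4 -> u \in S c -> E u u' -> A c u' -> u' \in S c.
  move=> c4 uS uu' Au'; have Au := SA c u c4 uS; move: uS; rewrite !inE.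
  case/existsP=> i /and3P[pc Ti cu]; apply/existsP; exists i; rewrite pc Ti /=.
  by apply: connect_trans cu (connect1 _); rewrite /K /= Au Au'.
have o4 : other_class q < 4 by rewrite /other_class; case: eqP.
pose a1 := col 0; pose b1 := col (partner q 0).
pose a2 := col (other_class q); pose b2 := col (partner q (other_class q)).
have ab1 : a1 != b1 by rewrite colI ?partner_lt // eq_sym partner_neq.
have ab2 : a2 != b2 by rewrite colI ?partner_lt // eq_sym partner_neq.
have sw1 : swappable E f a1 b1 (S 0).
  by move=> u uS; split=> [|u' uu' Au']; [exact: SA | exact: Scl uS uu' Au'].
pose f1 := swap_colors a1 b1 (S 0) f.
have pf1 : proper_for E f1 by apply: swap_proper.
have diff : [/\ a1 != a2, a1 != b2, b1 != a2 & b1 != b2].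
  have := paired_other q3 (isT : 0 < 4); have := paired_other q3 (partner_lt q 0).
  rewrite /paired !eqxx ?orbT /= => h1 h2.
  rewrite /a1 /b1 /a2 /b2 !colI ?partner_lt //; move: h1 h2.
  by move=> /negbT; rewrite negb_or => /andP[h1 h2] /negbT; rewrite negb_or => /andP[h3 h4];
    split; rewrite eq_sym.
have A1 u : (f1 u \in [:: a2; b2]) = (f u \in [:: a2; b2]).
  rewrite ffunE; case: ifP => // uS; have := SA 0 u isT uS; rewrite /A -/a1 -/b1.
  have [d1 d2 d3 d4] := diff.
  rewrite !inE => /orP[] /eqP ->; rewrite ?tpermL ?tpermR;
  by rewrite (negbTE d1) (negbTE d2) (negbTE d3) (negbTE d4).
have sw2 : swappable E f1 a2 b2 (S (other_class q)).
  move=> u uS; rewrite A1; split=> [|u' uu']; first exact: SA.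
  by rewrite A1 => Au'; apply: Scl uS uu' Au'.
pose f2 := swap_colors a2 b2 (S (other_class q)) f1.
have f2v : f2 v = f v by rewrite !ffunE !Sv.
exists f2; split=> //.
- apply: (ReachStep (t := fun _ => 1) ab1 sw1) => [|x]; last by case: (_ \in _).
  apply: (ReachStep (t := fun _ => 0) ab2 sw2) => [|x]; last by case: (_ \in _).
  exact: ReachRefl.
- exact: swap_proper.
split; first exact: word_kswap.
move=> i id; rewrite f2v -/c0 -/col /kswap /ats nth_mkseq // -!/(ats _ _).
rewrite !ffunE !Snbr // paired_other ?lt4 // rw //.
have i4 := lt4 i id; case: (nth false T _); rewrite ?andbF ?andbT //.
have [d1 d2 d3 d4] := diff.
case: (boolP (paired q 0 (ats w i))) => /=.
  rewrite /paired => /orP[] /eqP <-; first by rewrite tpermL.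
  by rewrite tpermR partnerK.
rewrite -paired_other // /paired => /orP[] /eqP <-; first by rewrite tpermL.
by rewrite tpermR partnerK.
Qed.

End KempeRound.

(** * Reducing a coloring at one vertex *)

Section LocalReduction.
Variables (V D : finType) (e : {perm D}).
Hypothesis eK : involutive e.
Implicit Types (n : {perm D}) (L : {set D}) (p : D -> V) (v : V) (s : seq D) (bs : seq (seq D)).
Implicit Types (f g : {ffun V -> 'I_5}).

Definition constant_on (T : eqType) (p : D -> V) bs (f : V -> T) :=
  {in bs, forall b, {in b &, forall x y, f (p (e x)) = f (p (e y))}}.

(** The letter 0 also serves as default for the color of [v] itself, which a proper coloring does
    not show at a neighbor. *)
Definition link_color p v f (x : D) : nat := odflt ord0 (unlift (f v) (f (p (e x)))).

Lemma link_color_eq n L p v s f x y : plane_map e n L p -> rotation n L p v s ->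
  proper_for (adj e L p) f -> x \in s -> y \in s ->
  link_color p v f x = link_color p v f y -> f (p (e x)) = f (p (e y)).
Proof.
move=> M rs pf; have H z : z \in s -> f v != f (p (e z)).
  by move=> zs; apply: pf; rewrite (rotation_nbr M rs); apply: map_f.
move=> /H/unlift_some[j fj uj] /H/unlift_some[k fk uk].
by rewrite /link_color uj uk /= fj fk => /val_inj ->.
Qed.

Lemma monochromatic_constant n L p v s f bs : plane_map e n L p -> rotation n L p v s ->
  proper_for (adj e L p) f -> noncrossing s bs ->
  monochromatic (link_color p v f) bs -> constant_on p bs f.
Proof.
move=> M rs pf nc mono b bb x y xb yb.
have sub z : z \in b -> z \in s.
  by move=> zb; rewrite -(perm_mem (noncrossing_perm nc)); apply/flattenP; exists b.
by apply: (link_color_eq M rs pf) (mono b bb x y xb yb); apply: sub.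
Qed.

Lemma reads_link_color n L p v s f w : plane_map e n L p -> rotation n L p v s ->
  reads e p v s f w -> w = map (link_color p v f) s.
Proof.
move=> M rs [/andP[/eqP sw w4] rw]; apply: (@eq_from_nth _ 0); first by rewrite size_map.
move=> i; rewrite sw => id; have x0 : D by case: (s) id => // x.
rewrite (nth_map x0) // /link_color.
have := rw i id; rewrite (nth_map x0) // => ->.
rewrite /col_from liftK /= inordK //; apply: (allP w4); apply: mem_nth; by rewrite sw.
Qed.

Lemma kempe_rounds (cyc : bool) target k n L p v s f :
  plane_map e n L p -> rotation n L p v s -> proper_for (adj e L p) f ->
  (cyc -> forall i, i < size s ->
     adj e L p (nth v [seq p (e x) | x <- s] i) (nth v [seq p (e x) | x <- s] (i.+1 %% size s))) ->
  (forall w, word (size s) w -> lookup (win_tree cyc (size s) target k) w) ->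
  exists f', [/\ reach (adj e L p) f f' (fun _ => 2 * k), proper_for (adj e L p) f'
               & target (map (link_color p v f') s)].
Proof.
move=> M rs pf cycE win.
pose P m w := exists f', [/\ reach (adj e L p) f f' (fun _ => 2 * m), proper_for (adj e L p) f'
   & reads e p v s f' w].
have [w rw] := reads_exists M rs pf.
have P0 : P 0 w by exists f; split=> //; apply: ReachRefl.
have step m w' q : word (size s) w' -> P m w' -> q < 3 ->
     exists2 rm, size rm = size s /\ chain_map cyc q (size s) w' rm &
       forall T, P m.+1 (kswap q (size s) w' rm T).
  move=> _ [f1 [R1 pf1 r1]] q3; have [rm h1 h2] := kempe_round eK M rs pf1 cycE r1 q3.
  exists rm => // T; have [f2 [R2 pf2 _ r2]] := h2 T; exists f2; split=> //.
  by apply: reach_le (reach_trans R1 R2) _ => x; rewrite mulnS addnC.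
have ww : word (size s) w by case: rw.
have [m [w' [mk ww' [f' [R' pf' r']] tw']]] := win_game step ww P0 (win w ww).
exists f'; split=> //; first by apply: reach_le R' _ => x; rewrite leq_mul2l /= -[k]add0n.
by rewrite -(reads_link_color M rs r').
Qed.

Lemma link_color_lt4 p v f x : link_color p v f x < 4.
Proof. by rewrite /link_color; apply: ltn_ord. Qed.

(** Up to degree four nothing has to be merged, at degree five two neighbors share one of four
    colors, and at degree six three rounds of two changes suffice, whence the bound 6. The last
    clause keeps the blocks trivial up to degree four, where nothing is known about large
    neighbors. *)
Lemma kempe_reduce n L p v s f :
  plane_map e n L p -> rotation n L p v s -> proper_for (adj e L p) f ->
  0 < size s -> size s <= 6 ->
  exists f' bs, [/\ reach (adj e L p) f f' (fun _ => 6), proper_for (adj e L p) f',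
    noncrossing s bs /\ size bs <= 4, constant_on p bs f'
    & size s <= 4 -> bs = [seq [:: x] | x <- s]].
Proof.
move=> M rs pf s0 s6.
have [s4|s4] := leqP (size s) 4.
  exists f, [seq [:: x] | x <- s]; split=> //; first exact: ReachRefl.
    by split; [exact: noncrossing_singletons | rewrite size_map].
  by move=> b /mapP[x _ ->] y z; rewrite !inE => /eqP -> /eqP ->.
have x0 : D by case: (s) s0 => // x.
have [s5|s5] := eqVneq (size s) 5.
  have [|bs [nc le mono]] := @five_pigeonhole _ (link_color p v f) x0 s s5.
    by apply/allP=> x _; apply: link_color_lt4.
  exists f, bs; split=> //; first exact: ReachRefl.
  exact: monochromatic_constant M rs pf nc mono.
have {s5 s6} s6 : size s = 6 by lia.
have [||f' [R pf' tw]] := @kempe_rounds false two_merges 3 n L p v s f M rs pf; first by [].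
  move=> w; rewrite s6; apply: win_everywhereP two_merges_everywhere.
have [bs [nc le mono]] := two_merges_blocks x0 s6 tw.
exists f', bs; split=> //; exact: monochromatic_constant M rs pf' nc mono.
Qed.

Lemma constant_on_pair n L p v s f bs x y : plane_map e n L p -> rotation n L p v s ->
  {in bs, forall b, b = [:: x; y] \/ size b = 1} -> f (p (e x)) = f (p (e y)) ->
  constant_on p bs f.
Proof.
move=> M rs one fxy b /one [->|]; last first.
  by case: b => [|a [|]] // _ c d; rewrite !inE => /eqP -> /eqP ->.
by move=> c d; rewrite !inE => /orP[] /eqP -> /orP[] /eqP ->.
Qed.

Lemma pentagon_reduce n L p v s f g :
  plane_map e n L p -> rotation n L p v s -> size s = 5 ->
  (forall i, i < 5 ->
     adj e L p (nth v [seq p (e x) | x <- s] i) (nth v [seq p (e x) | x <- s] (i.+1 %% 5))) ->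
  proper_for (adj e L p) f -> proper_for (adj e L p) g ->
  exists f' g' bs, [/\ reach (adj e L p) f f' (fun _ => 4), reach (adj e L p) g g' (fun _ => 4),
    proper_for (adj e L p) f' /\ proper_for (adj e L p) g',
    noncrossing s bs /\ size bs <= 4 & constant_on p bs f' /\ constant_on p bs g'].
Proof.
move=> M rs s5 cycE pf pg.
have x0 : D by case: (s) s5 => // x.
pose R h q := exists h', [/\ reach (adj e L p) h h' (fun _ => 4), proper_for (adj e L p) h'
  & h' (p (e (nth x0 s q.1))) = h' (p (e (nth x0 s q.2)))].
have lt5 q : q \in pentagon_pairs -> q.1 < q.2 < 5.
  by rewrite !inE => /or3P[|| /or3P[]] /eqP ->.
have avoid h q q' : proper_for (adj e L p) h -> q \in pentagon_pairs -> q' \in pentagon_pairs ->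
    exists q'', [/\ q'' \in pentagon_pairs, q'' \notin [:: q; q'] & R h q''].
  move=> ph hq hq'.
  have [||h' [Rh ph' tw]] := @kempe_rounds true (pattern_outside [:: q; q']) 2 n L p v s h M rs ph.
  - by move=> _ i; rewrite s5; apply: cycE.
  - move=> w; rewrite s5; apply: win_everywhereP.
    have := pattern_outside_everywhere; rewrite lallE => /allP/(_ q hq).
    by rewrite lallE => /allP/(_ q' hq').
  have lc i j : i < 5 -> j < 5 ->
      ats [seq link_color p v h' x | x <- s] i = ats [seq link_color p v h' x | x <- s] j ->
      h' (p (e (nth x0 s i))) = h' (p (e (nth x0 s j))).
    move=> i5 j5; rewrite /ats !(nth_map x0) ?s5 // => h1.
    by apply: (link_color_eq M rs ph') h1; apply: mem_nth; rewrite s5.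
  move: tw; rewrite /pattern_outside; case: ifP => [_|nc _].
    rewrite lhasE => /hasP[q'' q''in]; case: ifP => // nin /eqP E.
    have /andP[h1 h2] := lt5 _ q''in.
    exists q''; split=> //; first by rewrite nin.
    exists h'; split=> //; apply: lc => //; exact: ltn_trans h2.
  exfalso; move/negP: nc; apply; rewrite /cyclically_proper lallE; apply/allP=> i.
  rewrite mem_iota => /andP[_ i5]; apply/eqP=> E.
  have m5 : i.+1 %% 5 < 5 by rewrite ltn_mod.
  have := lc _ _ i5 m5 E; have := cycE i i5; rewrite !(nth_map x0) ?s5 // => /ph'.
  by move=> /eqP.
(* Three different pairs are found by avoiding, each time, those already obtained; the pair [(0, 2)]
   merely starts the process. Two sets of three among five pairs then intersect. *)
have three h : proper_for (adj e L p) h -> exists q1 q2 q3,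
   [/\ uniq [:: q1; q2; q3], {subset [:: q1; q2; q3] <= pentagon_pairs}
     & forall q, q \in [:: q1; q2; q3] -> R h q].
  move=> ph; have in0 : (0, 2) \in pentagon_pairs by [].
  have [q1 [i1 _ R1]] := avoid h _ _ ph in0 in0.
  have [q2 [i2 n2 R2]] := avoid h _ _ ph i1 i1.
  have [q3 [i3 n3 R3]] := avoid h _ _ ph i1 i2.
  exists q1, q2, q3; split.
  - move: n2 n3; rewrite /= !inE !orbb !negb_or => n2 /andP[n31 n32].
    by rewrite (eq_sym q1 q2) (eq_sym q1 q3) (eq_sym q2 q3) n2 n31 n32.
  - by move=> q; rewrite in_cons in_cons mem_seq1 => /or3P[] /eqP ->.
  - by move=> q; rewrite in_cons in_cons mem_seq1 => /or3P[] /eqP ->.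
have [a1 [a2 [a3 [ua sa Ra]]]] := three f pf; have [b1 [b2 [b3 [ub sb Rb]]]] := three g pg.
have [q qa qb] : exists2 q, q \in [:: a1; a2; a3] & q \in [:: b1; b2; b3].
  apply/hasP; apply: contraT => nh.
  have : uniq ([:: b1; b2; b3] ++ [:: a1; a2; a3]) by rewrite cat_uniq ub ua nh.
  move/uniq_leq_size => /(_ pentagon_pairs) h; suff: 6 <= size pentagon_pairs by [].
  by apply: h => z; rewrite mem_cat => /orP[/sb|/sa].
have [f' [Rf pf' ff]] := Ra q qa; have [g' [Rg pg' gg]] := Rb q qb.
have /andP[q12 q5] := lt5 q (sa q qa).
have sub : subseq [:: nth x0 s q.1; nth x0 s q.2] s.
  by apply: (@subseq_nths nat _ x0 s [:: q.1; q.2]) => /=; rewrite ?q12 ?s5 ?q5 ?(ltn_trans q12).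
have [bs [nc _ one le]] := noncrossing_subseq (isT : 0 < size [:: nth x0 s q.1; nth x0 s q.2]) sub.
exists f', g', bs; split=> //; first by split=> //; move: le; rewrite s5 /=; lia.
by split; apply: (constant_on_pair M rs one).
Qed.

End LocalReduction.

Lemma reach_edgeless (V : finType) (E : rel V) f g : (forall u w, ~~ E u w) ->
  reach E f g (fun _ => 1).
Proof.
move=> noE.
have H (X : seq V) (f0 : {ffun V -> 'I_5}) : uniq X -> (forall u, u \notin X -> f0 u = g u) ->
    reach E f0 g (fun u => u \in X).
  elim: X f0 => [|x X IH] f0 /=.
    move=> _ fg; have -> : f0 = g by apply/ffunP=> u; apply: fg.
    exact: ReachRefl.
  case/andP=> xX uX fg; have [fgx|fgx] := eqVneq (f0 x) (g x).
    have fg' u : u \notin X -> f0 u = g u.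
      by move=> uN; have [->//|ux] := eqVneq u x; apply: fg; rewrite inE negb_or ux.
    apply: reach_le (IH f0 uX fg') _ => u; by rewrite inE; case: (_ \in X); rewrite ?orbT.
  have sw : swappable E f0 (f0 x) (g x) [set x].
    apply: swappable1 => [u w||y]; rewrite 1?eq_sym ?(negbTE (noE _ _)) //.
  apply: (ReachStep (t := fun u => u \in X) fgx sw) => [|u]; last first.
    rewrite !inE; case: eqP => [->|] //=; by rewrite (negbTE xX).
  rewrite swap_colors1; apply: IH => // u uN; rewrite ffunE.
  by have [->//|ux] := eqVneq u x; apply: fg; rewrite inE negb_or ux.
have R : reach E f g (fun u => u \in enum V).
  by apply: H => [|u]; rewrite ?enum_uniq // mem_enum.
by apply: reach_le R _ => u; case: (_ \in _).
Qed.

(** * Recoloring through a merged map *)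

Section Merging.
Variables (V D : finType) (e : {perm D}).
Hypothesis eK : involutive e.
Implicit Types (n : {perm D}) (L : {set D}) (p : D -> V) (v : V) (s : seq D) (bs : seq (seq D)).

(** The labelling [phi] certifies that the merged map has no loop, so the five color theorem applies
    to it, and its coloring is pulled back. *)
Lemma merged_coloring (T : eqType) (phi : V -> T) n L p v s bs : plane_map e n L p ->
  ~~ adj e L p v v -> rotation n L p v s -> noncrossing s bs -> size bs <= 4 ->
  (forall u w, adj e L p u w -> phi u != phi w) -> constant_on e p bs phi ->
  exists2 h : {ffun V -> 'I_5}, proper_for (adj e L p) h & constant_on e p bs h.
Proof.
move=> M irr rs nc szb pphi hphi.
have [n2 [r [M2 H1 U1 _]]] := map_merge eK M irr rs nc.
have L21 : [set x in L | (p x != v) && (p (e x) != v)] \subset L.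
  by apply/subsetP=> x; rewrite inE => /andP[].
have [f2 hf2] := five_color eK M2 (merged_irreflexive L21 (U1 _ _ hphi) pphi).
have [f pf ff] := extend_coloring eK M irr rs nc szb H1 hf2.
exists f => // b bb x y xb yb.
have nv z : z \in b -> p (e z) != v.
  move=> zb; have zs : z \in s by rewrite -(perm_mem (noncrossing_perm nc)); apply/flattenP; exists b.
  apply: contraNneq irr => h; rewrite -[X in adj _ _ _ _ X]h (rotation_nbr M rs).
  exact: map_f.
by rewrite !ff ?nv // (H1 b bb x y).
Qed.

(** Only [v] pays for the lift: it follows at most four blocks, each changing [c] times, and makes
    one last move. *)
Lemma reach_merge n L p v s bs f g c : plane_map e n L p ->
  ~~ adj e L p v v -> rotation n L p v s -> noncrossing s bs -> size bs <= 4 -> 0 < size s ->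
  proper_for (adj e L p) f -> proper_for (adj e L p) g ->
  constant_on e p bs f -> constant_on e p bs g ->
  (forall n' L' p', plane_map e n' L' p' -> irreflexive (adj e L' p') ->
     #|p' @: L'| < #|p @: L| -> proper_for (adj e L' p') f -> proper_for (adj e L' p') g ->
     reach (adj e L' p') f g (fun _ => c)) ->
  reach (adj e L p) f g (fun _ => (4 * c).+1).
Proof.
move=> M irr rs nc szb s0 pf pg cf cg IH.
have [n2 [r [M2 H1 U1 _]]] := map_merge eK M irr rs nc.
set L2 := [set x in L | _] in M2.
have L21 : L2 \subset L by apply/subsetP=> x; rewrite inE => /andP[].
have rf u : f (r u) = f u by apply: U1.
have rg u : g (r u) = g u by apply: U1.
have prop2 (h : {ffun V -> 'I_5}) : (forall u, h (r u) = h u) -> proper_for (adj e L p) h ->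
    proper_for (adj e L2 (r \o p)) h.
  move=> rh ph u w /adjP[x xL2 [/= <- <-]]; rewrite !rh; apply: ph.
  by apply/adjP; exists x => //; apply: (subsetP L21).
have irr2 : irreflexive (adj e L2 (r \o p)) by apply: (merged_irreflexive L21 rf pf).
have lt2 : #|(r \o p) @: L2| < #|p @: L|.
  by apply: (merged_card M irr rs nc s0) => phi; apply: U1.
have R2 := IH _ _ _ M2 irr2 lt2 (prop2 f rf pf) (prop2 g rg pg).
pose Z := [seq (if b is x :: _ then r (p (e x)) else v) | b <- bs].
have Z4 : size Z <= 4 by rewrite size_map.
have hZ x : adj e L p v x -> r x \in Z.
  rewrite (rotation_nbr M rs) => /mapP[y ys ->].
  move: ys; rewrite -(perm_mem (noncrossing_perm nc)) => /flattenP[b bB yb].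
  apply/mapP; exists b => //; case: b bB yb => // z b bB yb.
  by rewrite (H1 _ bB y z) ?mem_head.
have hE x y : x != v -> y != v -> adj e L p x y -> adj e L2 (r \o p) (r x) (r y).
  move=> xv yv /adjP[z zL [zx zy]]; apply/adjP; exists z; last by rewrite /= zx zy.
  by rewrite inE zL zx zy xv.
have R := reach_lift (adj_sym eK M) irr hE Z4 hZ R2 pf pg
  (fun x _ => esym (rf x)) (fun x _ => esym (rg x)).
apply: reach_le R _ => x; case: eqP => _; last by lia.
by rewrite ltnS big_const_seq count_predT iter_addn_0 mulnC leq_mul2r Z4 orbT.
Qed.

End Merging.

Lemma flatten_block_eq (T : eqType) (bs : seq (seq T)) b b' x : uniq (flatten bs) ->
  b \in bs -> b' \in bs -> x \in b -> x \in b' -> b = b'.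
Proof.
elim: bs => // a bs IH /=; rewrite cat_uniq => /and3P[_ /hasPn dis ubs].
rewrite !inE => /orP[/eqP ->|bb] /orP[/eqP ->|bb'] xb xb' //.
- by have := dis x; rewrite xb => /(_ _)/negP[] //; apply/flattenP; exists b'.
- by have := dis x; rewrite xb' => /(_ _)/negP[] //; apply/flattenP; exists b.
- exact: IH.
Qed.

Lemma noncrossing_map (T U : Type) (h : T -> U) s bs : noncrossing s bs ->
  noncrossing (map h s) (map (map h) bs).
Proof.
elim=> {s bs} [s s0|k s bs _ IH|s1 s2 bs1 bs2 p1 p2 _ IH1 _ IH2] /=.
- by apply: NcOne; rewrite size_map.
- by apply: (NcRot (k := k)); rewrite -map_rot.
- by rewrite !map_cat; apply: NcCat; rewrite ?size_map.
Qed.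

Section Independent.
Variables (V D : finType) (e : {perm D}).
Hypothesis eK : involutive e.
Implicit Types (n : {perm D}) (L : {set D}) (p : D -> V) (v : V) (s : seq D) (bs : seq (seq D)).

Lemma rotation_rot n L p v s k : rotation n L p v s -> rotation n L p v (rot k s).
Proof. by case=> us cs sE; split; rewrite ?rot_uniq ?rot_cycle // => x; rewrite mem_rot. Qed.

(** Labelling each neighbor by the index of its block and every other vertex by itself is proper
    when the blocks are independent. *)
Lemma independent_coloring n L p v s bs : plane_map e n L p -> irreflexive (adj e L p) ->
  rotation n L p v s -> noncrossing s bs -> size bs <= 4 ->
  {in s &, injective (fun x => p (e x))} ->
  {in bs, forall b, {in b &, forall x y, ~~ adj e L p (p (e x)) (p (e y))}} ->
  exists2 h : {ffun V -> 'I_5}, proper_for (adj e L p) h & constant_on e p bs h.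
Proof.
move=> M irr rs nc szb inj indep.
have pe := noncrossing_perm nc.
have ub : uniq (flatten bs) by rewrite (perm_uniq pe); case: rs.
have sub b x : b \in bs -> x \in b -> x \in s.
  by move=> bb xb; rewrite -(perm_mem pe); apply/flattenP; exists b.
pose P u b := u \in [seq p (e x) | x <- b].
pose phi u : V + nat := if has (P u) bs then inr (find (P u) bs) else inl u.
apply: (merged_coloring eK (phi := phi) M (negbT (irr v)) rs nc szb).
  move=> u w auw; apply/eqP; rewrite /phi; case: ifP => hu; case: ifP => hw // [].
    have := nth_find [::] hu; have := nth_find [::] hw; move=> + + E; rewrite -E.
    case/mapP=> x xb wx /mapP[y yb uy]; move: auw; rewrite wx uy; apply/negP.
    by apply: indep yb xb; apply: mem_nth; rewrite -has_find.
  by move=> E; rewrite E irr in auw.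
move=> b bb x y xb yb; rewrite /phi.
have PE z b' : z \in b -> b' \in bs -> P (p (e z)) b' = (b' == b).
  move=> zb bb'; apply/mapP/eqP=> [[z' zb' /inj E]|->]; last by exists z.
  apply: (flatten_block_eq ub bb' bb zb'); rewrite -E //; [exact: sub bb zb | exact: sub bb' zb'].
have hP z : z \in b -> has (P (p (e z))) bs.
  by move=> zb; apply/hasP; exists b; rewrite ?PE ?eqxx.
rewrite !hP //; congr inr; apply: eq_in_find => b' bb'; by rewrite !PE.
Qed.

End Independent.

(** * The measure of the induction *)

Section Measure.
Variable V : finType.
Implicit Type E : rel V.

Definition support_set E := [set u | [exists w, E u w]].
Definition edge_set E := [set uw : V * V | E uw.1 uw.2].
(* Decreases both when vertices are merged and when an edge is added. *)
Definition map_measure E := (#|support_set E|.+1) ^ 3 - #|edge_set E|.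

Lemma edge_set_bound E : symmetric E -> #|edge_set E| <= #|support_set E| ^ 2.
Proof.
move=> sE; rewrite -mulnn -cardsX; apply: subset_leq_card; apply/subsetP=> -[u w].
rewrite !inE /= => uw; apply/andP; split; apply/existsP; first by exists w.
by exists u; rewrite sE.
Qed.

Lemma cube_succ x : x.+1 ^ 3 = x ^ 3 + 3 * x ^ 2 + 3 * x + 1.
Proof. rewrite !expnS !expn0 !muln1; nia. Qed.

(** A symmetric relation with support of size [s] has at most [s ^ 2] edges, and [s.+1 ^ 3 - s ^ 2]
    still exceeds [s ^ 3]; an arbitrary loss of edges is thus outweighed by the loss of one
    vertex. *)
Lemma map_measure_merge E E' : symmetric E -> #|support_set E'| < #|support_set E| ->
  map_measure E' < map_measure E.
Proof.
move=> /edge_set_bound le lt; have : (#|support_set E'|.+1) ^ 3 <= #|support_set E| ^ 3.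
  by rewrite leq_exp2r.
move: le; rewrite /map_measure (cube_succ #|support_set E|); lia.
Qed.

Lemma map_measure_edge E E' : symmetric E -> support_set E' = support_set E ->
  #|edge_set E| < #|edge_set E'| -> map_measure E' < map_measure E.
Proof.
move=> /edge_set_bound le sE lt; move: le lt; rewrite /map_measure sE cube_succ; lia.
Qed.

Lemma eq_map_measure E E' : E =2 E' -> map_measure E = map_measure E'.
Proof.
move=> EE; rewrite /map_measure; congr (_ ^ _ - _).
  by congr (#|pred_of_set _|.+1); apply/setP=> u; rewrite !inE; apply: eq_existsb => w; rewrite EE.
by apply: eq_card => uw; rewrite !inE EE.
Qed.

Lemma support_adj (D : finType) (e n : {perm D}) L p : plane_map e n L p ->
  support_set (adj e L p) = p @: L :> {set V}.
Proof.
move=> M; apply/setP=> u; rewrite inE; apply/existsP/imsetP=> [[w /adjP[x xL [<- _]]]|[x xL ->]].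
  by exists x.
by exists (p (e x)); apply/adjP; exists x.
Qed.

End Measure.

Section Linking.
Variables (V D : finType) (e : {perm D}).
Hypothesis eK : involutive e.
Variables (n : {perm D}) (L : {set D}) (p : D -> V) (v : V) (x1 x2 x3 x4 x5 : D).
Hypothesis M : plane_map e n L p.
Hypothesis irr : irreflexive (adj e L p).
Let s := [:: x1; x2; x3; x4; x5].
Hypothesis rs : rotation n L p v s.
Hypothesis inj : {in s &, injective (fun x => p (e x))}.
Let c x := p (e x).
Hypothesis n12 : ~~ adj e L p (c x1) (c x2).

(* A pair of nonadjacent neighbors of [v] that can be merged both with and without
   merging the first two. *)
Lemma linking_pair : exists xa xb h, [/\ subseq [:: xa; xb] s,
  ~~ adj e L p (c xa) (c xb), (xa == x1) && (xb == x2) = false, proper_for (adj e L p) h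
  & h (c x1) = h (c x2) /\ h (c xa) = h (c xb)].
Proof.
have sym := adj_sym eK M.
have us : uniq s by case: rs.
have nadjC a b : ~~ adj e L p (c a) (c b) -> ~~ adj e L p (c b) (c a) by rewrite sym.
have nn a : ~~ adj e L p (c a) (c a) by rewrite irr.
have indep2 a b : ~~ adj e L p (c a) (c b) ->
    {in [:: a; b] &, forall y z, ~~ adj e L p (p (e y)) (p (e z))}.
  move=> nab y z; rewrite !inE => /orP[] /eqP -> /orP[] /eqP ->.
  - exact: (nn a).
  - exact: nab.
  - exact: nadjC nab.
  - exact: (nn b).
have indep1 (b : seq D) : size b = 1 ->
    {in b &, forall y z, ~~ adj e L p (p (e y)) (p (e z))}.
  by case: b => [|a [|]] // _ y z; rewrite !inE => /eqP -> /eqP ->; apply: (nn a).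
have [u12 u13 u14 u15] : [/\ x1 != x2, x1 != x3, x1 != x4 & x1 != x5].
  by move: us; rewrite /s /= !inE !negb_or => /and5P[/and4P[-> -> -> ->]].
have [u24 u25] : x2 != x4 /\ x2 != x5.
  by move: us; rewrite /s /= !inE !negb_or => /and5P[_ /and3P[_ -> ->]].
have disjoint_case xa xb : subseq [:: xa; xb] [:: x3; x4; x5] -> ~~ adj e L p (c xa) (c xb) ->
  exists h, proper_for (adj e L p) h /\ (h (c x1) = h (c x2) /\ h (c xa) = h (c xb)).
  move=> sub nab; have [bs [nc tb one le]] := noncrossing_subseq (isT : 0 < size [:: xa; xb]) sub.
  have nc' : noncrossing s ([:: [:: x1; x2]] ++ bs).
    by rewrite -[s]/([:: x1; x2] ++ [:: x3; x4; x5]); apply: NcCat => //; apply: NcOne.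
  have [|b|h ph ch] := independent_coloring eK M irr rs nc' _ inj.
  - by move: le; rewrite /= addn2 !ltnS => /leq_trans; apply.
  - rewrite inE => /orP[/eqP ->|/one [->|]].
    + exact: indep2.
    + exact: indep2.
    + exact: indep1.
  exists h; split=> //; split.
    by apply: (ch [:: x1; x2]); rewrite ?inE ?eqxx ?orbT.
  by apply: (ch [:: xa; xb]); rewrite ?inE ?eqxx ?orbT // tb orbT.
have sub345 xa xb : subseq [:: xa; xb] [:: x3; x4; x5] -> subseq [:: xa; xb] s.
  by move=> h; apply: subseq_trans h (suffix_subseq [:: x1; x2] _).
have inner xa xb : subseq [:: xa; xb] [:: x3; x4; x5] -> xa != x1 -> ~~ adj e L p (c xa) (c xb) ->
  exists xa xb h, [/\ subseq [:: xa; xb] s,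
  ~~ adj e L p (c xa) (c xb), (xa == x1) && (xb == x2) = false, proper_for (adj e L p) h
  & h (c x1) = h (c x2) /\ h (c xa) = h (c xb)].
  move=> sub xa1 nab; have [h [ph eh]] := disjoint_case _ _ sub nab.
  by exists xa, xb, h; split=> //; [exact: sub345 | rewrite (negbTE xa1)].
have [a34|] := boolP (adj e L p (c x3) (c x4)); last first.
  apply: inner; last by rewrite eq_sym.
  by have := @mask_subseq _ [:: true; true] [:: x3; x4; x5].
have [a45|] := boolP (adj e L p (c x4) (c x5)); last first.
  apply: inner; last by rewrite eq_sym.
  by have := @mask_subseq _ [:: false; true; true] [:: x3; x4; x5].
have [a35|] := boolP (adj e L p (c x3) (c x5)); last first.
  apply: inner; last by rewrite eq_sym.
  by have := @mask_subseq _ [:: true; false; true] [:: x3; x4; x5].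
have ins : [/\ x1 \in s, x2 \in s, x3 \in s, x4 \in s & x5 \in s].
  by split; rewrite !inE eqxx ?orbT.
have [i1 i2 i3 i4 i5] := ins.
have nvc x : x \in s -> v != c x.
  move=> xs; case: (rs) => _ _ sE; apply: contraFneq (irr v) => h; apply/adjP; exists x.
    by move: xs; rewrite sE => /andP[].
  by split=> //; move: xs; rewrite sE => /andP[_ /eqP].
have cne x y : x \in s -> y \in s -> x != y -> c x != c y.
  by move=> xs ys; apply: contraNneq => /inj ->.
have u3 : [/\ x3 != x4 & x4 != x5].
  move: us; rewrite /s /= !inE !negb_or => /and5P[_ _ /andP[-> _] -> _]; by [].
have [u34 u45] := u3.
have u23 : x2 != x3 by move: us; rewrite /s /= !inE !negb_or => /and5P[_ /and3P[-> ]].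
(* The ends of [x3], [x4], [x5] are now pairwise adjacent. The edge between the ends of [x3] and
   [x5] separates the end of [x4] from those of [x1] and [x2], so [x1], [x2], [x4] form an
   independent block. *)
have cross xa : xa \in [:: x1; x2] -> ~~ adj e L p (c xa) (c x4).
  move=> xa12; apply/negP=> a14.
  have sub4 : subseq [:: xa; x3; x4; x5] s.
    move: xa12; rewrite !inE => /orP[] /eqP ->.
      by have := @mask_subseq _ [:: true; false; true; true; true] s.
    by have := @mask_subseq _ [:: false; true; true; true; true] s.
  have [xs x3a x4a x5a] : [/\ xa \in s, xa != x3, xa != x5 & True].
    by move: xa12; rewrite !inE => /orP[] /eqP ->; rewrite ?eqxx ?orbT.
  apply: (@no_crossing V D e eK n L p v s xa x3 x4 x5 (pred2 (c xa) (c x4)) (pred2 (c x3) (c x5)) M rs sub4) => //=.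
  - by move=> u /orP[] /eqP ->; rewrite negb_or !cne // eq_sym.
  - by rewrite negb_or !nvc.
  - by rewrite negb_or !nvc.
  - by rewrite eqxx.
  - by rewrite eqxx.
  - by apply: connect1; rewrite /= !eqxx orbT.
  - by apply: connect1; rewrite /= !eqxx orbT.
have n14 : ~~ adj e L p (c x1) (c x4) by apply: cross; rewrite inE eqxx.
have n24 : ~~ adj e L p (c x2) (c x4) by apply: cross; rewrite !inE eqxx orbT.
have sub3 : subseq [:: x1; x2; x4] s by have := @mask_subseq _ [:: true; true; false; true] s.
have [bs [nc tb one le]] := noncrossing_subseq (isT : 0 < size [:: x1; x2; x4]) sub3.
have [|b|h ph ch] := independent_coloring eK M irr rs nc _ inj.
- by move: le; rewrite /= addn3 !ltnS => /leq_trans; apply.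
- move=> /one [->|].
    move=> y z; rewrite !inE => /or3P[] /eqP -> /or3P[] /eqP ->;
      solve [exact: (nn _) | exact: n12 | exact: n14 | exact: n24 | exact: nadjC n12
            | exact: nadjC n14 | exact: nadjC n24].
  exact: indep1.
exists x1, x4, h; split=> //.
- by have := @mask_subseq _ [:: true; false; false; true] s.
- by rewrite eqxx /= eq_sym (negbTE u24).
- by split; apply: (ch _ tb); rewrite !inE eqxx ?orbT.
Qed.

End Linking.

(** * Meyniel's theorem *)

Lemma eq_reach (V : finType) (E E' : rel V) f g t : E =2 E' -> reach E f g t -> reach E' f g t.
Proof. by move=> EE; apply: reach_sub => u w; rewrite EE. Qed.

Lemma simple_rotation_inj (V D : finType) (e n : {perm D}) L (p : D -> V) v s :
  simple_map e L p -> rotation n L p v s -> {in s &, injective (fun x => p (e x))}.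
Proof.
move=> sim [_ _ sE] x y; rewrite !sE => /andP[xL /eqP xv] /andP[yL /eqP yv] h.
by apply: sim; rewrite ?xv ?yv.
Qed.

Lemma subseq_head_neq (T : eqType) (x y z : T) s : uniq (x :: s) -> z = x -> ~ subseq [:: y; z] (x :: s).
Proof.
move=> /= /andP[xs _] -> /=; case: eqP => [_|_] h; last first.
  by case/negP: xs; apply: (mem_subseq h); rewrite !inE eqxx orbT.
by case/negP: xs; apply: (mem_subseq h); rewrite inE.
Qed.

(* Meyniel's theorem, with a bound depending only on the size of the graph: around
   a vertex of degree 5, either two consecutive neighbors are not adjacent and one
   compares the colorings where they agree with those where they differ, or the
   two colorings can be made to agree on a pair of opposite neighbors. *)
Theorem reach_bounded k : exists c, forall (V D : finType) (e n : {perm D}) L (p : D -> V),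
  involutive e -> plane_map e n L p -> irreflexive (adj e L p) ->
  map_measure (adj e L p) < k ->
  forall f g, proper_for (adj e L p) f -> proper_for (adj e L p) g ->
  reach (adj e L p) f g (fun _ => c).
Proof.
elim: k => [|k [c IH]]; first by exists 0.
(* A convenient common upper bound for the sums listed in [b1] to [b5]. *)
exists (12 * c + 20) => V D e n0 L0 p eK M0 irr0 lek f g pf0 pg0.
have b1 : (4 * c).+1 <= 12 * c + 20 by clear; lia.
have b2 : 4 + ((4 * c).+1 + 4) <= 12 * c + 20 by clear; lia.
have b3 : (4 * c).+1 + ((4 * c).+1 + c) <= 12 * c + 20 by clear; lia.
have b4 : c + ((4 * c).+1 + (4 * c).+1) <= 12 * c + 20 by clear; lia.
have b5 : c <= 12 * c + 20 by clear; lia.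
have [L00|L00] := eqVneq L0 set0.
  apply: reach_le (reach_edgeless _ _ _) _ => [u w|x]; last by rewrite addnC.
  by apply/negP=> /adjP[x]; rewrite L00 inE.
have [n [L [M adjE sim pE]]] := map_simplify eK M0 irr0.
have irr : irreflexive (adj e L p) by move=> u; rewrite adjE.
have mE := eq_map_measure adjE; rewrite -mE in lek.
have pf : proper_for (adj e L p) f by move=> u w; rewrite adjE; apply: pf0.
have pg : proper_for (adj e L p) g by move=> u w; rewrite adjE; apply: pg0.
apply: (eq_reach adjE).
have L1 : L != set0.
  by case/set0Pn: L00 => x xL; apply: contraTneq (imset_f p xL) => h; rewrite -pE h imset0 inE.
have [v [s [rs s0 s5]]] := low_degree_vertex eK M irr sim L1.
have inj := simple_rotation_inj sim rs.
have sym := adj_sym eK M.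
have irrv := negbT (irr v).
have merge bs f1 g1 : noncrossing s bs -> size bs <= 4 -> proper_for (adj e L p) f1 ->
    proper_for (adj e L p) g1 -> constant_on e p bs f1 -> constant_on e p bs g1 ->
    reach (adj e L p) f1 g1 (fun _ => (4 * c).+1).
  move=> nc szb pf1 pg1 cf cg; apply: (reach_merge eK M irrv rs nc szb s0 pf1 pg1 cf cg).
  move=> n' L' p' M' irr' lt pf' pg'; apply: (IH V D e n' L' p' eK M' irr') => //.
  rewrite -(support_adj M') -(support_adj M) in lt.
  by rewrite -ltnS; apply: leq_trans lek; rewrite ltnS; apply: map_measure_merge lt.
have [s4|s4] := leqP (size s) 4.
  have cs (h : {ffun V -> 'I_5}) : constant_on e p [seq [:: x] | x <- s] h.
    by move=> b /mapP[x _ ->] y z; rewrite !inE => /eqP -> /eqP ->.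
  have szs : size [seq [:: x] | x <- s] <= 4 by rewrite size_map.
  exact: reach_le (merge _ f g (noncrossing_singletons s0) szs pf pg (cs f) (cs g)) _.
have se5 : size s = 5 by apply/eqP; rewrite eqn_leq s5 s4.
have [/forallP cyc|] := boolP [forall i : 'I_5,
   adj e L p (nth v [seq p (e x) | x <- s] i) (nth v [seq p (e x) | x <- s] (i.+1 %% 5))].
  have [|f1 [g1 [bs [Rf Rg [pf1 pg1] [nc szb] [cf cg]]]]] := pentagon_reduce eK M rs se5 _ pf pg.
    by move=> i i5; apply: (cyc (Ordinal i5)).
  have R := reach_trans Rf (reach_trans (merge bs f1 g1 nc szb pf1 pg1 cf cg) (reach_sym Rg)).
  exact: reach_le R _.
case/forallPn=> i nadj.
have [x1 [x2 [x3 [x4 [x5 [rotE n12]]]]]] : exists x1 x2 x3 x4 x5,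
    rot i s = [:: x1; x2; x3; x4; x5] /\ ~~ adj e L p (p (e x1)) (p (e x2)).
  case: i nadj => i i5; case: (s) se5 => [|y1 [|y2 [|y3 [|y4 [|y5 [|]]]]]] // _.
  case: i i5 => [|[|[|[|[|]]]]] //= _ nadj.
  - by exists y1, y2, y3, y4, y5.
  - by exists y2, y3, y4, y5, y1.
  - by exists y3, y4, y5, y1, y2.
  - by exists y4, y5, y1, y2, y3.
  - by exists y5, y1, y2, y3, y4.
have rs' := rotation_rot i rs; have inj' := simple_rotation_inj sim rs'.
rewrite rotE in rs' inj'.
have mergeR bs f1 g1 : noncrossing [:: x1; x2; x3; x4; x5] bs -> size bs <= 4 -> proper_for (adj e L p) f1 ->
    proper_for (adj e L p) g1 -> constant_on e p bs f1 -> constant_on e p bs g1 ->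
    reach (adj e L p) f1 g1 (fun _ => (4 * c).+1).
  by rewrite -rotE => nc; apply: merge; apply: NcRot nc.
set s' := [:: x1; x2; x3; x4; x5] in rs' inj' mergeR.
have mergePair xa xb f1 g1 : subseq [:: xa; xb] s' -> proper_for (adj e L p) f1 ->
    proper_for (adj e L p) g1 -> f1 (p (e xa)) = f1 (p (e xb)) -> g1 (p (e xa)) = g1 (p (e xb)) ->
    reach (adj e L p) f1 g1 (fun _ => (4 * c).+1).
  move=> sub pf1 pg1 ff gg.
  have [bs [nc tb one le]] := noncrossing_subseq (isT : 0 < size [:: xa; xb]) sub.
  apply: (mergeR bs f1 g1 nc _ pf1 pg1); first by move: le; rewrite /= addn2 !ltnS.
    exact: (constant_on_pair M rs' one ff).
  exact: (constant_on_pair M rs' one gg).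
set c1 := p (e x1) in n12; set c2 := p (e x2) in n12.
have [us' cs' sE'] := rs'.
have ins : x1 \in s' /\ x2 \in s' by rewrite !inE !eqxx ?orbT.
have [i1 i2] := ins.
have x1L : x1 \in L by move: i1; rewrite sE' => /andP[].
have px1 : p x1 = v by move: i1; rewrite sE' => /andP[_ /eqP].
have nx1 : n x1 = x2 by move: cs' => /= /andP[/eqP].
have nbrv x : x \in s' -> p (e x) != v.
  move=> xs; apply: contraFneq (irr v) => h; rewrite -[X in adj _ _ _ _ X]h (rotation_nbr M rs').
  exact: (map_f (fun x => p (e x))).
have c12 : c1 != c2.
  apply/eqP=> /(inj' _ _ i1 i2) x12; move: us'; by rewrite /s' /= x12 inE eqxx.
(* A coloring that differs on [c1] and [c2] is a proper coloring of the map with this edge added,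
   and the added edge lowers the measure. *)
have := map_add_edge eK M x1L; rewrite nx1 px1 -/c1 -/c2.
case/(_ (nbrv _ i1) c12)=> D' [e' [n' [L' [p' [eK' M' adjE' [iota [pi roti]]]]]]].
have irr' : irreflexive (adj e' L' p').
  move=> u; rewrite adjE' irr /=; have [->|_] := eqVneq u c1; last by rewrite andbF.
  by rewrite (negbTE c12).
have subE : subrel (adj e L p) (adj e' L' p') by move=> u w uw; rewrite adjE' uw.
have adjv x : x \in s' -> adj e L p (p (e x)) v.
  by move=> xs; rewrite sym (rotation_nbr M rs'); apply: (map_f (fun x => p (e x))).
have measure' : map_measure (adj e' L' p') < map_measure (adj e L p).
  apply: map_measure_edge => //.
    apply/setP=> u; rewrite !inE; apply/existsP/existsP=> -[w]; last by exists w; apply: subE.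
    rewrite adjE' => /or3P[h|/andP[/eqP -> _]|/andP[/eqP -> _]]; first by exists w.
      by exists v; apply: (adjv x1).
    by exists v; apply: (adjv x2).
  apply: proper_card; apply/properP; split.
    by apply/subsetP=> uw; rewrite !inE; apply: subE.
  exists (c1, c2); first by rewrite inE adjE' /= !eqxx orbT.
  by rewrite inE.
have properE (h : {ffun V -> 'I_5}) : proper_for (adj e L p) h -> h c1 != h c2 -> proper_for (adj e' L' p') h.
  move=> ph h12 u w; rewrite adjE' => /or3P[/ph //|/andP[/eqP -> /eqP ->]|/andP[/eqP -> /eqP ->]] //.
  by rewrite eq_sym.
have different f1 g1 : proper_for (adj e L p) f1 -> proper_for (adj e L p) g1 -> f1 c1 != f1 c2 ->
    g1 c1 != g1 c2 -> reach (adj e L p) f1 g1 (fun _ => c).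
  move=> pf1 pg1 f12 g12; apply: (reach_sub subE).
  apply: (IH V D' e' n' L' p' eK' M' irr'); [|exact: properE|exact: properE].
  by rewrite -ltnS; apply: leq_trans lek.
have sub12 : subseq [:: x1; x2] s' by have := @mask_subseq _ [:: true; true] s'.
have same f1 g1 : proper_for (adj e L p) f1 -> proper_for (adj e L p) g1 -> f1 c1 = f1 c2 ->
    g1 c1 = g1 c2 -> reach (adj e L p) f1 g1 (fun _ => (4 * c).+1).
  exact: mergePair.
have [xa [xb [h1 [subab nab neab ph1 [h12 hab]]]]] := linking_pair eK M irr rs' inj' n12.
have [a_in b_in] : xa \in s' /\ xb \in s'.
  by split; apply: (mem_subseq subab); rewrite !inE eqxx ?orbT.
(* [h1] agrees on both pairs, [h2] on the pair [xa], [xb] only; [h2] is found by merging this pair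
   in the map with the added edge. A merge of [xa] and [xb] then links the colorings agreeing on
   [c1], [c2] to those that differ there. *)
have [h2 ph2 [h2n h2ab]] : exists2 h2 : {ffun V -> 'I_5}, proper_for (adj e L p) h2 &
    h2 c1 != h2 c2 /\ h2 (p (e xa)) = h2 (p (e xb)).
  have vc x : x \in s' -> v != p (e x) by move=> xs; rewrite eq_sym nbrv.
  have rsi := roti v s' (vc _ i1) (vc _ i2) rs'.
  have [bs [nc tb one le]] := noncrossing_subseq (isT : 0 < size [:: xa; xb]) subab.
  have nab' : ~~ adj e' L' p' (p (e xa)) (p (e xb)).
    rewrite adjE' (negbTE nab) /=; apply/norP; split; apply/negP=> /andP[/eqP E1 /eqP E2].
      by move: neab; rewrite (inj' _ _ a_in i1 E1) (inj' _ _ b_in i2 E2) !eqxx.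
    have xa2 := inj' _ _ a_in i2 E1; have xb1 := inj' _ _ b_in i1 E2.
    exact: (subseq_head_neq us' xb1 subab).
  have [|||h ph ch] := independent_coloring eK' M' irr' rsi (noncrossing_map iota nc).
  - by rewrite size_map; move: le; rewrite /= addn2 !ltnS.
  - by move=> _ _ /mapP[x xs ->] /mapP[y ys ->]; rewrite !pi => /(inj' _ _ xs ys) ->.
  - have nab2 : ~~ adj e' L' p' (p (e xb)) (p (e xa)) by rewrite (adj_sym eK' M').
    move=> _ /mapP[b /one bE ->] _ _ /mapP[x xb' ->] /mapP[y yb ->]; rewrite !pi.
    case: bE xb' yb => [->|].
      rewrite !inE => /orP[] /eqP -> /orP[] /eqP ->; [by rewrite irr'|exact: nab'|exact: nab2|by rewrite irr'].
    by case: b => [|z [|]] // _; rewrite !inE => /eqP -> /eqP ->; rewrite irr'.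
  exists h; first by move=> u w uw; apply: ph; apply: subE.
  split; first by apply: ph; rewrite adjE' !eqxx orbT.
  rewrite -!pi; apply: (ch (map iota [:: xa; xb])); first exact: map_f.
    by rewrite inE eqxx.
  by rewrite !inE eqxx orbT.
have R12 := mergePair xa xb h1 h2 subab ph1 ph2 hab h2ab.
have [f12|f12] := eqVneq (f c1) (f c2); have [g12|g12] := eqVneq (g c1) (g c2).
- exact: reach_le (same f g pf pg f12 g12) _.
- have R := reach_trans (same f h1 pf ph1 f12 h12) (reach_trans R12 (different h2 g ph2 pg h2n g12)).
  exact: reach_le R _.
- have R := reach_trans (different f h2 pf ph2 f12 h2n)
    (reach_trans (reach_sym R12) (same h1 g ph1 pg h12 g12)).
  exact: reach_le R _.
- exact: reach_le (different f g pf pg f12 g12) _.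
Qed.

(** * The polynomial recursion *)

Lemma greedy_independent (T : finType) (R : rel T) d (A : {set T}) :
  symmetric R -> {in A, reflexive R} -> {in A, forall x, #|[set y | R x y]| <= d} ->
  exists I, [/\ uniq I, {subset I <= A}, {in I &, forall x y, x != y -> ~~ R x y}
              & #|A| <= d * size I].
Proof.
move=> sR; have [k] := ubnP #|A|; elim: k A => // k IH A lek rA dA.
have [->|[x xA]] := set_0Vmem A; first by exists [::]; rewrite cards0.
pose A' := A :\: [set y | R x y].
have sA' : A' \subset A by apply: subsetDl.
have xN : x \notin A' by rewrite !inE rA.
have lt : #|A'| < #|A|.
  by apply: proper_card; apply/properP; split=> //; exists x.
have [|y yA'|y yA'|I [uI sI nI cI]] := IH A'.
- exact: leq_trans lt lek.
- by apply: rA; apply: (subsetP sA').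
- by apply: dA; apply: (subsetP sA').
have xy y : y \in I -> ~~ R x y by move/sI; rewrite !inE => /andP[].
exists (x :: I); split=> /=.
- by rewrite uI andbT; apply: contra xN; apply: sI.
- by move=> y; rewrite inE => /orP[/eqP -> //|/sI]; apply: (subsetP sA').
- move=> y z; rewrite !inE => /orP[/eqP ->|yI] /orP[/eqP ->|zI]; rewrite ?eqxx // => yz.
  + exact: xy.
  + by rewrite sR; apply: xy.
  + exact: nI.
- rewrite mulnS; apply: leq_trans (_ : #|[set y | R x y]| + #|A'| <= _); last first.
    by apply: leq_add; first exact: dA.
  by rewrite -(cardsID [set y | R x y] A) leq_add2r subset_leq_card ?subsetIr.
Qed.

Definition rel_comp (T : finType) (Q Q' : rel T) : rel T :=
  fun x z => [exists y, Q x y && Q' y z].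

Lemma card_rel_comp (T : finType) (Q Q' : rel T) d d' x :
  #|[set y | Q x y]| <= d -> (forall y, #|[set z | Q' y z]| <= d') ->
  #|[set z | rel_comp Q Q' x z]| <= d * d'.
Proof.
move=> dQ dQ'; pose F := \bigcup_(y in [set y | Q x y]) [set z | Q' y z].
apply: (@leq_trans #|F|).
  apply: subset_leq_card; apply/subsetP=> z; rewrite inE => /existsP[y /andP[xy yz]].
  by apply/bigcupP; exists y; rewrite inE.
apply: leq_trans (_ : \sum_(y in [set y | Q x y]) d' <= _); last first.
  by rewrite sum_nat_const leq_mul2r dQ orbT.
rewrite /F; apply: (big_ind2 (fun (B : {set T}) k => #|B| <= k)) => [|B1 k1 B2 k2 h1 h2|y _] //.
  by rewrite cards0.
by apply: leq_trans (leq_card_setU _ _) _; apply: leq_add.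
Qed.

(** * A spread-out family of vertices of small degree *)

Section Selection.
Variables (V D : finType) (e : {perm D}).
Hypothesis eK : involutive e.
Variables (n : {perm D}) (L : {set D}) (p : D -> V) (K : nat).
Hypothesis M : plane_map e n L p.
Hypothesis irr : irreflexive (adj e L p).
Hypothesis sim : simple_map e L p.
Let E := adj e L p.

Definition degree (L : {set D}) (p : D -> V) u := #|[set x in L | p x == u]|.
Definition big u := K <= degree L p u.
Definition big_degree v := #|[set x in L | (p x == v) && big (p (e x))]|.
Definition near v x := (x == v) || E v x && ~~ big x.

Lemma sum_degree : \sum_(u in p @: L) degree L p u = #|L|.
Proof.
rewrite -[RHS]sum1_card (partition_big p (mem (p @: L))) /=; last by move=> x xL; rewrite imset_f.
by apply: eq_bigr => u _; rewrite /degree -sum1_card; apply: eq_bigl => x; rewrite inE.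
Qed.

Lemma degree_gt0 u : u \in p @: L -> 0 < degree L p u.
Proof. by case/imsetP=> x xL ->; apply/card_gt0P; exists x; rewrite inE xL eqxx. Qed.

Lemma card_neighbors u : #|[set w | E u w]| <= degree L p u.
Proof.
apply: leq_trans (leq_imset_card (fun x => p (e x)) _); apply: subset_leq_card.
apply/subsetP=> w; rewrite inE => /adjP[x xL [pu pw]]; apply/imsetP; exists x => //.
by rewrite inE xL pu eqxx.
Qed.

(* A discharging count: every vertex of small degree sends one unit of its degree
   to each of its big neighbors; the average degree being less than 6, this leaves many
   small vertices with [degree + big_degree <= 6]. *)
Lemma many_good_vertices : 84 <= K ->
  #|p @: L| <= 12 * #|[set v in p @: L | ~~ big v & degree L p v + big_degree v <= 6]|.
Proof.
move=> K84; have [L0|L0] := eqVneq L set0; first by rewrite L0 imset0 cards0.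
have lt6 := edge_bound eK M irr sim L0.
set G := [set v in _ | _ & _].
pose B := [set v in p @: L | big v]; pose S := [set v in p @: L | ~~ big v].
have WE : #|p @: L| = #|B| + #|S|.
  rewrite -(cardsID B (p @: L)); congr (_ + _).
    by apply: eq_card => v; rewrite !inE; case: (v \in p @: L); case: (big v).
  by apply: eq_card => v; rewrite !inE; case: (v \in p @: L); case: (big v).
have sumE : #|L| = \sum_(v in B) degree L p v + \sum_(v in S) degree L p v.
  rewrite -sum_degree (bigID big) /=; congr (_ + _); apply: eq_bigl => v; by rewrite inE.
have Bb : 84 * #|B| <= \sum_(v in B) degree L p v.
  rewrite mulnC -sum_nat_const; apply: leq_sum => v; rewrite inE => /andP[_].
  exact: leq_trans.
have bB : \sum_(v in S) big_degree v <= \sum_(v in B) degree L p v.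
  apply: (@leq_trans #|[set x in L | big (p (e x))]|).
    rewrite -[X in _ <= X]sum1_card.
    rewrite (partition_big p (mem (p @: L))) /=; last by move=> x; rewrite inE => /andP[/imset_f ->].
    rewrite [X in _ <= X](bigID [pred v | ~~ big v]) /= -[X in X <= _]addn0.
    apply: leq_add => //; rewrite leq_eqVlt; apply/orP; left; apply/eqP.
    apply: eq_big => [v|v _]; first by rewrite inE.
    rewrite /big_degree -sum1_card; apply: eq_bigl => x; rewrite !inE -!andbA.
    by congr (_ && _); rewrite andbC.
  rewrite (_ : #|_| = #|[set x in L | big (p x)]|).
    rewrite -[X in X <= _]sum1_card (partition_big p (mem B)) /=; last first.
      by move=> x; rewrite !inE => /andP[/imset_f -> ->].
    apply: leq_sum => v; rewrite inE => /andP[_ bv]; rewrite /degree -sum1_card.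
    rewrite big_mkcond [X in _ <= X]big_mkcond /=; apply: leq_sum => x _; rewrite !inE.
    by case: (x \in L) => //=; case: (p x == v); rewrite ?andbT ?andbF //; case: big.
  rewrite -[RHS](card_imset _ (@perm_inj _ e)); apply: eq_card => x; rewrite inE.
  have [_ eL _ _] := M.
  apply/andP/imsetP=> [[xL bx]|[y + ->]]; last by rewrite inE eK => /andP[/eL].
  by exists (e x); rewrite ?eK // inE eL.
have key : 7 * #|S| <= \sum_(v in S) degree L p v + \sum_(v in S) big_degree v + 6 * #|G|.
  rewrite -big_split /= mulnC -sum_nat_const.
  have -> : 6 * #|G| = \sum_(v in S) (if v \in G then 6 else 0).
    rewrite -big_mkcondr /= mulnC -sum_nat_const; apply: eq_bigl => v.
    by rewrite /S /G !inE; case: (v \in p @: L); case: (big v).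
  rewrite -big_split /=; apply: leq_sum => v; rewrite inE => /andP[vW bv].
  have := degree_gt0 vW; have : v \in G = (degree L p v + big_degree v <= 6).
    by rewrite inE vW bv.
  by case: (_ \in G) => [_|/esym/negbT]; lia.
(* Writing [W], [B], [S], [G] for the sizes of the sets: [key] and [bB] give [7S <= |L| + 6G], hence
   [S < 6B + 6G] by the edge bound, while [84B <= |L| < 6W] gives [7B < W/2]. So
   [W = B + S < W/2 + 6G], which explains both 84 and 12. *)
move: lt6 WE sumE Bb bB key; move: #|L| #|p @: L| #|B| #|S| #|G|.
move: (\sum_(v in B) degree L p v) (\sum_(v in S) degree L p v) (\sum_(v in S) big_degree v).
clear; lia.
Qed.

(** Two vertices that conflict are joined by at most three steps between small vertices, and each
    vertex has at most [K ^ 3] others within such reach. Steps through big vertices would admit no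
    bound, so nothing is asked about big neighbors. *)
Lemma spread_vertices : 84 <= K ->
  exists I : seq V, [/\ uniq I, #|p @: L| <= 12 * K ^ 3 * size I,
    {in I, forall v, [/\ 0 < degree L p v, ~~ big v & degree L p v + big_degree v <= 6]}
  & {in I &, forall v w, v != w -> forall x y, near v x -> near w y ->
       x != y /\ ~~ E x y}].
Proof.
move=> K84; have sE : symmetric E := adj_sym eK M.
pose Q x y := [&& ~~ big x, ~~ big y & (x == y) || E x y].
have sQ : symmetric Q by move=> x y; rewrite /Q sE eq_sym; case: big; case: big.
have dQ x : #|[set y | Q x y]| <= K.
  have [bx|bx] := boolP (big x).
    by rewrite (_ : [set y | _] = set0) ?cards0 //; apply/setP=> y; rewrite !inE /Q bx.
  apply: (@leq_trans #|x |: [set y | E x y]|).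
    apply: subset_leq_card; apply/subsetP=> y; rewrite !inE => /and3P[_ _].
    by rewrite eq_sym.
  rewrite cardsU1 inE (irr x : E x x = false); apply: leq_ltn_trans (card_neighbors x) _.
  by rewrite ltnNge.
pose R := rel_comp Q (rel_comp Q Q).
have dR x : #|[set y | R x y]| <= K ^ 3.
  rewrite !expnS expn0 muln1; apply: card_rel_comp => // y; exact: card_rel_comp.
have sR : symmetric R.
  have imp x y : R x y -> R y x.
    case/existsP=> a /andP[xa /existsP[b /andP[ab yb]]].
    apply/existsP; exists b; rewrite sQ yb; apply/existsP; exists a.
    by rewrite sQ ab sQ.
  by move=> x y; apply/idP/idP; apply: imp.
set G := [set v in p @: L | ~~ big v & degree L p v + big_degree v <= 6].
have rR : {in G, reflexive R}.
  move=> v; rewrite inE => /and3P[_ bv _]; have qv : Q v v by rewrite /Q bv eqxx.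
  by apply/existsP; exists v; rewrite qv; apply/existsP; exists v; rewrite qv.
have [I [uI sI nI cI]] := greedy_independent sR rR (fun x _ => dR x).
exists I; split=> //.
- apply: leq_trans (many_good_vertices K84) _; by rewrite -mulnA leq_mul2l cI orbT.
- by move=> v /sI; rewrite inE => /and3P[/degree_gt0 d0 bv dv]; split.
move=> v w vI wI vw x y vx wy.
have nearQ u z : u \in I -> near u z -> Q u z.
  move/sI; rewrite inE => /and3P[_ bu _] /orP[/eqP ->|/andP[uz bz]]; rewrite /Q bu ?eqxx //.
  by rewrite bz uz orbT.
have [qx qy] := (nearQ v x vI vx, nearQ w y wI wy).
have bx : ~~ big x by case/and3P: qx.
have by' : ~~ big y by case/and3P: qy.
have nR := nI v w vI wI vw.
suff : ~~ ((x == y) || E x y) by rewrite negb_or => /andP.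
apply: contra nR => xy; apply/existsP; exists x; rewrite qx; apply/existsP; exists y.
have qxy : Q x y by rewrite /Q bx by'.
by rewrite qxy sQ.
Qed.

End Selection.

(** * Merging at all vertices of a nonadjacent family *)

Section Process.
Variables (V D : finType) (e : {perm D}).
Hypothesis eK : involutive e.
Implicit Types (n : {perm D}) (L : {set D}) (p : D -> V) (v : V) (s : seq D) (bs : seq (seq D)).
Implicit Types (S : V -> seq D) (B : V -> seq (seq D)) (I : seq V).

(** Giving all neighbors of [v] one common label is compatible with any blocks, so [r] mixes only
    neighbors of [v] among themselves. The other vertices of the family are not among them and keep
    their rotations. *)
Lemma merge_step n L p v I S bs : plane_map e n L p -> ~~ adj e L p v v ->
  rotation n L p v (S v) -> noncrossing (S v) bs ->
  v \notin I -> {in v :: I &, forall u w, ~~ adj e L p u w} ->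
  {in I, forall u, rotation n L p u (S u)} ->
  exists n1 r, let L1 := [set x in L | (p x != v) && (p (e x) != v)] in
  [/\ plane_map e n1 L1 (r \o p), constant_on e p bs r,
      forall (T : eqType) (phi : V -> T), constant_on e p bs phi -> forall u, phi (r u) = phi u,
      {in I, forall u, rotation n1 L1 (r \o p) u (S u)}
    & {in I &, forall u w, ~~ adj e L1 (r \o p) u w} /\
      forall w, (r w \in I) = (w \in I)].
Proof.
move=> M irr rv nc vI nadj rI.
have [n1 [r [M1 H1 U1 N1]]] := map_merge eK M irr rv nc.
have rfix u w : u \in I -> (r w == u) = (w == u).
  move=> uI; pose phi w := if w \in [seq p (e x) | x <- S v] then None else Some w.
  have uN : u \notin [seq p (e x) | x <- S v].
    by rewrite -(rotation_nbr M rv); apply: nadj; rewrite inE ?eqxx ?uI ?orbT.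
  have phiu x : (phi x == Some u) = (x == u).
    by rewrite /phi; case: ifP => // xN; apply/esym/negbTE; apply: contraNneq uN => <-.
  rewrite -!phiu U1 // => b bb x y xb yb; rewrite /phi !(map_f (fun x => p (e x))) //;
    by rewrite -(perm_mem (noncrossing_perm nc)); apply/flattenP; exists b.
exists n1, r => L1; split=> //.
- move=> u uI; have [us cs sE] := rI u uI; split=> //.
    have nn : {in S u &, frel n1 =2 frel n}.
      move=> x y xs _ /=; move: xs; rewrite sE => /andP[xL /eqP pu]; rewrite N1 // pu.
        by apply: contraNneq vI => <-.
      by apply: nadj; rewrite inE ?eqxx ?uI ?orbT.
    by rewrite (eq_in_cycle nn) //; apply/allP.
  move=> x; rewrite sE !inE /= rfix //; case: (boolP (x \in L)) => //= xL.
  case: eqP => [pu|]; last by rewrite andbF.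
  rewrite andbT; apply/esym/andP; split.
    by rewrite pu; apply: contraNneq vI => <-.
  apply: contraTneq (nadj u v _ _) => [pe||]; rewrite ?inE ?eqxx ?uI ?orbT //.
  by apply/negPn/adjP; exists x.
split=> [u w uI wI|w]; last first.
  apply/idP/idP=> wI; first by have := rfix _ w wI; rewrite eqxx => /esym/eqP ->.
  by have := rfix _ w wI; rewrite eqxx => /eqP ->.
apply/negP=> /adjP[x]; rewrite inE => /and3P[xL _ _] /= [/eqP + /eqP].
  rewrite !rfix // => /eqP pu /eqP pw; have := nadj u w.
  rewrite !inE uI wI !orbT => /(_ isT isT)/negP; apply; by apply/adjP; exists x.
Qed.

Definition blocks_of s bs :=
  [/\ noncrossing s bs, size bs <= 4 & size s <= 4 -> bs = [seq [:: x] | x <- s]].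

Lemma proper_merged (f : {ffun V -> 'I_5}) (r : V -> V) L (L1 : {set D}) p : L1 \subset L ->
  (forall u, f (r u) = f u) -> proper_for (adj e L p) f -> proper_for (adj e L1 (r \o p)) f.
Proof.
move=> /subsetP sub rf pf u w /adjP[x xL [/= <- <-]]; rewrite !rf; apply: pf.
by apply/adjP; exists x => //; apply: sub.
Qed.

Lemma sub_live L p v : [set x in L | (p x != v) && (p (e x) != v)] \subset L.
Proof. by apply/subsetP=> x; rewrite inE => /andP[]. Qed.

Lemma constant_on_lift n L p v I S B (r : V -> V) (f f1 : {ffun V -> 'I_5}) bs :
  plane_map e n L p -> rotation n L p v (S v) -> noncrossing (S v) bs ->
  ~~ adj e L p v v -> v \notin I ->
  {in v :: I &, forall u w, ~~ adj e L p u w} ->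
  {in I, forall u, rotation n L p u (S u)} ->
  {in I, forall u, noncrossing (S u) (B u)} ->
  constant_on e p bs r -> (forall u, u != v -> f u = f1 (r u)) ->
  {in I, forall u, constant_on e (r \o p) (B u) f1} ->
  {in v :: I, forall u, constant_on e p (if u == v then bs else B u) f}.
Proof.
move=> M rv nc irr vI nadj rI ncI cr ff1 c1 u uI.
have nv u' s' x : u' \in v :: I -> rotation n L p u' s' -> x \in s' -> p (e x) != v.
  move=> u'I rs xs; apply: contraTneq (nadj u' v u'I (mem_head _ _)) => h.
  by rewrite negbK -h (rotation_nbr M rs); apply: (map_f (fun x => p (e x))).
have mem s' bs' b x : noncrossing s' bs' -> b \in bs' -> x \in b -> x \in s'.
  by move=> nc' bb xb; rewrite -(perm_mem (noncrossing_perm nc')); apply/flattenP; exists b.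
case: eqP uI => [->|/eqP uv] uI b bb x y xb yb.
  by rewrite !ff1 ?(cr b bb x y) //; apply: (nv v (S v)) => //; apply: mem bb _.
have uI' : u \in I by move: uI; rewrite inE (negbTE uv).
rewrite !ff1; first exact: (c1 u uI' b bb).
all: by apply: (nv u (S u) _ uI (rI u uI')); apply: mem (ncI u uI') bb _.
Qed.

(** One labelling [phi], constant on all blocks, certifies the absence of loops throughout the
    sequence of merges; five colors are then enough at the end and at each extension back. *)
Lemma merged_coloring_seq (T : eqType) (phi : V -> T) I S B n L p :
  plane_map e n L p -> (forall u w, adj e L p u w -> phi u != phi w) ->
  uniq I -> {in I &, forall u w, ~~ adj e L p u w} ->
  {in I, forall u, [/\ rotation n L p u (S u), noncrossing (S u) (B u), size (B u) <= 4
     & constant_on e p (B u) phi]} ->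
  exists2 h : {ffun V -> 'I_5}, proper_for (adj e L p) h & {in I, forall u, constant_on e p (B u) h}.
Proof.
elim: I n L p => [|v I IH] n L p M pphi.
  move=> _ _ _; have [|h ph] := five_color eK M; last by exists h.
  by move=> u; apply/negbTE/negP=> h; have := pphi _ _ h; rewrite eqxx.
move=> /= /andP[vI uI] nadj HI; have [rv ncv szv cv] := HI v (mem_head _ _).
have sub u : u \in I -> u \in v :: I by rewrite inE orbC => ->.
have irr u : ~~ adj e L p u u by apply/negP=> h; have := pphi _ _ h; rewrite eqxx.
have rI : {in I, forall u, rotation n L p u (S u)} by move=> u /sub/HI[].
have [n1 [r [M1 H1 U1 R1 [A1 rI1]]]] := merge_step M (irr v) rv ncv vI nadj rI.
have rphi := U1 _ _ cv.
have [||h1 ph1 ch1] := IH _ _ _ M1 _ uI A1.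
- move=> u w /adjP[x xL1 [/= <- <-]]; rewrite !rphi; apply: pphi; apply/adjP; exists x => //.
  exact: (subsetP (sub_live L p v)).
- move=> u uI'; have [_ nc sz c] := HI u (sub _ uI'); split=> //; first exact: R1.
  by move=> b bb x y xb yb /=; rewrite !rphi; apply: c bb _ _ xb yb.
have [h ph hh] := extend_coloring eK M (irr v) rv ncv szv H1 ph1.
exists h => // u uI'.
have ncI : {in I, forall u, noncrossing (S u) (B u)} by move=> w /sub/HI[].
have := constant_on_lift M rv ncv (irr v) vI nadj rI ncI H1 hh ch1 uI'.
by case: eqP => [->|].
Qed.

(* Reducing a coloring by Kempe changes at the vertices of [I], one after the
   other, merging the blocks found at a vertex before passing to the next. *)
Lemma reduce_seq T I S n L p f :
  plane_map e n L p -> proper_for (adj e L p) f ->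
  uniq I -> {in I &, forall u w, ~~ adj e L p u w} ->
  {in I, forall u, [/\ rotation n L p u (S u), 0 < size (S u) & size (S u) <= 6]} ->
  (forall n' L' p', plane_map e n' L' p' -> irreflexive (adj e L' p') ->
     #|p' @: L'| + size I <= #|p @: L| -> forall f g, proper_for (adj e L' p') f ->
     proper_for (adj e L' p') g -> reach (adj e L' p') f g (fun _ => T)) ->
  exists B (f' : {ffun V -> 'I_5}), [/\ {in I, forall u, blocks_of (S u) (B u)},
    proper_for (adj e L p) f', {in I, forall u, constant_on e p (B u) f'}
  & forall g, proper_for (adj e L p) g -> {in I, forall u, constant_on e p (B u) g} ->
    reach (adj e L p) f g (fun x => let c := T + 6 * size I in if x \in I then 5 * c + 1 else c)].
Proof.
elim: I n L p f => [|v I IH] n L p f M pf.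
  move=> _ _ _ HT; exists (fun _ => [::]), f; split=> // g pg _.
  apply: reach_le (HT n L p M _ _ f g pf pg) _; last by move=> x; rewrite addn0.
    by move=> u; apply/negbTE/negP=> h; have := pf _ _ h; rewrite eqxx.
  by rewrite addn0.
move=> /= /andP[vI uI] nadj HI HT; have [rv s0 s6] := HI v (mem_head _ _).
have sub u : u \in I -> u \in v :: I by rewrite inE orbC => ->.
have irr u : ~~ adj e L p u u by apply/negP=> h; have := pf _ _ h; rewrite eqxx.
have rI : {in I, forall u, rotation n L p u (S u)} by move=> u /sub/HI[].
have [f1 [bs [Rf pf1 [nc szb] cf1 bs4]]] := kempe_reduce eK M rv pf s0 s6.
have [n1 [r [M1 H1 U1 R1 [A1 rI1]]]] := merge_step M (irr v) rv nc vI nadj rI.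
set L1 := [set x in L | _] in M1 R1 A1.
have L1L : L1 \subset L by apply: sub_live.
have rf1 u : f1 (r u) = f1 u by apply: U1.
have pf11 := proper_merged L1L rf1 pf1.
have lt1 := merged_card M (irr v) rv nc s0 (fun phi => U1 _ phi).
have [||B [f2 [HB pf2 cf2 reach2]]] := IH _ _ _ _ M1 pf11 uI A1.
- by move=> u uI'; have [_ h1 h2] := HI u (sub _ uI'); split=> //; apply: R1.
- move=> n' L' p' M' irr' le; apply: HT M' irr' _.
  by rewrite addnS; apply: leq_ltn_trans le lt1.
have [h ph hh] := extend_coloring eK M (irr v) rv nc szb H1 pf2.
have ncI : {in I, forall u, noncrossing (S u) (B u)} by move=> w /HB[].
exists (fun u => if u == v then bs else B u), h; split=> //.
- move=> u; rewrite inE; case: eqP => [-> _|_ /=]; first by split.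
  exact: HB.
- exact: (constant_on_lift M rv nc (irr v) vI nadj rI ncI H1 hh cf2).
move=> g pg cg.
have rg u : g (r u) = g u.
  by apply: U1; have := cg v (mem_head _ _); rewrite eqxx.
have cg2 : {in I, forall u, constant_on e (r \o p) (B u) g}.
  move=> u uI' b bb x y xb yb /=; rewrite !rg; have := cg u (sub _ uI').
  case: eqP => [uv|_ c]; first by rewrite -uv uI' in vI.
  exact: c b bb x y xb yb.
have R2 := reach2 g (proper_merged L1L rg pg) cg2.
pose Z := [seq (if b is x :: _ then r (p (e x)) else v) | b <- bs].
have Z4 : size Z <= 4 by rewrite size_map.
have hZ x : adj e L p v x -> r x \in Z.
  rewrite (rotation_nbr M rv) => /mapP[y ys ->].
  move: ys; rewrite -(perm_mem (noncrossing_perm nc)) => /flattenP[b bB yb].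
  apply/mapP; exists b => //; case: b bB yb => // z b bB yb.
  by rewrite (H1 _ bB y z) ?mem_head.
have hE x y : x != v -> y != v -> adj e L p x y -> adj e L1 (r \o p) (r x) (r y).
  move=> xv yv /adjP[z zL [zx zy]]; apply/adjP; exists z; last by rewrite /= zx zy.
  by rewrite inE zL zx zy xv.
have R3 := reach_lift (adj_sym eK M) (irr v) hE Z4 hZ R2 pf1 pg
  (fun x _ => esym (rf1 x)) (fun x _ => esym (rg x)).
(* The neighbors of [v] lie outside [I], so [v] follows vertices with budget [c] and never one with
   the larger budget. The factor 5 does not accumulate along the family. *)
have ZI : {in Z, forall z, z \notin I}.
  move=> z /mapP[[|x b] bb ->] //; rewrite rI1; apply/negP=> xI.
  have := nadj v (p (e x)) (mem_head _ _) (sub _ xI); rewrite (rotation_nbr M rv).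
  rewrite (map_f (fun x => p (e x))) //.
  by rewrite -(perm_mem (noncrossing_perm nc)); apply/flattenP; exists (x :: b); rewrite ?mem_head.
apply: reach_le (reach_trans Rf R3) _ => x /=; rewrite inE rI1.
have -> : T + 6 * (size I).+1 = T + 6 * size I + 6 by rewrite mulnS; clear; lia.
set c := T + 6 * size I; have [_|_] := eqVneq x v; last first.
  by case: ifP => _; move: c => c /=; clear; lia.
have -> : \sum_(z <- Z) (if z \in I then 5 * c + 1 else c) = size Z * c.
  rewrite big_seq_cond (eq_bigr (fun _ => c)) => [|z /andP[/ZI/negbTE -> _] //].
  by rewrite -big_seq_cond big_const_seq count_predT iter_addn_0 mulnC.
have : size Z * c <= 4 * c by rewrite leq_mul2r Z4 orbT.
by rewrite orTb; move: (size Z * c) => m; move: c => c; clear; lia.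
Qed.

End Process.

Section Common.
Variables (V D : finType) (e : {perm D}).
Hypothesis eK : involutive e.
Variables (n : {perm D}) (L : {set D}) (p : D -> V) (K : nat) (I : seq V).
Variables (S : V -> seq D) (B : V -> seq (seq D)) (F : V -> {ffun V -> 'I_5}).
Hypothesis M : plane_map e n L p.
Hypothesis sim : simple_map e L p.
Let E := adj e L p.
Hypothesis irr : irreflexive E.
Hypothesis uI : uniq I.
Hypothesis few : {in I, forall v, ~~ big L p K v /\ degree L p v + big_degree e L p K v <= 6}.
Hypothesis spread : {in I &, forall v w, v != w -> forall x y,
  near e L p K v x -> near e L p K w y -> x != y /\ ~~ E x y}.
Hypothesis rotS : {in I, forall v, rotation n L p v (S v)}.
Hypothesis blocks : {in I, forall v, blocks_of (S v) (B v)}.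
Hypothesis pF : {in I, forall v, proper_for E (F v)}.
Hypothesis cF : {in I, forall v, constant_on e p (B v) (F v)}.

(* Each vertex of [I] is reduced according to its own coloring [F v].  A small
   neighbor [x] of [v] is labelled by the big neighbor of [v] having its color, if
   any, and else by [v] and its color; the spreading of [I] makes this labelling proper. *)
Lemma common_coloring : exists2 h : {ffun V -> 'I_5}, proper_for E h &
  {in I, forall v, constant_on e p (B v) h}.
Proof.
have near0 v : near e L p K v v by rewrite /near eqxx.
have near1 v x : E v x -> ~~ big L p K x -> near e L p K v x.
  by move=> vx bx; rewrite /near bx -/E vx orbT.
have nadj : {in I &, forall u w, ~~ E u w}.
  move=> u w uI' wI; have [->|uw] := eqVneq u w; first by rewrite irr.
  by have [] := spread uI' wI uw (near0 u) (near0 w).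
pose owner x := [pick v in I | E v x && ~~ big L p K x].
have ownerE v x : v \in I -> E v x -> ~~ big L p K x -> owner x = Some v.
  move=> vI vx bx; rewrite /owner; case: pickP => [w /and3P[wI wx _]|/(_ v)]; last first.
    by rewrite vI vx bx.
  congr Some; apply/eqP/negPn/negP=> wv.
  by have [] := spread wI vI wv (near1 _ _ wx bx) (near1 _ _ vx bx); rewrite eqxx.
have ownerP x v : owner x = Some v -> [/\ v \in I, E v x & ~~ big L p K x].
  by rewrite /owner; case: pickP => // w /and3P[? ? ?] [<-].
pose hub v x := [pick h | [&& E v h, big L p K h & F v h == F v x]].
have hubP v x h : hub v x = Some h -> [/\ E v h, big L p K h & F v h = F v x].
  by rewrite /hub; case: pickP => // w /and3P[? ? /eqP ?] [<-].
pose phi x : V + V * 'I_5 := if owner x is Some v then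
  (if hub v x is Some h then inl h else inr (v, F v x)) else inl x.
have pphi u w : E u w -> phi u != phi w.
  move=> uw; have wu : E w u by rewrite /E (adj_sym eK M).
  rewrite /phi; case ou : (owner u) => [v|]; case ow : (owner w) => [v'|].
  - have [vI vu bu] := ownerP _ _ ou; have [v'I vw bw] := ownerP _ _ ow.
    have [vv|vv] := eqVneq v v'; last first.
      by have [_] := spread vI v'I vv (near1 _ _ vu bu) (near1 _ _ vw bw); rewrite uw.
    subst v'; have c := pF vI uw.
    case hu : (hub v u) => [h|]; case hw : (hub v w) => [h'|] //; apply: contraNneq c => -[].
      by move=> hh; have [_ _ <-] := hubP _ _ _ hu; have [_ _ <-] := hubP _ _ _ hw; rewrite hh.
    by move=> ->.
  - have [vI vu bu] := ownerP _ _ ou; case hu : (hub v u) => [h|] //.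
    apply: contraNneq (pF vI uw) => -[hw]; have [_ _ <-] := hubP _ _ _ hu; by rewrite hw.
  - have [vI vu bu] := ownerP _ _ ow; case hu : (hub v' w) => [h|] //.
    apply: contraNneq (pF vI wu) => -[hw]; have [_ _ <-] := hubP _ _ _ hu; by rewrite hw.
  - by apply: contraTneq uw => -[->]; rewrite irr.
apply: (merged_coloring_seq eK M (phi := phi) (S := S)) => // v vI.
have [nc sz bs4] := blocks vI; have [us cs sE] := rotS vI; split=> //.
move=> b bb x y xb yb; have [s4|s4] := leqP (size (S v)) 4.
  by move: bb xb yb; rewrite bs4 // => /mapP[z _ ->]; rewrite !inE => /eqP -> /eqP ->.
have mem z : z \in b -> z \in S v.
  by move=> zb; rewrite -(perm_mem (noncrossing_perm nc)); apply/flattenP; exists b.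
have Ez z : z \in b -> E v (p (e z)).
  by move/mem=> zs; rewrite /E (rotation_nbr M (rotS vI)); apply: (map_f (fun x => p (e x))).
have dS : degree L p v = size (S v).
  by rewrite -(card_uniqP us); apply: eq_card => z; rewrite inE sE.
(* More than four neighbors leave room for at most one big neighbor in the bound 6. *)
have b1 : big_degree e L p K v <= 1.
  by have [_] := few vI; rewrite dS; move: s4; clear; lia.
have one h h' : E v h -> E v h' -> big L p K h -> big L p K h' -> h = h'.
  case/adjP=> z zL [zv zh] /adjP[z' z'L [z'v z'h]] bh bh'; rewrite -zh -z'h.
  congr (p (e _)); apply: (card_le1_eqP b1); rewrite !inE ?zL ?z'L ?zv ?z'v ?zh ?z'h eqxx //.
(* The two have the same color under [F v], so the hub of the small neighbor exists; it is the only
   big neighbor of [v]. *)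
have small_big z z' : z \in b -> z' \in b -> ~~ big L p K (p (e z)) -> big L p K (p (e z')) ->
    phi (p (e z)) = phi (p (e z')).
  move=> zb z'b bz bz'; rewrite /phi (ownerE v) ?Ez //.
  case o : (owner (p (e z'))) => [w|]; first by have [_ _] := ownerP _ _ o; rewrite bz'.
  rewrite /hub; case: pickP => [h /and3P[vh bh _]|/(_ (p (e z')))].
    by congr inl; apply: one => //; apply: Ez.
  by rewrite (cF vI bb zb z'b) Ez // bz' eqxx.
case: (boolP (big L p K (p (e x)))) => bx; case: (boolP (big L p K (p (e y)))) => by'.
- by rewrite (one (p (e x)) (p (e y))) ?Ez.
- by apply/esym/small_big.
- exact: small_big.
- by rewrite /phi !(ownerE v) ?Ez // /hub (cF vI bb xb yb).
Qed.

End Common.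

(** Bernoulli's inequality [B] gives [N ^ k >= 2 * N.-1 ^ k] for [k = N.-1], and five such factors
    yield [32 >= 20]. *)
Lemma power_growth N : 0 < N -> exists2 c, 0 < c & 20 * N.-1 ^ c <= N ^ c.
Proof.
case: N => // M _; case: M => [|M]; first by exists 1.
have B k : M.+1 ^ k * (M.+1 + k) <= M.+1 * M.+2 ^ k.
  elim: k => [|k IH]; first by rewrite !expn0 mul1n muln1 addn0.
  apply: (@leq_trans (M.+2 * (M.+1 ^ k * (M.+1 + k)))); last first.
    by rewrite (expnS M.+2) [X in _ <= X]mulnCA leq_mul2l IH.
  rewrite expnS; move: (M.+1 ^ k) => x; clear; nia.
have B2 : 2 * M.+1 ^ M.+1 <= M.+2 ^ M.+1.
  rewrite -(leq_pmul2l (ltn0Sn M)); apply: leq_trans (B M.+1).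
  by move: (M.+1 ^ M.+1) => x; rewrite addnn -mul2n [x * _]mulnCA mulnCA (mulnC x).
exists (M.+1 * 5); first by rewrite muln_gt0.
rewrite !expnM; apply: (@leq_trans ((2 * M.+1 ^ M.+1) ^ 5)); last by rewrite leq_exp2r.
by rewrite expnMn leq_mul2r; apply/orP; right.
Qed.

(** Since [20 * m ^ c <= w ^ c], the recursive term uses half of [C * w ^ c]. The other half is at
    least [C * w / 2 = 9 * C0 * w + 62 * w], which covers the remaining [9 * C0] and [62 * w]; this
    fixes the value of [C]. *)
Lemma polynomial_step N c C0 w m : 0 < c -> 20 * N.-1 ^ c <= N ^ c -> 0 < w -> 0 < N ->
  N * m <= N.-1 * w ->
  10 * ((18 * C0 + 124) * m ^ c + C0) + 62 * w <= (18 * C0 + 124) * w ^ c + C0.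
Proof.
move=> c0 gr w0 N0 le; set C := 18 * C0 + 124.
have h1 : 20 * m ^ c <= w ^ c.
  have Nc : 0 < N ^ c by rewrite expn_gt0 N0.
  rewrite -(leq_pmul2l Nc) mulnCA -!expnMn.
  apply: (@leq_trans (20 * (N.-1 * w) ^ c)); first by rewrite leq_mul2l leq_exp2r // le orbT.
  by rewrite !expnMn mulnA leq_mul2r gr orbT.
have h2 : w <= w ^ c by case: (c) c0 => // c' _; rewrite expnS leq_pmulr // expn_gt0 w0.
have h3 : C <= C * w by rewrite leq_pmulr.
have h4 : C * w <= C * w ^ c by rewrite leq_mul2l h2 orbT.
have h5 : 20 * (C * m ^ c) <= C * w ^ c by rewrite mulnCA leq_mul2l h1 orbT.
have h6 : C * w = 18 * C0 * w + 124 * w by rewrite mulnDl.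
have h7 : 18 * C0 <= 18 * C0 * w by rewrite leq_pmulr.
move: h4 h5 h6 h7; move: (C * m ^ c) (C * w ^ c) (C * w) (18 * C0 * w) => a b d f.
clear; lia.
Qed.

(* Two colorings reduced along two disjoint linear-size sets of vertices are both
   joined to a common coloring of the graph, so that the distance [t] satisfies
   [t(w) <= 10 t((1 - 1/N) w) + 62 w]. *)
Theorem reach_polynomial : exists C c C0, forall (V D : finType) (e n : {perm D}) L (p : D -> V),
  involutive e -> plane_map e n L p -> irreflexive (adj e L p) ->
  forall f g, proper_for (adj e L p) f -> proper_for (adj e L p) g ->
  reach (adj e L p) f g (fun _ => C * #|p @: L| ^ c + C0).
Proof.
have [K K84] : exists K, 84 <= K by exists 84.
(* [X] is the loss factor of [spread_vertices]. One half of the family has [h] vertices with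
   [w <= 3 * X * h], so [w - h] is at most the fraction [1 - 1/N] of [w]. *)
pose X := 12 * K ^ 3; pose N := (3 * X).+1.
have [c c0 gr] := power_growth (ltn0Sn (3 * X) : 0 < N).
(* A map with at most [X] vertices has measure at most [X.+1 ^ 3]. *)
have [C0 base] := reach_bounded (X.+1 ^ 3).+1.
pose C := 18 * C0 + 124.
exists C, c, C0 => V D e n L p eK.
have [k] := ubnP #|p @: L|; elim: k n L p => // k IH n0 L0 p lek M0 irr0 f g pf0 pg0.
have [n [L [M adjE sim pE]]] := map_simplify eK M0 irr0.
have irr : irreflexive (adj e L p) by move=> u; rewrite adjE.
have pf : proper_for (adj e L p) f by move=> u w; rewrite adjE; apply: pf0.
have pg : proper_for (adj e L p) g by move=> u w; rewrite adjE; apply: pg0.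
apply: (eq_reach adjE); rewrite -pE in lek *.
set w := #|p @: L| in lek *.
have [wX|Xw] := leqP w X.
  apply: reach_le (base V D e n L p eK M irr _ f g pf pg) _ => [|x]; last exact: leq_addl.
  rewrite ltnS /map_measure (support_adj M); apply: leq_trans (leq_subr _ _) _.
  by rewrite leq_exp2r.
have [I [uI szI HI spread]] := spread_vertices eK M irr sim K84.
have [S rot] : exists S : V -> seq D, forall v, rotation n L p v (S v).
  by have := @fin_all_exists V (fun _ => seq D) (rotation n L p) (fun v => rotation_exists v M).
have dS v : size (S v) = degree L p v.
  by have [us cs sE] := rot v; rewrite -(card_uniqP us); apply: eq_card => z; rewrite inE sE.
have irrI : {in I &, forall u v, ~~ adj e L p u v}.
  move=> u v uI' vI; have [->|uv] := eqVneq u v; first by rewrite irr.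
  have nr z : near e L p K z z by rewrite /near eqxx.
  by have [] := spread u v uI' vI uv u v (nr u) (nr v).
pose h := (size I)./2; pose Ia := take h I; pose Ib := drop h I.
have IE : I = Ia ++ Ib by rewrite cat_take_drop.
have [aI bI] : {subset Ia <= I} /\ {subset Ib <= I}.
  by split=> x xI; rewrite IE mem_cat xI ?orbT.
have Iw : size I <= w.
  rewrite -(card_uniqP uI) subset_leq_card //; apply/subsetP=> v /HI[d0 _ _].
  by case/card_gt0P: d0 => x; rewrite inE => /andP[xL /eqP <-]; apply: imset_f.
have sza : size Ia = h by rewrite size_takel // /h; clear; lia.
have szb : h <= size Ib by rewrite size_drop /h; clear; lia.
have szb2 : size Ib <= w by apply: leq_trans Iw; rewrite size_drop leq_subr.
(* [X < w <= X * size I] forces at least two vertices in [I], and then rounding down the half leaves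
   at least a third. *)
have h3 : size I <= 3 * h.
  have : 1 < size I.
    rewrite -(@ltn_pmul2l X) ?muln1; first exact: leq_trans szI.
    by rewrite /X muln_gt0 expn_gt0; move: K84; clear; lia.
  by rewrite /h; clear; lia.
have wN : w <= 3 * X * h.
  by apply: leq_trans szI _; rewrite -/X (mulnC 3) -mulnA leq_mul2l h3 orbT.
have hw : h <= w by rewrite -sza; apply: leq_trans Iw; rewrite sza /h; clear; lia.
have h0 : 0 < h by case: (h) wN => //; rewrite muln0 leqn0 => /eqP w0; rewrite w0 in Xw.
pose T := C * (w - h) ^ c + C0.
have HT n' L' (p' : D -> V) : plane_map e n' L' p' -> irreflexive (adj e L' p') ->
    #|p' @: L'| + h <= w -> forall f g, proper_for (adj e L' p') f ->
    proper_for (adj e L' p') g -> reach (adj e L' p') f g (fun _ => T).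
  move=> M' irr' le f1 g1 pf1 pg1.
  have lt : #|p' @: L'| < w by move: le h0; clear; lia.
  have R := IH n' L' p' (leq_trans lt lek) M' irr' f1 g1 pf1 pg1.
  apply: reach_le R _ => x; rewrite /T leq_add2r leq_mul2l leq_exp2r //; apply/orP; right; move: le; clear; lia.
have part I' f1 : {subset I' <= I} -> uniq I' -> h <= size I' -> size I' <= w ->
   proper_for (adj e L p) f1 -> exists B (f' : {ffun V -> 'I_5}), [/\ {in I', forall u, blocks_of (S u) (B u)},
    proper_for (adj e L p) f', {in I', forall u, constant_on e p (B u) f'}
  & forall g1, proper_for (adj e L p) g1 -> {in I', forall u, constant_on e p (B u) g1} ->
    reach (adj e L p) f1 g1 (fun x => 5 * T + 31 * w)].
  move=> sI uI' hI' I'w pf1.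
  have [|||B [f' [h1 h2 h3' h4]]] := reduce_seq (T := T) (I := I') (S := S) eK M pf1 uI'.
  - by move=> u v /sI uI1 /sI vI1; apply: irrI.
  - move=> u /sI/HI[d0 _ d6]; split; rewrite ?dS //; apply: leq_trans d6; exact: leq_addr.
  - move=> n' L' p' M' irr' le; apply: HT M' irr' _.
    by apply: leq_trans le; rewrite leq_add2l.
  exists B, f'; split=> // g1 pg1 cg1; apply: reach_le (h4 g1 pg1 cg1) _ => x /=.
  have w0 : 0 < w by apply: leq_trans Xw.
  have ar1 a b s : s <= b -> 0 < b -> 5 * (a + 6 * s) + 1 <= 5 * a + 31 * b by clear; lia.
  have ar2 a b s : s <= b -> a + 6 * s <= 5 * a + 31 * b by clear; lia.
  by case: ifP => _; [apply: ar1 | apply: ar2].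
have [Ba [fa [bla pfa cfa Ra]]] := part Ia f aI (take_uniq _ uI) (eq_leq (esym sza)) (leq_trans (eq_leq sza) hw) pf.
have [Bb [fb [blb pfb cfb Rb]]] := part Ib g bI (drop_uniq _ uI) szb szb2 pg.
have disj x : x \in Ib -> x \in Ia = false.
  move=> xb; apply/negP=> xa; move: uI; rewrite IE cat_uniq => /and3P[_ /hasPn/(_ x xb)/negP nx _]; exact: nx.
have split_in (P : V -> bool -> Prop) : {in Ia, forall v, P v true} -> {in Ib, forall v, P v false} ->
    {in I, forall v, P v (v \in Ia)}.
  move=> Pa Pb v vI; have [va|va] := boolP (v \in Ia); first exact: Pa.
  by apply: Pb; move: vI; rewrite IE mem_cat (negbTE va).
(* [f] dictates the blocks on [Ia] and [g] those on [Ib]. The common coloring respects both, so it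
   is a valid target for either reduction. *)
have [h1 ph1 ch1] := @common_coloring V D e eK n L p K I S
  (fun v => if v \in Ia then Ba v else Bb v) (fun v => if v \in Ia then fa else fb) M
  irr uI (fun v vI => let: And3 _ b1 b2 := HI v vI in conj b1 b2) spread (fun v _ => rot v)
  (split_in (fun v b => blocks_of (S v) (if b then Ba v else Bb v)) bla blb)
  (split_in (fun v b => proper_for (adj e L p) (if b then fa else fb)) (fun v _ => pfa) (fun v _ => pfb))
  (split_in (fun v b => constant_on e p (if b then Ba v else Bb v) (if b then fa else fb)) cfa cfb).
have R1 : reach (adj e L p) f h1 (fun x => 5 * T + 31 * w).
  by apply: Ra => // u ua; have := ch1 u (aI u ua); rewrite ua.
have R2 : reach (adj e L p) g h1 (fun x => 5 * T + 31 * w).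
  by apply: Rb => // u ub; have := ch1 u (bI u ub); rewrite (disj u ub).
apply: reach_le (reach_trans R1 (reach_sym R2)) _ => x.
have w0 : 0 < w by apply: leq_trans Xw.
have le : N * (w - h) <= N.-1 * w.
  rewrite /N mulnBr leq_subLR mulSn mulSn leq_add2r.
  exact: leq_trans wN (leq_addl _ _).
have := polynomial_step C0 c0 gr w0 (ltn0Sn _ : 0 < N) le; rewrite -/C -/T.
suff ar t a b : 10 * t + 62 * a <= b -> 5 * t + 31 * a + (5 * t + 31 * a) <= b by apply: ar.
by clear; lia.
Qed.

(** * From drawings to combinatorial maps *)

Lemma connect_ind (T : finType) (r : rel T) x (P : pred T) : P x ->
  (forall u w, P u -> r u w -> P w) -> forall y, connect r x y -> P y.
Proof.
move=> Px Pr y /connectP[s]; elim: s x Px => [x Px _ -> //|z s IH x Px] /=.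
by case/andP=> xz ps ls; apply: (IH z) => //; apply: Pr xz.
Qed.

Definition rel_on (T : finType) (r : rel T) (A : pred T) : rel T :=
  fun x y => [&& A x, A y & r x y].

Lemma porbit_trans (D : finType) (s : {perm D}) x y z :
  y \in porbit s x -> z \in porbit s y -> z \in porbit s x.
Proof. by rewrite -eq_porbit_mem => /eqP ->. Qed.

(** * Minors of planar maps *)

Section Minor.
Variables (D T V : finType) (e n : {perm D}) (q : D -> T) (phi : T -> option V) (E : rel V) (v0 : V).
Hypothesis eK : involutive e.
Hypothesis pl : planar_perm e n.
Hypothesis orb : forall x y, (q x == q y) = (y \in porbit n x).
Hypothesis sE : symmetric E.
Hypothesis irr : irreflexive E.
Let g : rel T := fun c c' => [exists d, (q d == c) && (q (e d) == c')].
Hypothesis conn : forall v c c', phi c = Some v -> phi c' = Some v ->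
  connect (rel_on g (fun c => phi c == Some v)) c c'.
Hypothesis edge : forall x y, E x y -> exists2 d, phi (q d) = Some x & phi (q (e d)) = Some y.

(* The minor obtained by contracting the classes of the partial labelling [phi]. *)
Lemma minor_map : exists n' (L : {set D}) (p : D -> V), plane_map e n' L p /\ adj e L p =2 E.
Proof.
pose X := [seq d <- enum D | (phi (q d) != None) && (phi (q (e d)) == phi (q d))].
have [n1 [pl1 H1 H2 H3 _]] := contract_edges X pl.
have inX d : (d \in X) = (phi (q d) != None) && (phi (q (e d)) == phi (q d)).
  by rewrite mem_filter mem_enum andbT.
have qn d : q (n d) = q d by apply/esym/eqP; rewrite orb mem_porbit1.
have inv d : phi (q (n1 d)) = phi (q d).
  apply: (H3 _ (fun d => phi (q d))) => [x|x]; first by rewrite qn.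
  by rewrite inX => /andP[_ /eqP].
have join v d1 d2 : phi (q d1) = Some v -> phi (q d2) = Some v -> d2 \in porbit n1 d1.
  move=> h1 h2; have := conn h1 h2.
  move/(@connect_ind _ _ _ (fun c => [forall d, (q d == c) ==> (d \in porbit n1 d1)])).
  move=> H; have {}H := H _ _; apply: (implyP (forallP (H _ _) d2)) => //.
    by apply/forallP=> d; apply/implyP; rewrite eq_sym orb => /H1.
  move=> u w /forallP hu /and3P[pu pw /existsP[d /andP[/eqP qd /eqP qed]]].
  apply/forallP=> d'; apply/implyP; rewrite -qed eq_sym orb => /H1; apply: porbit_trans.
  apply: porbit_trans (implyP (hu d) _) (H2 d _); first exact/eqP.
  by rewrite inX qd qed (eqP pu) (eqP pw) eqxx.
pose p d := odflt v0 (phi (q d)).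
pose lt (u w : V) := enum_rank u < enum_rank w.
have ltN (u w : V) : u != w -> lt w u = ~~ lt u w.
  move=> uw; rewrite /lt; case: ltngtP => // /val_inj/enum_rank_inj wu.
  by rewrite wu eqxx in uw.
pose c u w := [pick d | (phi (q d) == Some u) && (phi (q (e d)) == Some w)].
have cP u w : E u w -> exists d, [/\ c u w = Some d, phi (q d) = Some u & phi (q (e d)) = Some w].
  move=> /edge[d h1 h2]; rewrite /c; case: pickP => [d' /andP[/eqP h /eqP h']|/(_ d)].
    by exists d'.
  by rewrite h1 h2 !eqxx.
pose L := [set d | [&& phi (q d) == Some (p d), phi (q (e d)) == Some (p (e d)),
  E (p d) (p (e d)) & if lt (p d) (p (e d)) then c (p d) (p (e d)) == Some d
                      else c (p (e d)) (p d) == Some (e d)]].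
have neq u w : E u w -> u != w by apply: contraTneq => ->; rewrite irr.
have eL : {in L, forall d, e d \in L}.
  move=> d; rewrite !inE eK => /and4P[-> -> h]; have -> : E (p (e d)) (p d) by rewrite sE.
  by rewrite (ltN _ _ (neq _ _ h)) ?eK; case: (lt _ _).
have [n2 [pl2 K1 K2 _]] := isolate_darts (enum (~: L)) pl1.
exists n2, L, p; split; first split=> //.
- move=> d1 d2 l1 l2; rewrite K2; try by rewrite inE mem_enum inE negbK.
  have livep d : d \in L -> phi (q d) = Some (p d) by rewrite inE => /andP[/eqP].
  have [h1 h2] := (livep _ l1, livep _ l2); apply/eqP/idP=> [h|].
    by apply: join h1 _; rewrite h2 h.
  move/(@porbit_ind _ n1 d1 (fun d => phi (q d) == phi (q d1))) => H.
  have : phi (q d2) == phi (q d1) by apply: H => // u; rewrite inv.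
  by rewrite h1 h2 => /eqP[].
- by move=> x xL; apply: K1; rewrite mem_enum inE.
move=> u w; apply/adjP/idP=> [[d dL [<- <-]]|uw]; first by move: dL; rewrite inE => /and4P[].
have [luw|luw] := boolP (lt u w).
  have [d [cd h1 h2]] := cP _ _ uw; exists d; last by rewrite /p h1 h2.
  by rewrite inE /p h1 h2 /= !eqxx uw luw cd eqxx.
have [|d [cd h1 h2]] := cP w u; first by rewrite sE.
exists (e d); last by rewrite eK /p h1 h2.
by rewrite inE /p eK h1 h2 /= !eqxx uw (negbTE luw) cd eqxx.
Qed.

End Minor.

Section BranchSets.
Variables (T V : finType) (g : rel T) (o : rel V) (C : V -> {set T}) (W : V -> V -> {set T}).
Hypothesis sg : symmetric g.
Hypothesis irr_o : irreflexive o.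
Let connected (A : {set T}) := {in A &, forall x y, connect (rel_on g (mem A)) x y}.
Hypothesis cC : forall x, connected (C x).
Hypothesis dC : forall x y c, c \in C x -> c \in C y -> x = y.
Hypothesis cW : forall x y, o x y -> connected (W x y).
Hypothesis Wx : forall x y, o x y -> exists2 c, c \in W x y & c \in C x.
Hypothesis Wy : forall x y, o x y -> exists2 c, c \in W x y & c \in C y.
Hypothesis WC : forall x y z c, o x y -> c \in W x y -> c \in C z -> z = x \/ z = y.
Hypothesis WW : forall x y x' y' c, o x y -> o x' y' -> c \in W x y -> c \in W x' y' -> y = y'.

(* The branch set of [y] consists of [C y] and of the final segments of the [W x y]. *)
Lemma branch_sets : exists phi : T -> option V,
  (forall v c c', phi c = Some v -> phi c' = Some v ->
     connect (rel_on g (fun c => phi c == Some v)) c c') /\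
  (forall x y, o x y -> exists c c', [/\ g c c', phi c = Some x & phi c' = Some y]).
Proof.
(* Cells of [W x y] in no branch core are offered to [y]; [B y] keeps those connected to [C y]
   within the offered cells, which makes it connected. *)
pose A y c := (c \in C y) || [exists x, o x y && (c \in W x y)] && [forall z, c \notin C z].
pose B y c := [exists c0 in C y, connect (rel_on g (A y)) c0 c].
have BA y c : B y c -> A y c.
  case/existsP=> c0 /andP[c0C]; apply: connect_ind; first by rewrite /A c0C.
  by move=> u w _ /and3P[].
have BC y c : B y c -> c \in C y \/ (exists x, o x y /\ c \in W x y) /\ forall z, c \notin C z.
  by move/BA/orP=> [|/andP[/existsP[x /andP[? ?]] /forallP h]]; [left | right; split=> //; exists x].
have Bdis y z c : B y c -> B z c -> y = z.
  move=> /BC[cy|[[x [xy cx]] nc]] /BC[cz|[[x' [xz cx']] nc']].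
  - exact: dC cy cz.
  - by have := nc' y; rewrite cy.
  - by have := nc z; rewrite cz.
  - exact: WW xy xz cx cx'.
have CB y c : c \in C y -> B y c by move=> cy; apply/existsP; exists c; rewrite cy connect0.
pose phi c := [pick y | B y c].
have phiE y c : (phi c == Some y) = B y c.
  rewrite /phi; case: pickP => [z Bz|/(_ y) ->] //; apply/eqP/idP=> [[<-]//|By].
  by rewrite (Bdis _ _ _ By Bz).
have phiP y c : phi c = Some y <-> B y c by rewrite -phiE; split=> [->|/eqP].
exists phi; split=> [v c c'|x y xy].
  move=> /phiP Bc /phiP Bc'.
  have sr : connect_sym (rel_on g (fun c => phi c == Some v)).
    by apply: sym_connect_sym => u w; rewrite /rel_on sg andbCA.
  have root d : B v d -> exists2 c0, c0 \in C v & connect (rel_on g (fun c => phi c == Some v)) c0 d.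
    case/existsP=> c0 /andP[c0C c0d]; exists c0 => //.
    have /andP[//] : B v d && connect (rel_on g (fun c => phi c == Some v)) c0 d.
    apply: (@connect_ind _ _ c0 (fun d => B v d && connect (rel_on g (fun c => phi c == Some v)) c0 d)) c0d.
      by rewrite CB ?connect0.
    move=> u w /andP[Bu cu] uw; have Bw : B v w.
      case/existsP: Bu => c1 /andP[c1C c1u]; apply/existsP; exists c1; rewrite c1C.
      exact: connect_trans c1u (connect1 uw).
    rewrite Bw; apply: connect_trans cu (connect1 _).
    by rewrite /rel_on !phiE Bu Bw; case/and3P: uw.
  have [c0 c0C c0c] := root c Bc; have [c1 c1C c1c] := root c' Bc'.
  apply: connect_trans (_ : connect _ c c0) _; first by rewrite sr.
  apply: connect_trans c1c; have := cC c0C c1C; apply: connect_sub => u w /and3P[uC wC uw].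
  by apply: connect1; rewrite /rel_on !phiE !CB.
have [a aW aC] := Wx xy; have [b bW bC] := Wy xy.
have ba := cW xy bW aW.
(* The set [W x y] is walked from [C y] towards [C x]. Unless a step leads from [B y] into [B x],
   the walk never leaves [B y], and it would end in a cell of both [C x] and [B y]. *)
have [//|no] := boolP [exists c, exists c', [&& g c c', B x c & B y c']].
  by case/existsP=> c /existsP[c' /and3P[h1 h2 h3]]; exists c, c'; split=> //; apply/phiP.
have : B y a.
  apply: (@connect_ind _ _ b (B y)) ba; first exact: CB.
  move=> u w Bu /and3P[uW wW uw]; have [/existsP[z wz]|/existsPn nC] := boolP [exists z, w \in C z].
    have [zx|zy] := WC xy wW wz; last by rewrite CB // -zy.
    case/negP: no; apply/existsP; exists w; apply/existsP; exists u.
    by rewrite sg uw Bu CB // -zx.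
  have Aw : A y w.
    by rewrite /A; apply/orP; right; apply/andP; split; [apply/existsP; exists x; rewrite xy | apply/forallP].
  have Au := BA _ _ Bu; case/existsP: Bu => c1 /andP[c1C c1u]; apply/existsP; exists c1; rewrite c1C.
  by apply: connect_trans c1u (connect1 _); rewrite /rel_on uw Aw Au.
by move/(Bdis _ _ _ (CB _ _ aC)) => xy'; move: xy; rewrite xy' irr_o.
Qed.
End BranchSets.

(** [planar_perm] needs only lower bounds on numbers of orbits, so it is enough to exhibit an
    invariant with many values. *)
Lemma card_porbits_ge (D T : finType) (U : eqType) (s : {perm D}) (inv : D -> U) (d : T -> D) :
  (forall x, inv (s x) = inv x) -> injective (inv \o d) -> #|T| <= #|porbits s|.
Proof.
move=> Hinv inj; have inj2 : injective (fun t => porbit s (d t)).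
  move=> t t' /eqP; rewrite eq_porbit_mem porbit_sym => h; apply: inj => /=; apply/esym/eqP.
  apply: (@porbit_ind _ s (d t) (fun x => inv x == inv (d t))) h => // u; by rewrite Hinv.
rewrite -(card_codom inj2) subset_leq_card //; apply/subsetP=> _ /codomP[t ->].
exact: imset_f.
Qed.

(** * The grid as a planar map *)

Section Grid.
Variable M : nat.
Notation cell := ('I_M.+1 * 'I_M.+1)%type.
Notation dart := (cell * (bool * bool))%type.

Definition grid_move (s : bool) (i : 'I_M.+1) : 'I_M.+1 :=
  inord (if s then minn i.+1 M else i.-1).

Lemma val_grid_move s i : grid_move s i = (if s then minn i.+1 M else i.-1) :> nat.
Proof. by rewrite inordK //; case: s; have := ltn_ord i; lia. Qed.

Lemma grid_moveE s i : (grid_move s i == i) = if s then i == M :> nat else i == 0 :> nat.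
Proof. by rewrite -val_eqE /= val_grid_move; case: s; have := ltn_ord i; lia. Qed.

(* A dart is a cell with a direction: the first boolean tells the axis, the second
   one the sense.  A dart leaving the grid is its own reverse. *)
Definition grid_flip (x : dart) : dart :=
  let: ((i, j), (a, s)) := x in
  if a then (if grid_move s j == j then x else ((i, grid_move s j), (a, ~~ s)))
  else (if grid_move s i == i then x else ((grid_move s i, j), (a, ~~ s))).

Definition grid_turn (x : dart) : dart :=
  let: (c, (a, s)) := x in (c, (~~ a, if a then ~~ s else s)).

Lemma grid_moveK s i : grid_move s i != i -> grid_move (~~ s) (grid_move s i) = i.
Proof.
rewrite grid_moveE => h; apply: val_inj; rewrite /= !val_grid_move.
by case: s h => /=; have := ltn_ord i; lia.
Qed.

Lemma grid_flipK : involutive grid_flip.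
Proof.
move=> [[i j] [[] s]] /=; case: ifP => h /=; rewrite ?h // negbK grid_moveK ?h //.
all: by rewrite eq_sym h.
Qed.

Lemma grid_turn_inj : injective grid_turn.
Proof. by move=> [c [[] []]] [c' [[] []]] [] // ->. Qed.

Definition grid_reverse : {perm dart} := perm (inv_inj grid_flipK).
Definition grid_rotate : {perm dart} := perm grid_turn_inj.

Lemma grid_reverseK : involutive grid_reverse.
Proof. by move=> x; rewrite !permE grid_flipK. Qed.

Lemma grid_rotate_orbit x y : (x.1 == y.1) = (y \in porbit grid_rotate x).
Proof.
apply/eqP/idP=> [|h]; last first.
  apply/esym/eqP; apply: (@porbit_ind _ grid_rotate x (fun y => y.1 == x.1)) h => //.
  by move=> [c [a s]]; rewrite permE.
case: x y => c [a s] [c' [a' s']] /= <-.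
have st z : z \in porbit grid_rotate (c, (a, s)) -> grid_turn z \in porbit grid_rotate (c, (a, s)).
  by rewrite -{1}(porbit_step grid_rotate) permE.
have h0 := porbit_id grid_rotate (c, (a, s)); have h1 := st _ h0; have h2 := st _ h1; have h3 := st _ h2.
by case: a s a' s' st h0 h1 h2 h3 => [] [] [] [].
Qed.

Definition square (u v : nat) : option (nat * nat) :=
  if (0 < u <= M) && (0 < v <= M) then Some (u, v) else None.

(** The unit square at the corner of the dart, named by its corner with the largest coordinates;
    [None] stands for the outer face. *)
Definition grid_face (x : dart) :=
  let: ((i, j), (a, s)) := x in square (i + (a (+) s)) (j + s).

Lemma grid_faceE x : grid_face ((grid_rotate * grid_reverse)%g x) = grid_face x.
Proof.
rewrite permM !permE; case: x => [[i j] [a s]] /=.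
have Hi := ltn_ord i; have Hj := ltn_ord j.
have out u v u' v' : ~~ ((0 < u <= M) && (0 < v <= M)) -> ~~ ((0 < u' <= M) && (0 < v' <= M)) ->
  square u v = square u' v' by rewrite /square => /negbTE -> /negbTE ->.
have out_eq u v u' v' : u = u' -> v = v' -> square u v = square u' v' by move=> -> ->.
case: a; case: s => /=; rewrite grid_moveE /=; case: ifP => h /=; rewrite ?val_grid_move;
  by [apply: out_eq; lia | apply: out; lia].
Qed.

(** An edge is named by its larger coordinate along its axis; the values 0 and [M.+1] are the
    half-edges leaving the grid. *)
Definition grid_edge (x : dart) : bool * (nat * nat) :=
  let: ((i, j), (a, s)) := x in (a, if a then (j + s, i : nat) else (i + s, j : nat)).

Lemma grid_edgeE x : grid_edge (grid_reverse x) = grid_edge x.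
Proof.
rewrite permE; case: x => [[i j] [a s]] /=.
have Hi := ltn_ord i; have Hj := ltn_ord j.
case: a; case: ifP => //; rewrite grid_moveE => h /=; rewrite val_grid_move;
  by congr (_, (_, _)); case: s h => /=; lia.
Qed.

Lemma grid_connected x y : comp grid_reverse grid_rotate x y.
Proof.
pose z : dart := ((ord0, ord0), (false, false)).
suff H u : comp grid_reverse grid_rotate u z by apply: connect_trans (H x) _; rewrite -/(comp _ _ _ _) comp_sym.
have turn c k k' : comp grid_reverse grid_rotate (c, k) (c, k') by apply: comp_rot; rewrite -grid_rotate_orbit.
case: u => [[i j] k].
have step1 (i0 j0 : 'I_M.+1) : 0 < i0 -> exists i1 : 'I_M.+1, i1 = i0.-1 :> nat /\
    comp grid_reverse grid_rotate ((i0, j0), k) ((i1, j0), k).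
  move=> i0p; exists (grid_move false i0); split; first exact: val_grid_move.
  apply: connect_trans (turn _ k (false, false)) _.
  apply: connect_trans (comp_e _ _ _) _; rewrite permE /= grid_moveE /= eqn0Ngt i0p.
  exact: turn.
have step2 (i0 j0 : 'I_M.+1) : 0 < j0 -> exists j1 : 'I_M.+1, j1 = j0.-1 :> nat /\
    comp grid_reverse grid_rotate ((i0, j0), k) ((i0, j1), k).
  move=> i0p; exists (grid_move false j0); split; first exact: val_grid_move.
  apply: connect_trans (turn _ k (true, false)) _.
  apply: connect_trans (comp_e _ _ _) _; rewrite permE /= grid_moveE /= eqn0Ngt i0p.
  exact: turn.
have [m] := ubnP (i + j); elim: m i j => // m IH i j lem.
have [i0|i0] := posnP i; last first.
  have [i1 [vi1 c]] := step1 i j i0; apply: connect_trans c (IH _ _ _); rewrite vi1.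
  by move: lem i0; clear; lia.
have [j0|j0] := posnP j; last first.
  have [j1 [vj1 c]] := step2 i j j0; apply: connect_trans c (IH _ _ _); rewrite vj1.
  by move: lem j0; clear; lia.
have -> : i = ord0 by apply: val_inj.
have -> : j = ord0 by apply: val_inj.
exact: turn.
Qed.

(** The invariants give at least [(M+1)^2] vertices, [2(M+1)(M+2)] edges with the half-edges
    included, and [M^2 + 1] faces; the total is [4(M+1)^2 + 2], the number of darts plus twice the
    single component. *)
Lemma grid_planar : planar_perm grid_reverse grid_rotate.
Proof.
have nc : ncomp grid_reverse grid_rotate <= 1.
  apply: (@leq_trans #|[set [set: dart]]|); last by rewrite cards1.
  apply: subset_leq_card; apply/subsetP=> _ /imsetP[x _ ->]; rewrite inE; apply/eqP/setP=> y.
  by rewrite !inE grid_connected.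
have hn : #|{: cell}| <= #|porbits grid_rotate|.
  apply: (@card_porbits_ge _ _ _ grid_rotate fst (fun c : cell => (c, (false, false)))) => [x|c c' //].
  by case: x => [c [a s]]; rewrite permE.
have he : #|{: bool * ('I_M.+2 * 'I_M.+1)}| <= #|porbits grid_reverse|.
  pose coord (u : 'I_M.+2) : 'I_M.+1 := inord u.-1.
  have vc u : coord u + (0 < u) = u.
    by rewrite /coord inordK; have := ltn_ord u; lia.
  apply: (@card_porbits_ge _ _ _ grid_reverse grid_edge (fun t => let: (a, (u, j)) := t in
    if a then ((j, coord u), (a, 0 < u)) else ((coord u, j), (a, 0 < u)))).
    exact: grid_edgeE.
  move=> [a [u j]] [a' [u' j']] /=; case: a; case: a' => //= -[] /=; rewrite !vc;
    by move=> h1 h2; congr (_, (_, _)); apply: val_inj.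
have hF : #|{: option ('I_M * 'I_M)}| <= #|porbits (grid_rotate * grid_reverse)%g|.
  have lt (u : 'I_M) : u < M.+1 by apply: ltnW; rewrite ltnS.
  apply: (@card_porbits_ge _ _ _ (grid_rotate * grid_reverse)%g grid_face (fun t => if t is Some (u, v) then
    ((Ordinal (lt u), Ordinal (lt v)), (false, true)) else ((ord0, ord0), (false, false)))).
    exact: grid_faceE.
  have S (u v : 'I_M) : square (u + 1) (v + 1) = Some (u.+1, v.+1).
    by rewrite /square !addn1 /= !ltn_ord.
  move=> [[u v]|] [[u' v']|] //=; rewrite ?S //.
  by case=> h1 h2; congr (Some (_, _)); apply: val_inj.
rewrite /planar_perm.
move: hn he hF nc; rewrite card_option !card_prod !card_ord card_bool.
move: #|porbits grid_rotate| #|porbits grid_reverse| #|porbits (grid_rotate * grid_reverse)%g|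
  (ncomp grid_reverse grid_rotate) => a b c d.
clear; nia.
Qed.

Definition grid_adj (c c' : cell) :=
  (c.1 == c'.1) && ((c.2.+1 == c'.2 :> nat) || (c'.2.+1 == c.2 :> nat))
  || (c.2 == c'.2) && ((c.1.+1 == c'.1 :> nat) || (c'.1.+1 == c.1 :> nat)).

Lemma grid_adj_sym : symmetric grid_adj.
Proof.
by move=> c c'; rewrite /grid_adj (eq_sym c.1) (eq_sym c.2); congr (_ && _ || _ && _); rewrite orbC.
Qed.

Lemma grid_adj_dart c c' : grid_adj c c' -> exists d : dart, d.1 = c /\ (grid_reverse d).1 = c'.
Proof.
case: c c' => i j [i' j'] /orP[] /andP[/= /eqP -> h]; [exists ((i', j), (true, j < j')) | exists ((i, j'), (false, i < i'))].
  split=> //; rewrite permE /= grid_moveE; have Hj := ltn_ord j; have Hj' := ltn_ord j'.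
  have -> : (if j < j' then j == M :> nat else j == 0 :> nat) = false by case: ifP; move: h; lia.
  by congr (_, _); apply: val_inj; rewrite /= val_grid_move; case: ifP; move: h; lia.
split=> //; rewrite permE /= grid_moveE; have Hj := ltn_ord i; have Hj' := ltn_ord i'.
have -> : (if i < i' then i == M :> nat else i == 0 :> nat) = false by case: ifP; move: h; lia.
by congr (_, _); apply: val_inj; rewrite /= val_grid_move; case: ifP; move: h; lia.
Qed.

End Grid.

Lemma grid_minor M (V : finType) (E o : rel V) (v0 : V) (C : V -> {set 'I_M.+1 * 'I_M.+1})
    (W : V -> V -> {set 'I_M.+1 * 'I_M.+1}) :
  let conn A := {in A &, forall x y, connect (rel_on (@grid_adj M) (mem A)) x y} in
  symmetric E -> irreflexive E -> subrel o E -> (forall x y, E x y -> o x y || o y x) ->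
  (forall x, conn (C x)) -> (forall x y c, c \in C x -> c \in C y -> x = y) ->
  (forall x y, o x y -> conn (W x y)) ->
  (forall x y, o x y -> exists2 c, c \in W x y & c \in C x) ->
  (forall x y, o x y -> exists2 c, c \in W x y & c \in C y) ->
  (forall x y z c, o x y -> c \in W x y -> c \in C z -> z = x \/ z = y) ->
  (forall x y x' y' c, o x y -> o x' y' -> c \in W x y -> c \in W x' y' -> y = y') ->
  exists (D : finType) (e n : {perm D}) (L : {set D}) (p : D -> V),
    [/\ involutive e, plane_map e n L p & adj e L p =2 E].
Proof.
move=> conn sE irr oE Eo cC dC cW Wx Wy WC WW.
have irro : irreflexive o by move=> x; apply/negbTE/negP=> /oE; rewrite irr.
have [phi [phic phie]] := branch_sets (@grid_adj_sym M) irro cC dC cW Wx Wy WC WW.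
have := @minor_map _ _ V (grid_reverse M) (grid_rotate M) fst phi E v0 (@grid_reverseK M) (grid_planar M)
  (@grid_rotate_orbit M) sE irr.
case=> [v c c' h1 h2|x y xy|n' [L [p [Mp EE]]]]; last by exists _, (grid_reverse M), n', L, p; split=> //; apply: grid_reverseK.
  apply: connect_sub (phic v c c' h1 h2) => a b /and3P[ha hb /grid_adj_dart[d [da db]]].
  apply: connect1; rewrite /rel_on ha hb /=; apply/existsP; exists d; by rewrite da db !eqxx.
case/orP: (Eo x y xy) => /phie[c [c' [/grid_adj_dart[d [da db]] h1 h2]]].
  by exists d; rewrite ?da ?db.
by exists (grid_reverse M d); rewrite ?grid_reverseK ?da ?db.
Qed.

(** * From recolorings to paths of K-changes *)

Section KempePaths.
Variable G : sgraph.
Notation kgraph := (kempe_graph G 5).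

Lemma kempe_chain_exists (f : {ffun G -> 'I_5}) a b S x : swappable (@sedge G) f a b S -> x \in S ->
  exists B, [/\ kempe_chain f a b B, x \in B & B \subset S].
Proof.
move=> sw xS; have [fx _] := sw x xS.
have [|B mB] := @maxset_exists _ (fun B => connected_in B && bicolored f a b B) [set x].
  apply/andP; split; last by apply/forall_inP => u /set1P ->; move: fx; rewrite !inE.
  apply/andP; split; first by apply/set0Pn; exists x; rewrite inE.
  by apply/forall_inP => u /set1P ->; apply/forall_inP => w /set1P ->; apply: connect0.
rewrite sub1set => xB; exists B; split=> //.
have /andP[/andP[_ /forall_inP/(_ x xB)/forall_inP cB] /forall_inP bB] := maxsetp mB.
apply/subsetP=> y /cB; apply: connect_ind => // u w uS /and3P[uB wB uw].
by have [_ cl] := sw u uS; apply: cl uw _; rewrite !inE; apply: bB.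
Qed.

(** The set [S] is a union of chains, swapped one at a time; each chain uses up at least one vertex
    of [S], and the rest of [S] is still swappable afterwards. *)
Lemma swap_path (alpha : kgraph) a b S : a != b -> swappable (@sedge G) (val alpha) a b S ->
  exists p, [/\ path (@sedge kgraph) alpha p, val (last alpha p) = swap_colors a b S (val alpha)
              & size p <= #|S|].
Proof.
move=> ab; have [m] := ubnP #|S|; elim: m S alpha => // m IH S alpha leS sw.
have [S0|[x xS]] := set_0Vmem S.
  exists [::]; split=> //; apply/ffunP=> u; by rewrite ffunE S0 inE.
have [B [cB xB BS]] := kempe_chain_exists sw xS.
pose f1 := kempe_swap (val alpha) a b B.
pose alpha1 : kgraph := exist _ f1 (kempe_swap_proper (valP alpha) cB).
have step : @sedge kgraph alpha alpha1.
  apply/existsP; exists a; apply/existsP; exists b; apply/existsP; exists B.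
  by rewrite ab cB /=.
have mem u : (f1 u \in [:: a; b]) = (val alpha u \in [:: a; b]).
  by rewrite /f1 ffunE; case: ifP => // _; apply: mem_swap.
have sw1 : swappable (@sedge G) (val alpha1) a b (S :\: B).
  move=> u; rewrite inE => /andP[uB uS]; have [fu cl] := sw u uS.
  rewrite [val alpha1]/= mem; split=> // w uw; rewrite mem => fw; rewrite inE (cl w uw fw) andbT.
  apply: contra uB => wB; apply: (kempe_chain_closed cB wB); first by rewrite sg_sym.
  by move: fu; rewrite !inE.
have lt : #|S :\: B| < #|S|.
  by apply: proper_card; apply/properP; split; [apply: subsetDl | exists x; rewrite // inE xB].
have [p [pp lp sp]] := IH (S :\: B) alpha1 (leq_trans lt leS) sw1.
exists (alpha1 :: p); split; first exact/andP.
  rewrite [last _ _]/= lp; apply/ffunP=> u; rewrite !ffunE inE; case: (boolP (u \in B)) => uB //=.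
  by rewrite (subsetP BS u uB).
exact: leq_ltn_trans sp lt.
Qed.

(** A swap on [S] costs at most [#|S|] K-changes, so summing the individual counts over all vertices
    bounds the length. *)
Lemma reach_path (f g : {ffun G -> 'I_5}) t : reach (@sedge G) f g t ->
  forall alpha : kgraph, val alpha = f ->
  exists p, [/\ path (@sedge kgraph) alpha p, val (last alpha p) = g & size p <= \sum_x t x].
Proof.
elim=> {f g t} [f t|a b S f g t t' ab sw _ IH le] alpha af; first by exists [::].
rewrite -af in sw; have [p [pp lp sp]] := swap_path ab sw.
have [|q [pq lq sq]] := IH (last alpha p); first by rewrite lp af.
exists (p ++ q); split; first by rewrite cat_path pp.
  by rewrite last_cat.
rewrite size_cat; apply: leq_trans (leq_add sp sq) _.
rewrite -sum1_card big_mkcond -big_split /=; apply: leq_sum => x _.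
by apply: leq_trans (le x); case: (x \in S).
Qed.

End KempePaths.

From mathcomp Require Import archimedean.
From mathcomp Require Import all_classical all_reals all_analysis.
Import Order.TTheory GRing.Theory Num.Theory.
Import numFieldNormedType.Exports.

Lemma grid_step1 M (i i' j : 'I_M.+1) : i <= i'.+1 -> i' <= i.+1 ->
  ((i, j) == (i', j)) || grid_adj (i, j) (i', j).
Proof.
by rewrite -pair_eqE /grid_adj /pair_eq /= eqxx andbT -val_eqE /= => h h'; case: ltngtP; lia.
Qed.

Lemma grid_step2 M (i j j' : 'I_M.+1) : j <= j'.+1 -> j' <= j.+1 ->
  ((i, j) == (i, j')) || grid_adj (i, j) (i, j').
Proof.
by rewrite -pair_eqE /grid_adj /pair_eq /= eqxx /= -val_eqE /= => h h'; case: ltngtP; lia.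
Qed.

(** * Approximating plane sets by grid cells *)

Section Cells.
Local Open Scope classical_set_scope.
Local Open Scope ring_scope.
Variable R : realType.
Implicit Types (K : set (R * R)) (q : R * R) (m B : nat).

Lemma compact_separated K K' : compact K -> compact K' -> K `&` K' = set0 ->
  exists2 d : R, 0 < d & forall q q', K q -> K' q' -> d <= `|q - q'|.
Proof.
move=> cK cK' dis; have [KK0|] := pselect (K `*` K' !=set0); last first.
  move=> no; exists 1 => // q q' Kq Kq'; exfalso; apply: no; by exists (q, q').
have cf : {within K `*` K', continuous (fun z : (R * R) * (R * R) => `|z.1 - z.2|)}.
  apply: continuous_subspaceT => z; apply: cvg_norm; apply: cvgB; [exact: cvg_fst | exact: cvg_snd].
have [c + cmin] := compact_EVT_min KK0 (compact_setX cK cK') cf.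
rewrite inE => -[/= Kc Kc']; exists `|c.1 - c.2|; last first.
  by move=> q q' Kq Kq'; apply: (cmin (q, q')); rewrite inE.
rewrite normr_gt0 subr_eq0; apply/eqP=> c12.
by have : (K `&` K') c.1; [split=> //; rewrite c12 | rewrite dis].
Qed.

Lemma compact_norm_bound K : compact K -> exists B, forall q, K q -> `|q| <= B%:R.
Proof.
move/compact_bounded/ex_strict_bound_gt0=> [b _ hb]; exists (Num.trunc b).+1 => q Kq.
by apply: ltW; apply: lt_trans (hb q Kq) (truncnS_gt b).
Qed.

(* The plane is cut into cells of side [1/m], its points being translated by [(B, B)];
   a cell is close to [q] when it is the cell of [q] or one of its eight neighbors. *)
Definition cell_index m B (t : R) : nat := Num.trunc (m%:R * (t + B%:R)).

Definition close_cell m B M (c : 'I_M.+1 * 'I_M.+1) q :=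
  [&& (c.1 <= (cell_index m B q.1).+1)%N, (cell_index m B q.1 <= c.1.+1)%N,
      (c.2 <= (cell_index m B q.2).+1)%N & (cell_index m B q.2 <= c.2.+1)%N].

Definition cells m B M K : {set 'I_M.+1 * 'I_M.+1} :=
  [set c | `[< exists2 q, K q & close_cell m B c q >]].

Lemma trunc_close (x y : R) : 0 <= x -> 0 <= y -> `|x - y| < 1 ->
  (Num.trunc x <= (Num.trunc y).+1)%N.
Proof.
move=> x0 y0 xy; have /andP[x1 _] := truncn_itv x0; have /andP[_ y2] := truncn_itv y0.
rewrite -ltnS -(ltr_nat R); apply: le_lt_trans x1 _.
rewrite -addn1 natrD; have := ler_norm (x - y); lra.
Qed.

(** Being close to the same cell lets the indices differ by at most two, so the scaled coordinates
    differ by less than 3. *)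
Lemma close_trunc (x y : R) (i j k : nat) : 0 <= x -> 0 <= y -> Num.trunc x = i -> Num.trunc y = j ->
  (i <= k.+1)%N -> (k <= j.+1)%N -> x - y < 3.
Proof.
move=> x0 y0 xi yj ik kj; have /andP[_ x1] := truncn_itv x0; have /andP[y2 _] := truncn_itv y0.
have : (i <= j + 2)%N by lia.
rewrite -(ler_nat R) natrD; move: x1 y2; rewrite xi yj -(addn1 i) natrD; lra.
Qed.

Section Mesh.
Variables (m B M : nat).
Hypothesis m0 : (0 < m)%N.
Hypothesis BM : (2 * m * B <= M)%N.

Lemma scaled_ge0 (t : R) : `|t| <= B%:R -> 0 <= m%:R * (t + B%:R).
Proof. by rewrite ler_norml => /andP[h _]; rewrite mulr_ge0 // -lerBlDr sub0r. Qed.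

Lemma cell_index_le (t : R) : `|t| <= B%:R -> (cell_index m B t <= M)%N.
Proof.
move=> tB; apply: leq_trans BM; rewrite truncn_le_nat -addn1 natrD !natrM.
move: (tB); rewrite ler_norml => /andP[_ h].
apply: (@le_lt_trans _ _ (m%:R * (B%:R + B%:R))); last first.
  have -> : m%:R * (B%:R + B%:R) = 2%:R * m%:R * B%:R :> R by ring.
  by rewrite ltrDl ltr01.
by rewrite ler_wpM2l // lerD2r.
Qed.

Lemma norm_prod_le q : `|q| <= B%:R -> `|q.1| <= B%:R /\ `|q.2| <= B%:R.
Proof. by rewrite prod_normE ge_max => /andP. Qed.

Definition cell_of q : 'I_M.+1 * 'I_M.+1 := (inord (cell_index m B q.1), inord (cell_index m B q.2)).

Lemma val_cell_of q : `|q| <= B%:R ->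
  (cell_of q).1 = cell_index m B q.1 :> nat /\ (cell_of q).2 = cell_index m B q.2 :> nat.
Proof. by move=> /norm_prod_le[h1 h2]; rewrite /= !inordK ?ltnS ?cell_index_le. Qed.

Lemma close_cell_of q : `|q| <= B%:R -> close_cell m B (cell_of q) q.
Proof. by move=> qB; have [h1 h2] := val_cell_of qB; rewrite /close_cell h1 h2 !leqnSn. Qed.

Lemma cell_of_close q q' : `|q| <= B%:R -> `|q'| <= B%:R -> `|q - q'| < m%:R^-1 ->
  close_cell m B (cell_of q') q.
Proof.
move=> qB q'B; have [h1 h2] := val_cell_of q'B; rewrite /close_cell h1 h2 => lt.
have [[a1 a2] [b1 b2]] := (norm_prod_le qB, norm_prod_le q'B).
have [c1 c2] : `|q.1 - q'.1| < m%:R^-1 /\ `|q.2 - q'.2| < m%:R^-1.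
  by move: lt; rewrite prod_normE gt_max => /andP.
have key (s t : R) : `|s| <= B%:R -> `|t| <= B%:R -> `|s - t| < m%:R^-1 ->
    (cell_index m B s <= (cell_index m B t).+1)%N.
  move=> sB tB st; apply: trunc_close; try exact: scaled_ge0.
  rewrite -mulrBr opprD addrACA subrr addr0 normrM normr_nat.
  by rewrite mulrC -ltr_pdivlMr ?ltr0n // mul1r.
by rewrite !key // distrC.
Qed.

Lemma close_cell_dist (c : 'I_M.+1 * 'I_M.+1) q q' : `|q| <= B%:R -> `|q'| <= B%:R ->
  close_cell m B c q -> close_cell m B c q' -> m%:R * `|q - q'| < 3.
Proof.
move=> /norm_prod_le[a1 a2] /norm_prod_le[b1 b2] /and4P[h1 h2 h3 h4] /and4P[k1 k2 k3 k4].
have key (s t : R) (k : nat) : `|s| <= B%:R -> `|t| <= B%:R -> (k <= (cell_index m B s).+1)%N ->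
    (cell_index m B s <= k.+1)%N -> (k <= (cell_index m B t).+1)%N ->
    (cell_index m B t <= k.+1)%N -> m%:R * `|s - t| < 3.
  move=> sB tB s1 s2 t1 t2; have E : m%:R * (s - t) = m%:R * (s + B%:R) - m%:R * (t + B%:R).
    by rewrite -mulrBr opprD addrACA subrr addr0.
  have -> : m%:R * `|s - t| = `|m%:R * (s - t)| by rewrite normrM normr_nat.
  rewrite ltr_norml E ltrNl opprB.
  by rewrite !(@close_trunc _ _ _ _ k _ _ erefl erefl) ?scaled_ge0.
rewrite prod_normE maxr_pMr ?ler0n // gt_max.
by rewrite (key _ _ c.1) ?(key _ _ c.2).
Qed.

Lemma cells_disjoint K K' : (forall q, K q -> `|q| <= B%:R) -> (forall q, K' q -> `|q| <= B%:R) ->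
  (forall q q', K q -> K' q' -> 3 <= m%:R * `|q - q'|) ->
  forall c, c \in cells m B M K -> c \notin cells m B M K'.
Proof.
move=> hK hK' far c; rewrite inE => /asboolP[q Kq cq]; rewrite inE; apply/asboolPn=> -[q' Kq' cq'].
by have := close_cell_dist (hK q Kq) (hK' q' Kq') cq cq'; rewrite ltNge far.
Qed.

(** Points of [K] at distance less than [1/m] have cells close to each other, so being joined to the
    cell of [q] is a locally constant property on [K], hence constant because [K] is connected. *)
Lemma cells_connected K : connected K -> (forall q, K q -> `|q| <= B%:R) ->
  {in cells m B M K &, forall c c', connect (rel_on (@grid_adj M) (mem (cells m B M K))) c c'}.
Proof.
move=> conK hK; set S := cells m B M K; set r := rel_on _ _.
have inS q c : K q -> close_cell m B c q -> c \in S.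
  by move=> Kq cq; rewrite inE; apply/asboolP; exists q.
have sr : connect_sym r.
  by apply: sym_connect_sym => u w; rewrite /r /rel_on grid_adj_sym andbCA.
have block q c : K q -> close_cell m B c q -> connect r c (cell_of q).
  move=> Kq cq; have [h1 h2] := val_cell_of (hK q Kq).
  pose c1 := ((cell_of q).1, c.2).
  have cc1 : close_cell m B c1 q.
    by move: cq => /and4P[_ _ k3 k4]; apply/and4P; split; rewrite ?(h1 : c1.1 = _ :> nat).
  have step a b : close_cell m B a q -> close_cell m B b q -> (a == b) || grid_adj a b -> connect r a b.
    move=> ca cb /orP[/eqP -> //|ab]; apply: connect1.
    by rewrite /r /rel_on /= !(inS q) ?ab.
  move: (cq) => /and4P[k1 k2 k3 k4].
  have s1 : (c == c1) || grid_adj c c1.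
    by rewrite /c1 [X in X == _]surjective_pairing [X in grid_adj X]surjective_pairing; apply: grid_step1; rewrite h1.
  have s2 : (c1 == cell_of q) || grid_adj c1 (cell_of q).
    by rewrite /c1 [X in _ == X]surjective_pairing [X in grid_adj _ X]surjective_pairing; apply: grid_step2; rewrite h2.
  have cc := close_cell_of (hK q Kq).
  exact: connect_trans (step _ _ cq cc1 s1) (step _ _ cc1 cc s2).
suff H q q' : K q -> K q' -> connect r (cell_of q) (cell_of q').
  have Sin c : c \in S -> exists2 q, K q & close_cell m B c q by rewrite inE => /asboolP.
  move=> c c' /Sin[q Kq cq] /Sin[q' Kq' cq'].
  apply: connect_trans (block q c Kq cq) (connect_trans (H q q' Kq Kq') _).
  by rewrite sr; apply: block Kq' cq'.
move=> Kq Kq'; pose Q z := connect r (cell_of q) (cell_of z).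
have local z : K z -> \forall z' \near z, K z' -> Q z' = Q z.
  move=> Kz; apply/nbhs_ballP; exists m%:R^-1; first by rewrite /= invr_gt0 ltr0n.
  move=> z'; rewrite -ball_normE /= => zz' Kz'; rewrite /Q.
  have h := block z _ Kz (cell_of_close (hK z Kz) (hK z' Kz') zz').
  by apply/idP/idP=> hz; apply: connect_trans hz _; rewrite // sr.
suff KE : [set z | K z /\ Q z] = K.
  have : [set z | K z /\ Q z] q' by rewrite KE.
  by case.
apply: conK; first by exists q; split=> //; rewrite /Q connect0.
  exists [set z | \forall z' \near z, K z' -> Q z']; last first.
    apply/seteqP; split=> z [Kz h]; split=> //=; first by near=> z'; move=> Kz'; rewrite (near (local z Kz) z').
    exact: (nbhs_singleton h).
  exact: open_interior.
exists (~` [set z | \forall z' \near z, K z' -> ~ Q z']); last first.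
  apply/seteqP; split=> z [Kz h]; split=> //=.
    by move/nbhs_singleton => /(_ Kz).
  apply: contrapT => nQ; apply: h; near=> z'; move=> Kz'; rewrite (near (local z Kz) z') //.
apply: open_closedC; exact: open_interior.
Unshelve. all: by end_near. Qed.

End Mesh.
End Cells.

(** * Plane drawings as grid minors *)

Section Drawing.
Local Open Scope classical_set_scope.
Local Open Scope ring_scope.
Variable R : realType.

(** Disjoint compact sets have positive distance. The mesh [m] is fine enough to make each of these
    finitely many distances at least [3/m], whereas two points close to a common cell are less than
    [3/m] apart. *)
Lemma discretize (J : finType) (K : J -> set (R * R)) :
  (forall j, compact (K j)) -> (forall j, connected (K j)) ->
  exists M (S : J -> {set 'I_M.+1 * 'I_M.+1}),
  [/\ forall j, {in S j &, forall c c', connect (rel_on (@grid_adj M) (mem (S j))) c c'},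
      forall j j', K j `&` K j' = set0 -> forall c, c \in S j -> c \notin S j'
    & forall j j' q, K j q -> K j' q -> exists2 c, c \in S j & c \in S j'].
Proof.
move=> cK conK.
have [b hb] := fin_all_exists (fun j => compact_norm_bound (cK j)).
pose B := (\max_j b j)%N.
have KB j q : K j q -> `|q| <= B%:R.
  by move=> Kq; apply: le_trans (hb j q Kq) _; rewrite ler_nat leq_bigmax.
have far (jj : J * J) : exists k : nat, K jj.1 `&` K jj.2 = set0 ->
    forall q q', K jj.1 q -> K jj.2 q' -> 3 <= k%:R * `|q - q'|.
  have [dis|nd] := pselect (K jj.1 `&` K jj.2 = set0); last by exists 0%N => /nd.
  have [d d0 hd] := compact_separated (cK jj.1) (cK jj.2) dis.
  exists (Num.trunc (3 / d)).+1 => _ q q' Kq Kq'.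
  have h1 := truncnS_gt (3 / d); have h2 := hd q q' Kq Kq'.
  apply: le_trans (_ : (Num.trunc (3 / d)).+1%:R * d <= _); last by rewrite ler_wpM2l ?ler0n.
  by rewrite -ler_pdivrMr //; apply: ltW.
have [k hk] := fin_all_exists far.
pose m := (\max_jj k jj).+1; pose M := (2 * m * B)%N.
exists M, (fun j => cells m B M (K j)); split.
- by move=> j; apply: cells_connected => //; apply: KB.
- move=> j j' dis; apply: (@cells_disjoint R m B M) => //; try exact: KB.
  move=> q q' Kq Kq'; apply: le_trans (hk (j, j') dis q q' Kq Kq') _.
  by rewrite ler_wpM2r // ler_nat ltnW // ltnS leq_bigmax.
- move=> j j' q Kq Kq'; exists (cell_of m B M q).
    by rewrite inE; apply/asboolP; exists q => //; apply: close_cell_of => //; apply: KB Kq.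
  by rewrite inE; apply/asboolP; exists q => //; apply: close_cell_of => //; apply: KB Kq.
Qed.

Lemma star_compact_connected (I : finType) (P : pred I) (A : set (R * R)) (F : I -> set (R * R)) :
  compact A -> connected A ->
  (forall i, P i -> [/\ compact (F i), connected (F i) & A `&` F i !=set0]) ->
  compact [set q | A q \/ exists i, P i /\ F i q] /\
  connected [set q | A q \/ exists i, P i /\ F i q].
Proof.
move=> cA nA HF.
suff H (s : seq I) : let S := [set q | A q \/ exists i, [/\ i \in s, P i & F i q]] in compact S /\ connected S.
  rewrite (_ : [set q | _] = [set q | A q \/ exists i, [/\ i \in enum I, P i & F i q]]); first exact: H.
  apply/seteqP; split=> q /= [|[i]]; try by left.
    by case=> h1 h2; right; exists i; rewrite mem_enum.
  by case=> _ h1 h2; right; exists i.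
elim: s => [|i s [IHc IHn]] /=.
  rewrite (_ : [set q | _] = A); first by [].
  by apply/seteqP; split=> q /= => [[|[i []]]|]; [| | left].
case Pi : (P i); last first.
  rewrite (_ : [set q | _] = [set q | A q \/ exists i, [/\ i \in s, P i & F i q]]) //.
  apply/seteqP; split=> q /= [|[j [js Pj Fj]]]; try by left.
    right; exists j; split=> //; move: js; rewrite inE => /orP[/eqP ji|//]; by rewrite ji Pi in Pj.
  by right; exists j; split=> //; rewrite inE js orbT.
have [cF nF [q0 [Aq0 Fq0]]] := HF i Pi.
rewrite (_ : [set q | _] = [set q | A q \/ exists i, [/\ i \in s, P i & F i q]] `|` F i).
  split; first exact: compactU.
  by apply: connectedU => //; exists q0; split=> //=; left.
apply/seteqP; split=> q /=.
- case=> [Aq|[j [js Pj Fj]]]; first by left; left.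
  by move: js; rewrite inE => /orP[/eqP ji|js]; [right; rewrite -ji | left; right; exists j].
- case=> [[Aq|[j [js Pj Fj]]]|Fq]; first by left.
    by right; exists j; split=> //; rewrite inE js orbT.
  by right; exists i; rewrite mem_head.
Qed.

(** Edges are oriented by [o] and each arc is cut at parameter 1/2. The star [X x] consists of the
    point of [x] and the first halves of its outgoing arcs; the second halves [K2] join the stars.
    Different stars are disjoint, a second half meets only the stars of its two ends, and second
    halves of different edges can meet only at a common final end. After discretization these are
    the hypotheses of [grid_minor]. *)
Lemma planar_plane_map (G : sgraph) (v0 : G) : Defs.planar R G ->
  exists (D : finType) (e n : {perm D}) (L : {set D}) (p : D -> G),
    [/\ involutive e, plane_map e n L p & adj e L p =2 @sedge G].
Proof.
case=> pos [arc [posI arcE arcV arcX]].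
pose o : rel G := fun x y => sedge x y && (enum_rank x < enum_rank y)%N.
have oasym x y : o x y -> o y x -> False.
  by move=> /andP[_ h1] /andP[_ h2]; move: (ltn_trans h1 h2); rewrite ltnn.
have ex_gam (xy : G * G) : exists g : R -> R * R, o xy.1 xy.2 ->
   [/\ {within `[0, 1], continuous g}, {in `[0, 1] &, injective g},
       g 0 = pos xy.1, g 1 = pos xy.2 & arc xy.1 xy.2 = g @` `[0, 1]].
  have [oxy|] := pselect (o xy.1 xy.2); last by move=> no; exists (fun _ => pos xy.1).
  have /andP[sxy _] := oxy; have [[g hg] _] := arcE _ _ sxy.
  by exists g.
have [gam hgam] := fin_all_exists ex_gam.
pose K1 x y := gam (x, y) @` `[0, 1/2]; pose K2 x y := gam (x, y) @` `[1/2, 1].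
have sub1 : `[0, 1/2 : R] `<=` `[0, 1].
  by move=> t /=; rewrite !in_itv /= => /andP[-> h] /=; apply: le_trans h _; lra.
have sub2 : `[1/2 : R, 1] `<=` `[0, 1].
  by move=> t /=; rewrite !in_itv /= => /andP[h ->]; rewrite andbT; apply: le_trans h; lra.
have K1top x y : o x y -> compact (K1 x y) /\ connected (K1 x y).
  move=> oxy; have [cg _ _ _ _] := hgam (x, y) oxy; have cg1 := continuous_subspaceW sub1 cg.
  split; first exact: continuous_compact cg1 (@segment_compact _ _ _).
  exact: connected_continuous_connected (@segment_connected _ _ _) cg1.
have K2top x y : o x y -> compact (K2 x y) /\ connected (K2 x y).
  move=> oxy; have [cg _ _ _ _] := hgam (x, y) oxy; have cg1 := continuous_subspaceW sub2 cg.
  split; first exact: continuous_compact cg1 (@segment_compact _ _ _).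
  exact: connected_continuous_connected (@segment_connected _ _ _) cg1.
have i0 : (0 : R) \in `[0, 1] by rewrite in_itv /= lexx ler01.
have i1 : (1 : R) \in `[0, 1] by rewrite in_itv /= lexx ler01.
have K1arc x y q : o x y -> K1 x y q -> arc x y q /\ q <> pos y.
  move=> oxy; have [_ inj _ g1 ->] := hgam (x, y) oxy; case=> t t1 <-; have t01 := sub1 t t1; split; first by exists t.
  rewrite -[pos y]g1 => /(inj _ _ _ i1) h; have : t = 1 by apply: h.
  by move=> t_1; move: t1; rewrite t_1 /= in_itv /= => /andP[_]; lra.
have K2arc x y q : o x y -> K2 x y q -> arc x y q /\ q <> pos x.
  move=> oxy; have [_ inj g0 _ ->] := hgam (x, y) oxy; case=> t t1 <-; have t01 := sub2 t t1; split; first by exists t.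
  rewrite -[pos x]g0 => /(inj _ _ _ i0) h; have : t = 0 by apply: h.
  by move=> t_1; move: t1; rewrite t_1 /= in_itv /= => /andP[]; lra.
have K1x x y : o x y -> K1 x y (pos x).
  move=> oxy; have [_ _ g0 _ _] := hgam (x, y) oxy; exists 0 => //=; rewrite in_itv /=; lra.
have K2y x y : o x y -> K2 x y (pos y).
  move=> oxy; have [_ _ _ g1 _] := hgam (x, y) oxy; exists 1 => //=; rewrite in_itv /=; lra.
have mid x y : K1 x y (gam (x, y) (1/2)) /\ K2 x y (gam (x, y) (1/2)).
  by split; exists (1/2) => //=; rewrite in_itv /=; lra.
have arc_meet x y z w q : o x y -> o z w -> (x, y) <> (z, w) -> arc x y q -> arc z w q ->
    q = pos x \/ q = pos y.
  move=> oxy ozw ne qa qb; have /andP[sxy _] := oxy; have /andP[szw _] := ozw.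
  have [//|no] := pselect (q = pos x \/ q = pos y); exfalso.
  have ne1 : (z, w) <> (x, y) by move/esym.
  have ne2 : (z, w) <> (y, x) by case=> zy wx; move: ozw; rewrite zy wx; apply: oasym.
  have := arcX x y z w sxy szw ne1 ne2; rewrite -subset0 => /(_ q) H.
  by apply: H; split=> //; split.
have arc_vertex x y z : o x y -> arc x y (pos z) -> z = x \/ z = y.
  by move=> /andP[sxy _]; apply: arcV.
pose X x := [set q | pos x = q \/ exists y, o x y /\ K1 x y q].
have Xtop x : compact (X x) /\ connected (X x).
  apply: (@star_compact_connected G (o x) [set q | pos x = q] (K1 x)).
  - by rewrite (_ : [set q | _] = [set pos x]); [exact: compact_set1 | apply/seteqP; split=> q /= ->].
  - by rewrite (_ : [set q | _] = [set pos x]); [exact: connected1 | apply/seteqP; split=> q /= ->].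
  - by move=> y oxy; have [h1 h2] := K1top x y oxy; split=> //; exists (pos x); split=> //; apply: K1x.
have XX x z q : X x q -> X z q -> x = z.
  have pK x' z' y' : o z' y' -> K1 z' y' (pos x') -> x' = z'.
    move=> ozy /K1arc -/(_ ozy)[h1 h2]; case: (arc_vertex _ _ _ ozy h1) => // xy.
    by case: h2; rewrite xy.
  case=> [<-|[y [oxy q1]]] [|[w [ozw q2]]]; first by move/posI.
  - exact: pK ozw q2.
  - by move=> zq; apply/esym; apply: pK oxy _; rewrite zq.
  have [xy|ne] := pselect ((x, y) = (z, w)); first by case: xy.
  have [a1 n1] := K1arc _ _ _ oxy q1; have [a2 n2] := K1arc _ _ _ ozw q2.
  case: (arc_meet _ _ _ _ _ oxy ozw ne a1 a2) => // qx.
  by apply: pK ozw _; rewrite -qx.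
have K2X x y z q : o x y -> K2 x y q -> X z q -> z = x \/ z = y.
  move=> oxy q2; have [a1 n1] := K2arc _ _ _ oxy q2; case=> [zq|[w [ozw q1]]].
    by apply: arc_vertex oxy _; rewrite zq.
  have [xy|ne] := pselect ((x, y) = (z, w)); first by case: xy; left.
  have [a2 n2] := K1arc _ _ _ ozw q1.
  case: (arc_meet _ _ _ _ _ oxy ozw ne a1 a2) => // qy.
  have a2' : arc z w (pos y) by rewrite -qy.
  by case: (arc_vertex _ _ _ ozw a2') => yz; [right | case: n2; rewrite qy yz].
have K2K2 x y x' y' q : o x y -> o x' y' -> K2 x y q -> K2 x' y' q -> y = y'.
  move=> oxy oxy' q1 q2; have [a1 n1] := K2arc _ _ _ oxy q1; have [a2 n2] := K2arc _ _ _ oxy' q2.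
  have [xy|ne] := pselect ((x, y) = (x', y')); first by case: xy.
  case: (arc_meet _ _ _ _ _ oxy oxy' ne a1 a2) => // qy.
  have a2' : arc x' y' (pos y) by rewrite -qy.
  by case: (arc_vertex _ _ _ oxy' a2') => // yx; case: n2; rewrite qy yx.
pose K (j : G + G * G) := match j with
  | inl x => X x | inr (x, y) => if o x y then K2 x y else set0 end.
have Kc j : compact (K j).
  case: j => [x|[x y]] /=; first by have [] := Xtop x.
  by case: ifP => [/K2top[]//|_]; apply: compact0.
have Kn j : connected (K j).
  case: j => [x|[x y]] /=; first by have [] := Xtop x.
  by case: ifP => [/K2top[]//|_]; apply: connected0.
have [M [S [S1 S2 S3]]] := discretize Kc Kn.
have S2' j j' c : c \in S j -> c \in S j' -> exists2 q, K j q & K j' q.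
  move=> cj cj'; have [dis|] := pselect (K j `&` K j' = set0).
    by move: cj'; rewrite (negbTE (S2 j j' dis c cj)).
  by move/eqP/set0P=> [q [? ?]]; exists q.
apply: (@grid_minor M G (@sedge G) o v0 (fun x => S (inl x)) (fun x y => S (inr (x, y)))).
- exact: sg_sym.
- exact: sg_irrefl.
- by move=> x y /andP[].
- move=> x y sxy; rewrite /o sxy sg_sym sxy /=; case: ltngtP => // /val_inj/enum_rank_inj xy.
  by move: sxy; rewrite xy sg_irrefl.
- by move=> x; apply: S1.
- by move=> x y c cx cy; have [q] := S2' _ _ _ cx cy; apply: XX.
- by move=> x y oxy; apply: S1.
- move=> x y oxy; have [m1 m2] := mid x y; apply: (S3 (inr (x, y)) (inl x) (gam (x, y) (1 / 2))).
    by rewrite /K oxy.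
  by right; exists y.
- move=> x y oxy; apply: (S3 (inr (x, y)) (inl y) (pos y)); last by left.
  by rewrite /K oxy; apply: K2y.
- move=> x y z c oxy c1 c2; have [q] := S2' _ _ _ c1 c2; rewrite /K oxy; exact: K2X.
- move=> x y x' y' c oxy oxy' c1 c2; have [q] := S2' _ _ _ c1 c2; rewrite /K oxy oxy'; exact: K2K2.
Qed.

End Drawing.

Local Open Scope ring_scope.

Theorem theorem1p5 (R : realType) :
  exists c C : R, [/\ 0 < c, 0 < C &
    forall G : sgraph, planar R G ->
    forall alpha beta : kempe_graph G 5,
    exists p : seq (kempe_graph G 5),
      [/\ path (@sedge (kempe_graph G 5)) alpha p,
          last alpha p = beta
        & (size p)%:R <= C * #|G|%:R `^ c]].
Proof.
have [A [c [A0 reachP]]] := reach_polynomial.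
(* The additional power of [#|G|] comes from summing the bound per vertex over all vertices. [A0] is
   absorbed because [#|G| ^ c] is at least 1, and the successors ensure positivity. *)
exists c.+1%:R, (A + A0).+1%:R; split; rewrite ?ltr0n // => G planarG alpha beta.
(* The empty graph has a single coloring, joined to itself by the empty path. *)
have [v0|noV] := pickP (@predT G); last first.
  exists [::]; split=> //; last by rewrite mulr_ge0 ?ler0n ?powR_ge0.
  by apply: val_inj; apply/ffunP=> x; have := noV x.
move=> _; have [D [e [n [L [p [eK M EE]]]]]] := planar_plane_map v0 planarG.
have irr : irreflexive (adj e L p) by move=> u; rewrite EE sg_irrefl.
have pr (gamma : kempe_graph G 5) : proper_for (adj e L p) (val gamma).
  move=> u w; rewrite EE => uw; exact: (implyP (forallP (forallP (valP gamma) u) w)).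
have := eq_reach EE (reachP G D e n L p eK M irr _ _ (pr alpha) (pr beta)).
case/reach_path/(_ alpha erefl)=> s [ps ls ss]; exists s; split=> //; first exact: val_inj.
rewrite powR_mulrn ?ler0n // -natrX -natrM ler_nat; apply: leq_trans ss _.
rewrite sum_nat_const -[X in (_ <= _ * X)%N]/(#|G| ^ c.+1)%N expnS mulnCA leq_mul2l; apply/orP; right.
have N0 : (0 < #|G|)%N by apply/card_gt0P; exists v0.
have le1 : (#|p @: L| ^ c <= #|G| ^ c)%N.
  by case: (c) => // c'; rewrite leq_exp2r // max_card.
have le2 : (0 < #|G| ^ c)%N by rewrite expn_gt0 N0.
rewrite mulSn mulnDl; apply: leq_trans (leq_addl _ _); apply: leq_add.
  by rewrite leq_mul2l le1 orbT.
by rewrite leq_pmulr.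
Qed.
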